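(* There exist an infinite sequence of positive integers $n \to \infty$ and, for each such $n$, a closed polygonal curve $P_n$ having $n$ line segments embedded in $\mathbb{R}^3$, such that any embedded triangulated PL surface in $\mathbb{R}^3$ that is oriented and has a PL subdivision of $P_n$ as its boundary contains at least $\frac{n^2}{2} - 3n + 5$ triangles.
   Context: A closed polygonal curve with $n$ line segments embedded in $\mathbb{R}^3$ is a simple closed curve that is a cyclic union of $n$ straight line segments (edges). An embedded triangulated PL surface in $\mathbb{R}^3$ is a compact 2-manifold with boundary (of arbitrary genus) that is given as the union of a finite simplicial complex of (flat) triangles in $\mathbb{R}^3$. Having a PL subdivision of $P_n$ as boundary means that the boundary of the surface, as a point set, is exactly $P_n$, where extra vertices of the triangulation are allowed to lie on the edges of $P_n$. *)

(* Defs.v *)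
From HB Require Import structures.
From mathcomp Require Import all_boot all_order all_algebra finmap.
From mathcomp Require Import all_classical all_reals topology normedtype.

Set Implicit Arguments.
Unset Strict Implicit.
Unset Printing Implicit Defensive.

Import Order.TTheory GRing.Theory Num.Theory.
Import numFieldNormedType.Exports.

Local Open Scope classical_set_scope.
Local Open Scope ring_scope.

(* [ordS i] is the cyclic successor i + 1 mod n. *)
Definition edge_point (R : realType) (n : nat) (P : 'I_n -> 'rV[R]_3)
    (i : 'I_n) (t : R) : 'rV[R]_3 :=
  (1 - t) *: P i + t *: P (ordS i).

Definition polygon (R : realType) (n : nat) (P : 'I_n -> 'rV[R]_3) :
    set 'rV[R]_3 :=
  [set x | exists (i : 'I_n) (t : R), 0 <= t <= 1 /\ x = edge_point P i t].

(* Injectivity of the closed parametrization: the half-open edges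
   [P i, P (i + 1)) are non-degenerate and pairwise disjoint.  For n > 0 this
   forces n >= 3. *)
Definition embedded_polygon (R : realType) (n : nat) (P : 'I_n -> 'rV[R]_3) :
    Prop :=
  forall (i j : 'I_n) (t u : R), 0 <= t < 1 -> 0 <= u < 1 ->
    edge_point P i t = edge_point P j u -> i = j /\ t = u.

Definition hull (R : realType) (s : {fset 'rV[R]_3}) : set 'rV[R]_3 :=
  [set x | exists w : 'rV[R]_3 -> R,
    [/\ forall v, v \in s -> 0 <= w v,
        \sum_(v <- s) w v = 1 &
        x = \sum_(v <- s) w v *: v]].

Definition affinely_independent (R : realType) (s : {fset 'rV[R]_3}) : Prop :=
  forall w : 'rV[R]_3 -> R,
    \sum_(v <- s) w v = 0 -> \sum_(v <- s) w v *: v = 0 ->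
    forall v, v \in s -> w v = 0.

(* A finite simplicial complex of triangles is given by the vertex sets of its
   triangles.  The lower-dimensional simplices are the faces of these, and all
   of them intersect in common faces as soon as the triangles do; the
   intersection is empty when no vertex is shared, since [hull fset0] is empty. *)
Definition triangle_complex (R : realType) (T : {fset {fset 'rV[R]_3}}) : Prop :=
  (forall s, s \in T -> #|` s| = 3%N /\ affinely_independent s) /\
  (forall s t, s \in T -> t \in T ->
     hull s `&` hull t = hull (s `&` t)%fset).

Definition carrier (R : realType) (T : {fset {fset 'rV[R]_3}}) :
    set 'rV[R]_3 :=
  [set x | exists2 s, s \in T & hull s x].

Definition half_plane (R : realType) : set 'rV[R]_2 :=
  [set p | 0 <= p ord0 ord0].

Definition relatively_open (X : topologicalType) (M U : set X) : Prop :=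
  exists2 O : set X, open O & U = M `&` O.

Definition homeomorphism_on (X Y : topologicalType) (U : set X) (V : set Y)
    (f : X -> Y) : Prop :=
  exists g : Y -> X,
    [/\ set_fun U V f, set_fun V U g,
        {in U, cancel f g}, {in V, cancel g f} &
        {within U, continuous f} /\ {within V, continuous g}].

(* [f] restricts to a homeomorphism from an open neighbourhood of [x] in [M]
   onto an open subset of the closed half-plane. *)
Definition half_plane_chart (R : realType) (M : set 'rV[R]_3) (x : 'rV[R]_3)
    (f : 'rV[R]_3 -> 'rV[R]_2) : Prop :=
  exists (U : set 'rV[R]_3) (V : set 'rV[R]_2),
    [/\ relatively_open M U, relatively_open (@half_plane R) V, U x &
        homeomorphism_on U V f].

(* The Hausdorff and second countability axioms hold for every subset of R^3. *)
Definition compact_surface_with_boundary (R : realType) (M : set 'rV[R]_3) :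
    Prop :=
  compact M /\ forall x, M x -> exists f, half_plane_chart M x f.

Definition surface_boundary (R : realType) (M : set 'rV[R]_3) :
    set 'rV[R]_3 :=
  [set x | M x /\ exists2 f, half_plane_chart M x f & f x ord0 ord0 = 0].

Definition embedded_triangulated_surface (R : realType)
    (T : {fset {fset 'rV[R]_3}}) : Prop :=
  triangle_complex T /\ compact_surface_with_boundary (carrier T).

Definition directed_edges (R : realType)
    (o : 'rV[R]_3 * 'rV[R]_3 * 'rV[R]_3) : seq ('rV[R]_3 * 'rV[R]_3) :=
  let: (a, b, c) := o in [:: (a, b); (b, c); (c, a)].

(* An orientation of a triangulated surface: a cyclic order on the vertices of
   each triangle, such that two distinct triangles with a common edge induce
   opposite directions on that edge. *)
Definition orientation (R : realType) (T : {fset {fset 'rV[R]_3}})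
    (o : {fset 'rV[R]_3} -> 'rV[R]_3 * 'rV[R]_3 * 'rV[R]_3) : Prop :=
  (forall s, s \in T -> [fset (o s).1.1; (o s).1.2; (o s).2]%fset = s) /\
  (forall s t a b, s \in T -> t \in T -> s != t ->
     (a, b) \in directed_edges (o s) -> a \in t -> b \in t ->
     (b, a) \in directed_edges (o t)).

(* Main.v *)
(* Take q = p - 1 and realize the (p, q) torus knot as a polygon with n = 2p
   edges, which are alternately rulings of two one-sheeted hyperboloids.  The
   torus cuts the complement of the knot into two solid tori, and there is a
   flat bundle of ordered lines R over the complement whose holonomy commutes
   with the translation by 1.  Some local sections at the knot are invariant
   under the meridian; following one of them once along the knot shifts it by
   the integer N = pq - p - q.

   Let a triangulated oriented surface span the knot.  A triangle minus the knot
   is convex, so that sections chosen near the vertices (meridian invariant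
   ones at the knot) extend over each triangle.  Rounding the difference of the
   sections at the ends of an edge gives an antisymmetric function on oriented
   edges, whose sum around a triangle is at most 1/2 in absolute value, as in
   the Milnor-Wood inequality, and is 0 if the triangle has an edge on the knot.
   Summing over all triangles, the interior edges cancel and the boundary edges
   contribute N up to sign.  If b triangles have an edge on the knot, this gives
   2N + b <= F, where b >= 3 since 3b >= n, and 2N + 3 = n^2/2 - 3n + 5. *)
Require Import Defs.
From HB Require Import structures.
From mathcomp Require Import all_boot all_order all_algebra finmap.
From mathcomp Require Import all_classical all_reals topology normedtype.
From mathcomp Require Import realfun trigo zify ring lra.

Set Implicit Arguments.
Unset Strict Implicit.
Unset Printing Implicit Defensive.

Import Order.TTheory GRing.Theory Num.Theory.
Import numFieldNormedType.Exports.

Local Open Scope classical_set_scope.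
Local Open Scope ring_scope.

(** The choice q = p - 1: a straight edge sweeps less than half a turn around the axis, so a knot
    with 2p edges of this kind winds fewer than p times; q = p - 1 is the largest winding number and
    makes N, which is 2g - 1 for the genus g of the knot, as large as the edges allow. The bundle:
    each solid torus has its own fibre coordinate, in which its core acts by a translation, by N/q
    or N/p up to sign, so that the q-th and the p-th power both become translation by N. The two
    coordinates are related by a piecewise linear map [phi], whose only task is to give the meridian
    a fixed point. The obstacle: sections cannot be continued across the knot, and the surface is
    only known to be a topological manifold. Invariance of the boundary has to be established before
    one knows that the knot meets a triangle in vertices and whole sides only; this gives the
    convexity of the punctured triangle. No two edges of the polygon are parallel, so a boundary
    side of a triangle lies in a single edge. Rounding is doubled throughout (floor plus ceiling),
    so all counts are integers: the bound 1/2 becomes 1 and N becomes 2N. *)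

Lemma near_normP (R : realType) (V : normedModType R) (x : V) (Q : V -> Prop) :
  (\forall z \near x, Q z) <->
  exists2 r : R, 0 < r & forall z, `|z - x| < r -> Q z.
Proof.
split => [/nbhs_normP[r /= r0 h]|[r r0 h]].
  by exists r => // z zr; apply: h => /=; rewrite -opprB normrN.
by apply/nbhs_normP; exists r => //= z /=; rewrite -opprB normrN; exact: h.
Qed.

(** * Continuation along an interval *)

Section UnitInterval.
Variable R : realType.
Implicit Types t u : R.

(** Connectedness of the interval as an induction principle: the supremum of the parameters up to
    which [Q] agrees with [Q 0] cannot stop short of [u]. All continuation arguments along segments
    run through it. *)
Lemma unit_interval_ind (Q : R -> Prop) :
  (forall t, 0 <= t <= 1 -> exists2 d, 0 < d & forall t' t'',
     0 <= t' <= 1 -> 0 <= t'' <= 1 -> `|t' - t| < d -> `|t'' - t| < d ->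
     Q t' -> Q t'') ->
  forall t u, 0 <= t <= 1 -> 0 <= u <= 1 -> Q t -> Q u.
Proof.
move=> Qloc.
suff H u : 0 <= u <= 1 -> (Q u <-> Q 0).
  by move=> t u t01 u01 /(H _ t01).1 /(H _ u01).2.
move=> /andP[u0 u1].
pose S := [set t | 0 <= t <= u /\ forall s, 0 <= s <= t -> (Q s <-> Q 0)].
have S0 : S 0.
  split=> [|s s0]; first by lra.
  by have -> : s = 0 by lra.
have Sub : has_ubound S by exists u => t [/andP[]].
have Ssup : has_sup S by split; [exists 0|].
set c := sup S.
have c0 : 0 <= c by apply: ub_le_sup.
have cu : c <= u by apply: ge_sup => [|t [/andP[]]]; [exists 0|].
have [d d0 Hd] := Qloc c ltac:(lra).
have [t St tc] := sup_adherent d0 Ssup; have tc' : t <= c := ub_le_sup Sub St.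
case: (St) => t0u Ht.
have Qt s : 0 <= s <= 1 -> `|s - c| < d -> (Q s <-> Q 0).
  move=> s01 sc; rewrite -(Ht t) ?lexx ?andbT; last by lra.
  have tcd : `|t - c| < d by rewrite ltr_norml -/c in tc *; apply/andP; lra.
  by split; apply: Hd => //; lra.
have Sm s : 0 <= s <= u -> s < c + d -> S s.
  move=> s0u sc; split=> // r rs.
  case: (lerP r t) => rt; first by apply: Ht; lra.
  by apply: Qt; [lra|rewrite ltr_norml -/c in tc *; apply/andP; lra].
suff uc : u < c + d by apply: (Sm u _ _).2; lra.
rewrite ltNge; apply/negP => cdu.
have : S (c + d / 2) by apply: Sm; lra.
by move=> /(ub_le_sup Sub); rewrite -/c; lra.
Qed.

Lemma unit_interval_const (T : Type) (f : R -> T) :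
  (forall t, 0 <= t <= 1 -> exists2 d, 0 < d & forall t',
     0 <= t' <= 1 -> `|t' - t| < d -> f t' = f t) ->
  f 0 = f 1.
Proof.
move=> floc; apply/esym; pattern (f 1); set Q := fun y => _.
apply: (@unit_interval_ind (fun t => Q (f t)) _ 0 1) => //; try lra.
move=> t t01; have [d d0 Hd] := floc t t01; exists d => // t' t'' a b a' b'.
by rewrite /Q (Hd t') // (Hd t'').
Qed.

End UnitInterval.

(** * Flat sections of a bundle of ordered lines over convex sets *)

Section Transport.
Variables (R : realType) (V : normedModType R).
Implicit Types (D X : set V) (x y z : V) (f g : V -> R).

Definition convex D := forall x y (t : R), D x -> D y -> 0 <= t <= 1 ->
  D ((1 - t) *: x + t *: y).

Lemma convexI D D' : convex D -> convex D' -> convex (D `&` D').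
Proof. by move=> cD cD' x y t [? ?] [? ?] t01; split; [exact: cD|exact: cD']. Qed.

Definition nball x (r : R) := [set z | `|z - x| < r].

Lemma segment_dist x y z w (t : R) : 0 <= t <= 1 ->
  `|(1 - t) *: x + t *: y - ((1 - t) *: z + t *: w)| <=
  (1 - t) * `|x - z| + t * `|y - w|.
Proof.
move=> /andP[t0 t1]; rewrite opprD addrACA -!scalerBr.
rewrite (le_trans (ler_normD _ _)) // !normrZ !ger0_norm //; lra.
Qed.

Lemma convex_nball x (r : R) : convex (nball x r).
Proof.
move=> y z t; rewrite /nball /= => yr zr t01.
have {1}-> : x = (1 - t) *: x + t *: x by rewrite -scalerDl subrK scale1r.
apply: le_lt_trans (segment_dist _ _ _ _ t01) _.
set a := `|y - x| in yr *; set b := `|z - x| in zr *.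
have [t0|t1] := lerP t (1 / 2).
  have : t * b <= t * r by rewrite ler_wpM2l; lra.
  have : (1 - t) * a < (1 - t) * r by rewrite ltr_pM2l; lra.
  by lra.
have : t * b < t * r by rewrite ltr_pM2l; lra.
have : (1 - t) * a <= (1 - t) * r by rewrite ler_wpM2l; lra.
by lra.
Qed.

Lemma segmentE x y (t : R) : (1 - t) *: x + t *: y = x + t *: (y - x).
Proof. by rewrite scalerBl scale1r scalerBr addrAC addrA. Qed.

Lemma segment_near x y (r : R) : 0 < r -> exists2 d, 0 < d & forall t t' : R,
  `|t' - t| < d -> `|((1 - t') *: x + t' *: y) - ((1 - t) *: x + t *: y)| < r.
Proof.
move=> r0; have n0 := normr_ge0 (y - x).
exists (r / (1 + `|y - x|)) => [|t t' h]; first by rewrite divr_gt0 //; lra.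
rewrite !segmentE opprD addrACA subrr add0r -scalerBl.
rewrite normrZ; move: h; rewrite ltr_pdivlMr; last by lra.
by apply: le_lt_trans; rewrite ler_wpM2l //; lra.
Qed.

Variables (X : set V) (std : V -> R -> V -> R).
Hypothesis std_lt : forall x z (v w : R), v < w -> std x v z < std x w z.
Hypothesis std_surj : forall x z (u : R), exists v, std x v z = u.
Hypothesis std_compat : forall x, X x -> \forall y \near x, X y -> forall v,
  exists v', \forall z \near y, X z -> std x v z = std y v' z.

(** [std x v] plays the role of the local constant section at [x] with parameter [v]. Agreement is
    asked only inside [D], which need not be open: it will be a punctured triangle in space. *)
Definition flat D f := forall x, D x ->
  exists v, \forall z \near x, D z -> f z = std x v z.

Lemma flat_sub D D' f : D' `<=` D -> flat D f -> flat D' f.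
Proof.
move=> DD' fD x /DD' /fD[v h]; exists v; near=> z => /DD'.
by near: z.
Unshelve. all: by end_near. Qed.

Lemma flat_std x v : X x -> exists2 r : R, 0 < r &
  flat (X `&` nball x r) (std x v).
Proof.
move=> /std_compat /near_normP[r r0 h]; exists r => // y [Xy yr].
have [v' h'] := h y yr Xy v; exists v'; near=> z => -[Xz _].
by move: Xz; near: z.
Unshelve. all: by end_near. Qed.

Lemma std_le x z (v w : R) : (std x v z < std x w z) = (v < w).
Proof.
case: (ltgtP v w) => [vw|wv|->]; last by rewrite ltxx.
  by rewrite std_lt.
by apply/negbTE; rewrite -leNgt ltW // std_lt.
Qed.

(** Near each point of the segment both functions are model sections based at that point, and
    [std_lt] orders these by their parameters alone. The sign of the comparison is therefore locally
    constant along the segment. *)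
Lemma flat_lt D f g x y : convex D -> flat D f -> flat D g ->
  D x -> D y -> f x < g x -> f y < g y.
Proof.
move=> cD fD gD Dx Dy fgx.
pose p (t : R) := (1 - t) *: x + t *: y.
have Dp t : 0 <= t <= 1 -> D (p t) by exact: cD.
have -> : y = p 1 by rewrite /p subrr scale0r add0r scale1r.
have {}fgx : f (p 0) < g (p 0) by rewrite /p subr0 scale1r scale0r addr0.
apply: (@unit_interval_ind _ (fun t => f (p t) < g (p t)) _ 0 1) fgx; try lra.
move=> t t01.
have [v /near_normP[r r0 hr]] := fD _ (Dp t t01).
have [w /near_normP[s s0 hs]] := gD _ (Dp t t01).
have [d d0 hd] := @segment_near x y (Num.min r s) ltac:(by rewrite lt_min r0).
exists d => // t' t'' t'01 t''01 /hd; rewrite lt_min => /andP[rt' st'] /hd.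
rewrite lt_min => /andP[rt'' st''].
rewrite hr ?hs ?[f (p t'')]hr ?[g (p t'')]hs //; try exact: Dp.
by rewrite !std_le.
Qed.

Lemma flat_eq D f g x y : convex D -> flat D f -> flat D g ->
  D x -> D y -> f x = g x -> f y = g y.
Proof.
move=> cD fD gD Dx Dy fgx; case: (ltgtP (f y) (g y)) => // h.
  by have := flat_lt cD fD gD Dy Dx h; rewrite fgx ltxx.
by have := flat_lt cD gD fD Dy Dx h; rewrite fgx ltxx.
Qed.

Lemma flat_local x : X x -> exists2 r : R, 0 < r & forall y u, X y -> `|y - x| < r ->
  exists2 f, flat (X `&` nball x r) f & f y = u.
Proof.
move=> Xx; have /near_normP[r r0 h] := std_compat Xx.
exists r => // y u Xy yr; have [v <-] := std_surj x y u; exists (std x v) => //.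
move=> z [Xz zr]; have [v' h'] := h z zr Xz v; exists v'; near=> z' => -[Xz' _].
by move: Xz'; near: z'.
Unshelve. all: by end_near. Qed.

Section Tube.
Variables (D : set V) (c y : V) (u : R).
Hypotheses (cD : convex D) (DX : D `<=` X) (Dc : D c) (Dy : D y).

Let p (t : R) := (1 - t) *: c + t *: y.

Let tube (t e : R) :=
  [set z | D z /\ exists2 s : R, 0 <= s <= t & `|z - p s| < e].

Lemma convex_tube t e : convex (tube t e).
Proof.
move=> z z' l [Dz [s s0 zs]] [Dz' [s' s'0 z's]] l01; split; first exact: cD.
exists ((1 - l) * s + l * s'); first by apply/andP; split; nra.
have -> : p ((1 - l) * s + l * s') = (1 - l) *: p s + l *: p s'.
  rewrite /p !scalerDr !scalerA addrACA -!scalerDl; congr (_ *: _ + _ *: _); ring.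
apply: le_lt_trans (segment_dist _ _ _ _ l01) _.
set a := `|_| in zs *; set b := `|_| in z's *.
have [t0|t1] := lerP l (1 / 2).
  have : l * b <= l * e by rewrite ler_wpM2l; lra.
  have : (1 - l) * a < (1 - l) * e by rewrite ltr_pM2l; lra.
  by lra.
have : l * b < l * e by rewrite ltr_pM2l; lra.
have : (1 - l) * a <= (1 - l) * e by rewrite ler_wpM2l; lra.
by lra.
Qed.

Let good (t : R) := exists e : R, 0 < e /\ exists2 f, flat (tube t e) f & f c = u.

(** Flatness concerns neighbourhoods, so the section is continued on a tube around the segment and
    not just on the segment. Tubes are convex, which gives uniqueness on overlaps. *)
Lemma tube_flat : exists e : R, 0 < e /\ exists2 f, flat (tube 1 e) f & f c = u.
Proof.
have p0 : p 0 = c by rewrite /p subr0 scale1r scale0r addr0.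
have Dp t : 0 <= t <= 1 -> D (p t) by exact: cD.
apply: (@unit_interval_ind R good _ 0 1); rewrite ?lexx ?ler01 //; last first.
  have [r r0 h] := flat_local (DX Dc).
  have [f ff fc] := h c u (DX Dc) ltac:(by rewrite subrr normr0).
  exists r; split => //; exists f => //; apply: flat_sub ff => z [Dz [s s0]].
  have -> : s = 0 by lra.
  by rewrite p0; split => //; exact: DX.
move=> t t01; have [r r0 h] := flat_local (DX (Dp t t01)).
have [d d0 hd] := @segment_near c y (r / 2) ltac:(lra).
exists d => // t' t'' t'01 t''01 t'd t''d [e [e0 [f ff fc]]].
have ptt' : `|p t' - p t| < r by apply: lt_trans (hd _ _ t'd) _; lra.
have [g gf gt] := h (p t') (f (p t')) (DX (Dp _ t'01)) ptt'.
(* [d] keeps [p s] within r/2 of [p t]; another r/2 for the width of the tube keeps the new part in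
   the ball where [g] is flat. *)
pose e' := Num.min e (r / 2).
have e'0 : 0 < e' by rewrite lt_min e0; lra.
have e'r : e' <= r / 2 by rewrite ge_min lexx orbT.
have fg z : tube t' e' z -> `|z - p t| < r -> f z = g z.
  move=> tz zr.
  have cI : convex (tube t' e' `&` nball (p t) r).
    by apply: convexI; [exact: convex_tube|exact: convex_nball].
  have ff' : flat (tube t' e' `&` nball (p t) r) f.
    apply: flat_sub ff => w [[Dw [s s0 ws]] _]; split => //; exists s => //.
    by apply: lt_le_trans ws _; rewrite ge_min lexx.
  have gf' : flat (tube t' e' `&` nball (p t) r) g.
    by apply: flat_sub gf => w [[Dw _] wr]; split => //; exact: DX.
  apply: (flat_eq cI ff' gf') (esym gt); last by split.
  split => //; split; first exact: Dp.
  by exists t'; [lra|rewrite subrr normr0].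
exists e'; split => //.
(* The old section on the thinner tube up to [t'], the local one beyond; by [fg] they agree on the
   convex overlap. *)
exists (fun z => if pselect (tube t' e' z) then f z else g z); last first.
  case: pselect => // -[]; split => //; exists 0; first lra.
  by rewrite p0 subrr normr0.
move=> z [Dz [s s0 zs]].
have [st'|st'] := lerP s t'.
  have tz : tube t' e' z by split => //; exists s => //; lra.
  have [v /near_normP[k k0 hk]] : exists v, \forall z' \near z, tube t' e z' ->
      f z' = std z v z'.
    apply: ff; split => //; exists s; first lra.
    by apply: lt_le_trans zs _; rewrite ge_min lexx.
  exists v; apply/near_normP; exists (Num.min k (e' - `|z - p s|)).
    by rewrite lt_min k0 subr_gt0.
  move=> z'; rewrite lt_min => /andP[z'k z'e] [Dz' _].
  have tz' : `|z' - p s| < e'.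
    rewrite -(subrK z z') -addrA (le_lt_trans (ler_normD _ _)) //; lra.
  case: pselect => [?|[]]; last by split => //; exists s => //; lra.
  apply: hk => //; split => //; exists s; first lra.
  by apply: lt_le_trans tz' _; rewrite ge_min lexx.
have sr : `|p s - p t| < r / 2.
  by apply: hd; move: t'd t''d; rewrite !ltr_norml => /andP[? ?] /andP[? ?]; apply/andP; lra.
have zr : `|z - p t| < r.
  rewrite -(subrK (p s) z) -addrA (le_lt_trans (ler_normD _ _)) //; lra.
have [v /near_normP[k k0 hk]] := gf z (conj (DX Dz) zr).
exists v; apply/near_normP; exists (Num.min k (r - `|z - p t|)).
  by rewrite lt_min k0 subr_gt0.
move=> z'; rewrite lt_min => /andP[z'k z'r] [Dz' _].
have z'r' : `|z' - p t| < r.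
  rewrite -(subrK z z') -addrA (le_lt_trans (ler_normD _ _)) //; lra.
rewrite -(hk z' z'k); last by split => //; exact: DX.
by case: pselect => // tz'; rewrite fg.
Qed.

Lemma transport_along : exists T f, [/\ convex T, T c, flat T f, f c = u &
  [/\ T `<=` D, T y & \forall z \near y, D z -> T z]].
Proof.
have [e [e0 [f ff fc]]] := tube_flat.
have p1 : p 1 = y by rewrite /p subrr scale0r add0r scale1r.
exists (tube 1 e), f; split => //; first exact: convex_tube.
- split => //; exists 0; first lra.
  by rewrite /p subr0 scale1r scale0r addr0 subrr normr0.
- split; first by move=> z [].
    by split => //; exists 1; [lra|rewrite p1 subrr normr0].
  apply/near_normP; exists e => // z ze Dz; split => //; exists 1; first lra.
  by rewrite p1.
Qed.

End Tube.

(** A convex set has no monodromy: the value at [y] is transported along the straight segment from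
    [c]. For [z] near [y] the tubes around the two segments meet in a convex set containing [c] and
    [z], so both transports give the same value at [z]. *)
Theorem flat_exists D c u : convex D -> D `<=` X -> D c ->
  exists2 f, flat D f & f c = u.
Proof.
move=> cD DX Dc.
have H y : exists Tf : set V * (V -> R), D y -> [/\ convex Tf.1, Tf.1 c, flat Tf.1 Tf.2, Tf.2 c = u &
    [/\ Tf.1 `<=` D, Tf.1 y & \forall z \near y, D z -> Tf.1 z]].
  have [Dy|nDy] := pselect (D y); last by exists (set0, fun=> 0).
  have [T [f h]] := transport_along u cD DX Dc Dy; by exists (T, f).
have [F HF] := choice H.
exists (fun y => (F y).2 y); last by have [_ _ _] := HF c Dc.
move=> y Dy; have [cT Tc fT fc [TD Ty nT]] := HF y Dy.
have [v hv] := fT y Ty; exists v; near=> z => Dz.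
have Tz : (F y).1 z by move: Dz; near: z.
have [cT' T'c fT' fc' [TD' T'z _]] := HF z Dz.
transitivity ((F y).2 z); last by move: Tz; near: z.
apply: (@flat_eq ((F z).1 `&` (F y).1) _ _ c z) => //.
- exact: convexI.
- by apply: flat_sub fT' => ? [].
- by apply: flat_sub fT => ? [].
- by rewrite fc fc'.
Unshelve. all: by end_near. Qed.

End Transport.

(** * Angles in turns, modulo 1 *)

Section CenteredFraction.
Variable R : realType.
Implicit Types t r : R.

(** The representative of [t] modulo 1 in [-1/2, 1/2). Differences of angles are measured through
    it, so an angle function may jump by integers. *)
Definition cfrac t : R := t - (Num.floor (t + 1 / 2))%:~R.

Lemma cfrac_itv t : - (1 / 2) <= cfrac t < 1 / 2.
Proof.
rewrite /cfrac; have := Num.Theory.floor_itv (t + 1 / 2).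
by rewrite intrD => /andP[]; lra.
Qed.

Lemma cfracE t : exists k : int, t = cfrac t + k%:~R.
Proof. by exists (Num.floor (t + 1 / 2)); rewrite /cfrac subrK. Qed.

Lemma cfrac_uniq t r (k : int) : `|r| < 1 / 2 -> t = r + k%:~R -> cfrac t = r.
Proof.
rewrite ltr_norml => /andP[r0 r1] ->; rewrite /cfrac.
have -> : Num.floor (r + k%:~R + 1 / 2) = k; last by rewrite addrK.
by apply: Num.Theory.floor_def; rewrite intrD; apply/andP; split; lra.
Qed.

Lemma cfracD t r : `|cfrac t| < 1 / 4 -> `|cfrac r| < 1 / 4 ->
  cfrac (t + r) = cfrac t + cfrac r.
Proof.
have [k hk] := cfracE t; have [l hl] := cfracE r => ht hr.
apply: (@cfrac_uniq _ _ (k + l)); last by rewrite intrD {1}hk {1}hl; ring.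
by apply: le_lt_trans (ler_normD _ _) _; lra.
Qed.

Lemma cosDint t (k : int) : cos (2 * pi * (t + k%:~R)) = cos (2 * pi * t).
Proof.
have H x (n : nat) : cos (x + 2 * pi * n%:R) = cos x :> R.
  have -> : 2 * pi * n%:R = (pi *+ 2) *+ n :> R.
    by rewrite -[in RHS]mulr_natl -[pi *+ 2]mulr_natl; ring.
  exact: (periodicn (@cosD2pi R)).
case: k => n; rewrite mulrDr.
  exact: H.
by rewrite NegzE mulrNz -(H _ n.+1) -pmulrn mulrN subrK.
Qed.

Lemma sinDint t (k : int) : sin (2 * pi * (t + k%:~R)) = sin (2 * pi * t).
Proof.
have H x (n : nat) : sin (x + 2 * pi * n%:R) = sin x :> R.
  have -> : 2 * pi * n%:R = (pi *+ 2) *+ n :> R.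
    by rewrite -[in RHS]mulr_natl -[pi *+ 2]mulr_natl; ring.
  exact: (periodicn (@sinD2pi R)).
case: k => n; rewrite mulrDr.
  exact: H.
by rewrite NegzE mulrNz -(H _ n.+1) -pmulrn mulrN subrK.
Qed.

(** Cosine decreases strictly on half a turn. This converts closeness of a cosine to 1 into
    closeness of an angle to an integer. *)
Lemma cfrac_small (e : R) : 0 < e -> exists2 d, 0 < d & forall t,
  1 - cos (2 * pi * t) < d -> `|cfrac t| < e.
Proof.
move=> e0; pose e' := Num.min e (1 / 2).
have e'0 : 0 < e' by rewrite lt_min e0; lra.
have e'1 : e' <= 1 / 2 by rewrite ge_min lexx orbT.
have pi0 := pi_gt0 R.
have I0 : (0 : R) \in `[0, pi] by rewrite in_itv /= lexx pi_ge0.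
have Ie : 2 * pi * e' \in `[0, pi] by rewrite in_itv /=; apply/andP; split; nra.
exists (1 - cos (2 * pi * e')).
  by rewrite subr_gt0 -[X in _ < X](cos0 R) ltr_cos //; nra.
move=> t h; suff : `|cfrac t| < e' by move=> /lt_le_trans; apply; rewrite ge_min lexx.
have [k hk] := cfracE t; have /andP[c0 c1] := cfrac_itv t.
have cb : `|cfrac t| <= 1 / 2 by rewrite ler_norml; apply/andP; split; lra.
have n0 := normr_ge0 (cfrac t).
have It : 2 * pi * `|cfrac t| \in `[0, pi] by rewrite in_itv /=; apply/andP; split; nra.
have : cos (2 * pi * e') < cos (2 * pi * `|cfrac t|).
  have <- : cos (2 * pi * t) = cos (2 * pi * `|cfrac t|).
    rewrite {1}hk cosDint -(cos_norm (2 * pi * cfrac t)) normrM (@ger0_norm _ (2 * pi)) //.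
    by rewrite mulr_ge0 // ltW.
  by lra.
by rewrite ltr_cos // ltr_pM2l // mulr_gt0.
Qed.

Lemma cos2pi_eq1 t : cos (2 * pi * t) = 1 -> exists k : int, t = k%:~R.
Proof.
move=> h; have [k hk] := cfracE t; exists k; rewrite hk.
suff -> : cfrac t = 0 by rewrite add0r.
apply/eqP; rewrite -normr_eq0 eq_le normr_ge0 andbT leNgt; apply/negP => c0.
by have [d d0 /(_ t)] := cfrac_small c0; rewrite h subrr ltxx => /(_ d0).
Qed.

(* Turn-valued argument: a full revolution has length 1. *)
Definition turn (u v : R) : R :=
  (if 0 <= v then acos (u / Num.sqrt (u ^+ 2 + v ^+ 2))
   else - acos (u / Num.sqrt (u ^+ 2 + v ^+ 2))) / (2 * pi).

Lemma turnP u v (r := Num.sqrt (u ^+ 2 + v ^+ 2)) : 0 < u ^+ 2 + v ^+ 2 ->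
  u = r * cos (2 * pi * turn u v) /\ v = r * sin (2 * pi * turn u v).
Proof.
move=> h; have r0 : 0 < r by rewrite sqrtr_gt0.
have r2 : r ^+ 2 = u ^+ 2 + v ^+ 2 by rewrite sqr_sqrtr // ltW.
have pi0 := pi_gt0 R.
set c := u / r; have cr : c * r = u by rewrite mulfVK // gt_eqF.
have c1 : -1 <= c <= 1.
  rewrite -ler_norml -(@ler_pXn2r _ 2) ?nnegrE // -normrX ger0_norm ?sqr_ge0 //.
  rewrite expr1n -(@ler_pM2r _ (r ^+ 2)) ?exprn_gt0 // -exprMn cr mul1r r2.
  by rewrite lerDl sqr_ge0.
have -> : 2 * pi * turn u v = if 0 <= v then acos c else - acos c.
  by rewrite /turn -/r -/c mulrC divfK // mulf_neq0 ?gt_eqF.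
have sa : r * sin (acos c) = `|v|.
  rewrite sin_acos // -(@ger0_norm _ r) ?ltW // -sqrtr_sqr -sqrtrM ?sqr_ge0 //.
  by rewrite -(sqrtr_sqr v); congr Num.sqrt; nra.
case: ifPn => v0; first by rewrite acosK ?in_itv //= sa ger0_norm // mulrC cr.
rewrite cosN sinN acosK ?in_itv //= mulrN sa ltr0_norm ?opprK ?ltNge //.
by rewrite mulrC cr.
Qed.

Lemma turn_unique r t : 0 < r -> exists k : int,
  turn (r * cos (2 * pi * t)) (r * sin (2 * pi * t)) = t + k%:~R.
Proof.
move=> r0; set u := r * cos _; set v := r * sin _.
have uv : u ^+ 2 + v ^+ 2 = r ^+ 2.
  by rewrite /u /v !exprMn -mulrDr cos2Dsin2 mulr1.
have := @turnP u v; rewrite uv sqrtr_sqr gtr0_norm // => /(_ (exprn_gt0 _ r0)).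
have rn : r != 0 by rewrite gt_eqF.
move=> [/(mulfI rn) hc /(mulfI rn) hs].
have [k hk] : exists k : int, turn u v - t = k%:~R.
  apply: cos2pi_eq1; rewrite mulrBr cosB -hc -hs -!expr2; exact: cos2Dsin2.
by exists k; lra.
Qed.

(** [turn] jumps across its cut, but the cosine of the difference of two angles is the normalized
    inner product of the vectors, which is continuous; [cfrac_small] does the rest. *)
Lemma turn_cvg (T : Type) (F : set_system T) {FF : Filter F} (U W : T -> R) (u w e : R) :
  U @ F --> u -> W @ F --> w -> 0 < u ^+ 2 + w ^+ 2 -> 0 < e ->
  \forall z \near F, `|cfrac (turn (U z) (W z) - turn u w)| < e.
Proof.
move=> Uu Ww h e0; have [d d0 hd] := cfrac_small e0.
pose S z := U z ^+ 2 + W z ^+ 2; pose s := u ^+ 2 + w ^+ 2.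
have SF : S @ F --> s by apply: cvgD; [exact: (cvgM Uu Uu)|exact: (cvgM Ww Ww)].
have G : (fun z => (U z * u + W z * w) / (Num.sqrt (S z) * Num.sqrt s)) @ F -->
    (u * u + w * w) / (Num.sqrt s * Num.sqrt s).
  apply: cvgM; first by apply: cvgD; apply: cvgMr_tmp.
  apply: cvgV; first by rewrite mulf_neq0 // gt_eqF // sqrtr_gt0.
  apply: cvgMr_tmp; apply: (cvg_comp _ _ SF); exact: sqrt_continuous.
have G1 : (u * u + w * w) / (Num.sqrt s * Num.sqrt s) = 1.
  by rewrite -!expr2 sqr_sqrtr ?(ltW h) // -/s divff // gt_eqF.
rewrite {}G1 in G.
have S0 : \forall z \near F, 0 < S z by exact: (cvgr_gt _ SF).
have G0 : \forall z \near F, 1 - d <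
    (U z * u + W z * w) / (Num.sqrt (S z) * Num.sqrt s).
  by apply: (cvgr_gt _ G); lra.
near=> z; apply: hd.
have Sz : 0 < S z by near: z.
have [hU hW] := turnP Sz; have [hu hw] := turnP h.
have -> : cos (2 * pi * (turn (U z) (W z) - turn u w)) =
    (U z * u + W z * w) / (Num.sqrt (S z) * Num.sqrt s).
  have E (a b c d' r1 r2 x y x' y' : R) : r1 != 0 -> r2 != 0 -> x = r1 * a ->
      y = r1 * b -> x' = r2 * c -> y' = r2 * d' ->
      a * c + b * d' = (x * x' + y * y') / (r1 * r2).
    by move=> n1 n2 -> -> -> ->; field; rewrite ?n1 ?n2.
  rewrite mulrBr cosB.
  have n1 : Num.sqrt (S z) != 0 by rewrite gt_eqF // sqrtr_gt0.
  have n2 : Num.sqrt s != 0 by rewrite gt_eqF // sqrtr_gt0.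
  exact: E n1 n2 hU hW hu hw.
have : 1 - d < (U z * u + W z * w) / (Num.sqrt (S z) * Num.sqrt s) by near: z.
by lra.
Unshelve. all: by end_near. Qed.

End CenteredFraction.

(** * The flat bundle over the knot complement: gluing homeomorphism and local sections *)

Section PiecewiseLinearShift.
Variables (R : realType) (s1 s2 : R).
Hypotheses (s1_gt1 : 1 < s1) (s2_gt0 : 0 < s2) (s2_le1 : s2 <= 1).

(** Lift of a circle homeomorphism. On [0, 1] it is the lower envelope of two lines, one through the
    origin and one through the point (1, 1), hence concave with a single break. *)
Definition plshift (t : R) : R :=
  let n := (Num.floor t)%:~R in
  n + Num.min (s1 * (t - n)) (1 - s2 * (1 - (t - n))).

Lemma plshift_int (n : int) (u : R) : 0 <= u < 1 ->
  plshift (n%:~R + u) = n%:~R + Num.min (s1 * u) (1 - s2 * (1 - u)).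
Proof.
move=> /andP[u0 u1]; rewrite /plshift.
have -> : Num.floor (n%:~R + u) = n.
  by apply: Num.Theory.floor_def; rewrite intrD; apply/andP; split; lra.
by rewrite addrAC subrr add0r.
Qed.

Lemma floor_decomp (t : R) : exists (n : int) (u : R), 0 <= u < 1 /\ t = n%:~R + u.
Proof.
exists (Num.floor t), (t - (Num.floor t)%:~R); split; last by rewrite addrC subrK.
by have := Num.Theory.floor_itv t; rewrite intrD => /andP[]; lra.
Qed.

Lemma plshiftD (t : R) (n : int) : plshift (t + n%:~R) = plshift t + n%:~R.
Proof.
have [k [u [u01 ->]]] := floor_decomp t.
by rewrite addrAC -intrD !plshift_int // intrD addrAC.
Qed.

Lemma plshift_lt : {homo plshift : t t' / t < t'}.
Proof.
move=> t t'; have [k [u [/andP[u0 u1] ->]]] := floor_decomp t.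
have [l [w [/andP[w0 w1] ->]]] := floor_decomp t' => tt'.
rewrite !plshift_int ?u0 ?w0 //.
have [kl|lk] := ltP k l.
  have kl1 : k%:~R + 1 <= l%:~R :> R by rewrite -[1]/(1%:~R) -intrD ler_int lezD1.
  have m1 : Num.min (s1 * u) (1 - s2 * (1 - u)) < 1.
    by rewrite gt_min; apply/orP; right; have := mulr_gt0 s2_gt0 (_ : 0 < 1 - u); lra.
  have : 0 <= Num.min (s1 * w) (1 - s2 * (1 - w)) by 
    by have := s1_gt1; have := s2_le1; have := s2_gt0; rewrite le_min; move=> *; apply/andP; split; nra.
  by lra.
have kl' : l%:~R <= k%:~R :> R by rewrite ler_int.
have : (l = k)%R.
  apply/eqP; rewrite eq_le lk leNgt; apply/negP => lk'.
  have : l%:~R + 1 <= k%:~R :> R by rewrite -[1]/(1%:~R) -intrD ler_int lezD1.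
  by lra.
move=> E; move: tt'; rewrite E ltrD2l => uw; rewrite ltrD2l lt_min !gt_min.
have s1uw : s1 * u < s1 * w by rewrite ltr_pM2l // (lt_trans ltr01).
have s2uw : s2 * u < s2 * w by rewrite ltr_pM2l //; lra.
apply/andP; split; apply/orP; [left|right]; lra.
Qed.

Lemma plshift_surj (y : R) : exists t, plshift t = y.
Proof.
have [n [w [/andP[w0 w1] ->]]] := floor_decomp y.
(* The inverse of a minimum of two increasing maps is the maximum of their inverses. *)
pose A := w / s1; pose B := 1 - (1 - w) / s2.
have s1n : s1 != 0 by rewrite gt_eqF // (lt_trans ltr01).
have hA : s1 * A = w by rewrite mulrC divfK.
have hB : s2 * (1 - B) = 1 - w by rewrite /B opprB addrC subrK mulrC divfK // gt_eqF.
have A0 : 0 <= A by rewrite divr_ge0 // ltW // (lt_trans ltr01).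
have s1' := s1_gt1; have s2' := s2_gt0; have s2'' := s2_le1.
have A1 : A < 1 by nra.
have B1 : B < 1 by nra.
exists (n%:~R + Num.max A B).
rewrite plshift_int; last by rewrite le_max A0 gt_max A1 B1.
congr (_ + _); have [AB|/ltW AB] := leP A B.
  have : s1 * A <= s1 * B by rewrite ler_wpM2l // ltW // (lt_trans ltr01).
  by rewrite hA hB => h; rewrite min_r; lra.
have : s2 * (1 - A) <= s2 * (1 - B) by rewrite ler_wpM2l ?(ltW s2_gt0) //; lra.
by rewrite hA hB => h; rewrite min_l; lra.
Qed.

End PiecewiseLinearShift.

(* The complement of a (p, q) torus knot with q = p - 1, given by the
   coordinates [m] (the torus is [m = 1]), [al] (longitude, defined where
   [m <= 1]) and [ga] (meridian, defined where [1 <= m]), all angles being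
   measured in turns. [P] contains the knot [p al - q ga \in Z] on the torus. *)
Section TorusKnotBundle.
Variables (R : realType) (V : normedModType R) (pz : int).
Hypothesis pz_gt3 : (3 < pz)%R.
Let p : R := pz%:~R.
Let q : R := p - 1.
Variables (m al ga : V -> R) (P : set V).
Hypothesis mC : continuous m.
Hypothesis alC : forall x (e : R), m x <= 1 -> 0 < e ->
  \forall z \near x, `|cfrac (al z - al x)| < e.
Hypothesis gaC : forall x (e : R), 1 <= m x -> 0 < e ->
  \forall z \near x, `|cfrac (ga z - ga x)| < e.
Hypothesis PE : forall x, m x = 1 ->
  (exists k : int, p * al x - q * ga x = k%:~R) -> P x.

(** Equals 2g - 1 for the genus g = (p - 1)(q - 1)/2 of the knot. It is the value that makes
    [glue_shift] come out. *)
Definition euler_num : R := p * q - p - q.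
Let N := euler_num.

Let p_gt3 : 3 < p. Proof. by rewrite /p -[3%:R]/(3%:~R) ltr_int. Qed.
Let q_gt2 : 2 < q. Proof. by rewrite /q; have := p_gt3; lra. Qed.
Let p_neq0 : p != 0. Proof. by rewrite gt_eqF //; have := p_gt3; lra. Qed.
Let q_neq0 : q != 0. Proof. by rewrite gt_eqF //; have := q_gt2; lra. Qed.

(* The slopes make [phi] map [0, 1/q] onto [0, 1 - 1/p] and [1/q, 1] onto
   [1 - 1/p, 1]. *)
Definition slope1 : R := q * (1 - p^-1).
Definition slope2 : R := p^-1 / (1 - q^-1).
Let phi := plshift slope1 slope2.

Let slope1_gt1 : 1 < slope1.
Proof.
have := p_gt3; have := q_gt2; rewrite /slope1 => q2 p3.
have : 0 < p^-1 by rewrite invr_gt0; lra.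
have : p^-1 < 1 / 3 by rewrite -[p^-1]mul1r ltr_pdivrMr //; lra.
by nra.
Qed.

Let qV : 0 < q^-1 < 1 / 2.
Proof.
have q2 := q_gt2; rewrite invr_gt0; apply/andP; split; first lra.
by rewrite -[q^-1]mul1r ltr_pdivrMr //; lra.
Qed.

Let pV : 0 < p^-1 < 1 / 3.
Proof.
have q2 := p_gt3; rewrite invr_gt0; apply/andP; split; first lra.
by rewrite -[p^-1]mul1r ltr_pdivrMr //; lra.
Qed.

Let slope2_gt0 : 0 < slope2.
Proof. by have := qV; have := pV => h h'; rewrite divr_gt0 //; lra. Qed.

Let slope2_le1 : slope2 <= 1.
Proof. by have := qV; have := pV => h h'; rewrite ler_pdivrMr //; lra. Qed.

Let phi_lt : {homo phi : t t' / t < t'}.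
Proof. exact: plshift_lt. Qed.

Let phiD t (n : int) : phi (t + n%:~R) = phi t + n%:~R.
Proof. exact: plshiftD. Qed.

Let phi0 : phi 0 = 0.
Proof.
rewrite -[X in phi X](addr0 (0%:~R)) /phi plshift_int ?lexx ?ltr01 //.
by rewrite mulr0 subr0 mulr1 min_l ?addr0 //; have := slope2_le1; lra.
Qed.

Let phi1 : phi q^-1 = 1 - p^-1.
Proof.
have h := qV; rewrite -[X in phi X]add0r -[X in phi (X + _)]/(0%:~R) /phi plshift_int; last lra.
rewrite /slope1 /slope2 divfK; last by rewrite gt_eqF //; lra.
by rewrite mulrAC mulfV // mul1r minxx add0r.
Qed.

(* Gluing map between the two fibre coordinates on the strip number [k] of the
   torus minus the knot, at the lifts [A], [G] of [al], [ga]. *)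
Definition glue (A G : R) (k : int) (v : R) : R :=
  phi (v + N / q * A + k%:~R / q) + k%:~R / p - k%:~R - N / p * G.

(** Well-definedness on the torus: other lifts of the two angles renumber the strips. Since (N +
    p)/q = p - 1, the argument of [phi] changes by the integer (p - 1) i - j, and since (N + q)/p =
    q - 1, the terms outside [phi] take it back. *)
Lemma glue_shift A G (k i j : int) v :
  glue (A + i%:~R) (G + j%:~R) (k + pz * i - (pz - 1) * j) v = glue A G k v.
Proof.
rewrite /glue.
have -> : v + N / q * (A + i%:~R) + (k + pz * i - (pz - 1) * j)%:~R / q =
    v + N / q * A + k%:~R / q + ((pz - 1) * i - j)%:~R.
  rewrite /N /euler_num !(intrD, intrM, intrN, rmorphB, rmorphM, rmorphD, rmorph1) /= -/p -/q.
  by rewrite /q; field; exact: q_neq0.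
rewrite phiD !(intrD, intrM, intrN, rmorphB, rmorphM, rmorphD, rmorph1) /= -/p -/q.
by rewrite /N /euler_num /q; field.
Qed.

(** Strips 0 and -1 are the two sides of the knot line. For this [v] they evaluate [phi] at 1/q and
    at 0, and the difference 1 - 1/p of the values is what the terms in [k] make up for. This is the
    fixed point of the meridian. *)
Lemma glue_knot L v : v = q^-1 - N / q * L ->
  glue L (p * L / q) 0 v = glue L (p * L / q) (-1) v.
Proof.
move=> ->; rewrite /glue mul0r subrK !addr0 subr0 mulN1r subrr.
rewrite phi1 phi0; ring.
Qed.

Definition theta x v := glue (al x) (ga x) (Num.floor (p * al x - q * ga x)) v.

Lemma theta_lt x v w : v < w -> theta x v < theta x w.
Proof. by move=> vw; rewrite /theta /glue !ltrD2r phi_lt // !ltrD2r. Qed.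

Lemma theta_surj x u : exists v, theta x v = u.
Proof.
set k := Num.floor (p * al x - q * ga x).
have [t ht] : exists t, phi t = u - (k%:~R / p - k%:~R - N / p * ga x).
  exact: plshift_surj.
exists (t - N / q * al x - k%:~R / q).
rewrite /theta /glue -/k.
have -> : t - N / q * al x - k%:~R / q + N / q * al x + k%:~R / q = t by ring.
rewrite ht; ring.
Qed.

Lemma thetaD1 x v : theta x (v + 1) = theta x v + 1.
Proof.
rewrite /theta /glue.
set k := Num.floor _.
have -> : v + 1 + N / q * al x + k%:~R / q = v + N / q * al x + k%:~R / q + 1%:~R.
  by ring.
rewrite phiD; ring.
Qed.

(* The local flat section at [x] with parameter [v], as a function of [z]. *)
Definition std x v z : R :=
  if m z <= 1 then v - N / q * cfrac (al z - al x)
  else theta x v - N / p * cfrac (ga z - ga x).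

Lemma std_lt x z v w : v < w -> std x v z < std x w z.
Proof. by move=> vw; rewrite /std; case: ifP => _; rewrite ltrD2r // theta_lt. Qed.

Lemma std_surj x z u : exists v, std x v z = u.
Proof.
rewrite /std; case: (m z <= 1).
  by exists (u + N / q * cfrac (al z - al x)); rewrite addrK.
have [v hv] := theta_surj x (u + N / p * cfrac (ga z - ga x)).
by exists v; rewrite hv addrK.
Qed.

Lemma stdD1 x v z : std x (v + 1) z = std x v z + 1.
Proof. by rewrite /std; case: ifP => _; rewrite ?thetaD1 addrAC. Qed.

(* At a point of the knot only the sections fixed by the meridian extend. *)
Definition knot_lift x L := exists i j : int,
  al x = L + i%:~R /\ ga x = p * L / q + j%:~R.

Definition adm x v := ~ P x \/ exists2 L, knot_lift x L & v = q^-1 - N / q * L.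

(** Off the knot, nearby points of the torus lie in the same strip up to a change of lifts, handled
    by [glue_shift]. On the knot the strip may drop by one, and an admissible [v] does not see this
    by [glue_knot]. *)
Lemma theta_near x : exists2 e : R, 0 < e & forall y v,
  m x = 1 -> m y = 1 -> adm x v ->
  `|cfrac (al y - al x)| < e -> `|cfrac (ga y - ga x)| < e ->
  theta y (v - N / q * cfrac (al y - al x)) =
  theta x v - N / p * cfrac (ga y - ga x).
Proof.
set w := p * al x - q * ga x; set k := Num.floor w.
have q2 := q_gt2; have p3 := p_gt3.
have /andP[k0 k1] := Num.Theory.floor_itv w; rewrite intrD -/k in k0 k1.
(* Distance from [w] to the ends of its strip; on the knot, where [w] is an integer, 1 ensures that
   only strips [k] and [k - 1] are reached. *)
pose e0 : R := if w == k%:~R then 1 else Num.min (w - k%:~R) (k%:~R + 1 - w).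
have e00 : 0 < e0.
  rewrite /e0; case: eqP => wk //; rewrite lt_min; apply/andP; split; last by lra.
  by rewrite subr_gt0 lt_neqAle k0 andbT; apply/eqP => E; apply: wk.
exists (e0 / (p + q)) => [|y v mx my av]; first by rewrite divr_gt0 //; lra.
have [i hi] := cfracE (al y - al x); have [j hj] := cfracE (ga y - ga x).
set da := cfrac (al y - al x) in hi *; set dg := cfrac (ga y - ga x) in hj *.
rewrite !ltr_pdivlMr; try lra; move=> ha hg.
have dd : `|p * da - q * dg| < e0.
  rewrite (le_lt_trans (ler_normB _ _)) // !normrM.
  rewrite (@gtr0_norm _ p) ?(@gtr0_norm _ q); try lra.
  move: ha hg; set A := `|da|; set B := `|dg| => ha hg.
  have [h|h] := lerP A B.
    have : p * A <= p * B by rewrite ler_wpM2l; lra.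
    by lra.
  have : q * B <= q * A by rewrite ler_wpM2l; lra.
  by lra.
have aly : al y = al x + da + i%:~R by lra.
have gay : ga y = ga x + dg + j%:~R by lra.
set k' := Num.floor (w + (p * da - q * dg)).
have -> : theta y (v - N / q * da) = glue (al x + da) (ga x + dg) k' (v - N / q * da).
  rewrite /theta aly gay -(glue_shift _ _ k' i j); congr glue.
  apply: Num.Theory.floor_def; have /andP[] := Num.Theory.floor_itv (w + (p * da - q * dg)).
  rewrite -/k' /w !(intrD, intrM, intrN, rmorphB, rmorphM, rmorphD, rmorph1) /= -/p -/q.
  by move=> h1 h2; apply/andP; split; lra.
have -> : glue (al x + da) (ga x + dg) k' (v - N / q * da) =
    glue (al x) (ga x) k' v - N / p * dg.
  rewrite /glue; have -> : v - N / q * da + N / q * (al x + da) = v + N / q * al x by ring.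
  ring.
congr (_ - _); rewrite /theta -/w -/k.
move: dd; rewrite /e0; case: eqP => [wk|wk].
  rewrite ltr_norml => /andP[d1 d2].
  case: av => [nP|[L [i' [j' [aL gL]]] vL]].
    by case: nP; apply: PE => //; exists k.
  have kE : k = pz * i' - (pz - 1) * j'.
    apply/eqP; rewrite -(@eqr_int R) -wk /w aL gL.
    rewrite !(intrD, intrM, intrN, rmorphB, rmorphM, rmorphD, rmorph1) /= -/p -/q.
    by apply/eqP; field.
  have g0 := glue_shift L (p * L / q) 0 i' j' v.
  have g1 := glue_shift L (p * L / q) (-1) i' j' v.
  rewrite -aL -gL in g0 g1.
  have [pd|pd] := lerP 0 (p * da - q * dg).
    congr glue; apply: Num.Theory.floor_def; rewrite intrD; apply/andP; split; lra.
  have -> : k' = -1 + pz * i' - (pz - 1) * j'.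
    rewrite -addrA -kE; apply: Num.Theory.floor_def.
    by rewrite !intrD !intrN; apply/andP; split; lra.
  by rewrite g1 -(glue_knot vL) -g0 add0r -kE.
rewrite lt_min !ltr_norml => /andP[/andP[d1 d2] /andP[d3 d4]].
by congr glue; apply: Num.Theory.floor_def; rewrite intrD; apply/andP; split; lra.
Qed.

Let m_lt x : m x < 1 -> \forall z \near x, m z < 1.
Proof. by move=> h; apply: (cvgr_lt (m x)) => //; exact: mC. Qed.

Let m_gt x : 1 < m x -> \forall z \near x, 1 < m z.
Proof. by move=> h; apply: (cvgr_gt (m x)) => //; exact: mC. Qed.

(** Where the inner coordinate is in force, in particular on the knot, the new parameter is recorded
    explicitly: it is needed to follow the invariant section along the knot. *)
Theorem std_compat_adm x : \forall y \near x, forall v, adm x v ->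
  exists v', (m y <= 1 -> v' = v - N / q * cfrac (al y - al x)) /\
    \forall z \near y, std x v z = std y v' z.
Proof.
have [e e0 he] := theta_near x.
(* Below 1/4 centred fractions add without wrapping ([cfracD]); below [e] the gluing maps agree
   ([theta_near]). *)
pose e' := Num.min e (1 / 4).
have e'0 : 0 < e' by rewrite lt_min e0; lra.
have na : \forall y \near x, m x <= 1 -> `|cfrac (al y - al x)| < e'.
  by have [h|h] := lerP (m x) 1; [near=> y => _; near: y; exact: alC|near=> y].
have ng : \forall y \near x, 1 <= m x -> `|cfrac (ga y - ga x)| < e'.
  by have [h|h] := lerP 1 (m x); [near=> y => _; near: y; exact: gaC|near=> y].
have n1 : \forall y \near x, m x < 1 -> m y < 1.
  have [h|h] := ltrP (m x) 1; last by near=> y.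
  by apply: filterS (m_lt h) => y my _.
have n2 : \forall y \near x, 1 < m x -> 1 < m y.
  have [h|h] := ltrP 1 (m x); last by near=> y.
  by apply: filterS (m_gt h) => y my _.
near=> y => v av.
have ay : m x <= 1 -> `|cfrac (al y - al x)| < e' by near: y.
have gy : 1 <= m x -> `|cfrac (ga y - ga x)| < e' by near: y.
have m1 : m x < 1 -> m y < 1 by near: y.
have m2 : 1 < m x -> 1 < m y by near: y.
have ee : e' <= e by rewrite ge_min lexx.
have e4 : e' <= 1 / 4 by rewrite ge_min lexx orbT.
have alD z : m x <= 1 -> `|cfrac (al z - al y)| < 1 / 4 ->
    cfrac (al z - al x) = cfrac (al y - al x) + cfrac (al z - al y).
  move=> /ay h h'; rewrite -cfracD //; last exact: lt_le_trans h e4.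
  by congr cfrac; ring.
have gaD z : 1 <= m x -> `|cfrac (ga z - ga y)| < 1 / 4 ->
    cfrac (ga z - ga x) = cfrac (ga y - ga x) + cfrac (ga z - ga y).
  move=> /gy h h'; rewrite -cfracD //; last exact: lt_le_trans h e4.
  by congr cfrac; ring.
have q4 : 0 < 1 / 4 :> R by lra.
case: (ltgtP (m y) 1) => my.
- exists (v - N / q * cfrac (al y - al x)); split => //.
  have mx : m x <= 1 by rewrite leNgt; apply/negP => /m2; lra.
  have ny := m_lt my.
  have ny' := alC (ltW my) q4.
  near=> z.
  have mz : m z <= 1 by apply: ltW; near: z.
  have az : `|cfrac (al z - al y)| < 1 / 4 by near: z.
  by rewrite /std mz alD //; ring.
- have [v' hv'] := theta_surj y (theta x v - N / p * cfrac (ga y - ga x)).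
  exists v'; split; first by [].
  have mx : 1 <= m x by rewrite leNgt; apply/negP => /m1; lra.
  have ny := m_gt my.
  have ny' := gaC (ltW my) q4.
  near=> z.
  have mz : (m z <= 1) = false by apply/negbTE; rewrite -ltNge; near: z.
  have az : `|cfrac (ga z - ga y)| < 1 / 4 by near: z.
  by rewrite /std mz hv' gaD //; ring.
- exists (v - N / q * cfrac (al y - al x)); split => //.
  have mx : m x = 1.
    by case: (ltgtP (m x) 1) => // [/m1|/m2]; rewrite my ltxx.
  have mx1 : m x <= 1 by rewrite mx.
  have mx2 : 1 <= m x by rewrite mx.
  have my1 : m y <= 1 by rewrite my.
  have my2 : 1 <= m y by rewrite my.
  have ny := alC my1 q4.
  have ny' := gaC my2 q4.
  near=> z.
  have az : `|cfrac (al z - al y)| < 1 / 4 by near: z.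
  have gz : `|cfrac (ga z - ga y)| < 1 / 4 by near: z.
  rewrite /std he //; last 2 first.
  + exact: lt_le_trans (ay mx1) ee.
  + exact: lt_le_trans (gy mx2) ee.
  by case: ifP => _; rewrite (alD z, gaD z) // mulrDr opprD addrA.
Unshelve. all: by end_near. Qed.

Lemma std_compat x : (~` P) x -> \forall y \near x, (~` P) y -> forall v,
  exists v', \forall z \near y, (~` P) z -> std x v z = std y v' z.
Proof.
move=> nPx; near=> y => _ v.
have /(_ v (or_introl nPx))[v' [_ h]] : forall v, adm x v ->
  exists v', (m y <= 1 -> v' = v - N / q * cfrac (al y - al x)) /\
    \forall z \near y, std x v z = std y v' z by near: y; exact: std_compat_adm.
by exists v'; near=> z => _; near: z.
Unshelve. all: by end_near. Qed.

(** Here [x] may lie on the knot: admissibility makes the section single-valued on the whole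
    punctured ball, although the ball minus the knot is not simply connected. *)
Lemma flat_knot x v : adm x v -> exists2 r, 0 < r &
  flat std (~` P `&` nball x r) (std x v).
Proof.
have /near_normP[r r0 h] := std_compat_adm x => av; exists r => // y [Py yr].
have [v' [_ hv']] := h y yr v av; exists v'; near=> z => _.
by near: z.
Unshelve. all: by end_near. Qed.

End TorusKnotBundle.

(** * The torus knot as a polygon with 2p edges, and the coordinates of its complement *)

Section TorusPolygon.
Variables (R : realType) (pn : nat).
Hypothesis pn_gt3 : (3 < pn)%N.
Let p : R := (pn%:Z)%:~R.
Let q : R := p - 1.

Let p_gt3 : 3 < p.
Proof. by rewrite /p -[3%:R]/(3%:~R) ltr_int. Qed.

Let cs (t : R) := cos (2 * pi * t).
Let sn (t : R) := sin (2 * pi * t).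

Let cs2sn2 t : cs t ^+ 2 + sn t ^+ 2 = 1. Proof. exact: cos2Dsin2. Qed.

Let csD t u : cs (t + u) = cs t * cs u - sn t * sn u.
Proof. by rewrite /cs mulrDr cosD. Qed.

Let snD t u : sn (t + u) = sn t * cs u + cs t * sn u.
Proof. by rewrite /sn mulrDr sinD. Qed.

Let csN t : cs (- t) = cs t. Proof. by rewrite /cs mulrN cosN. Qed.
Let snN t : sn (- t) = - sn t. Proof. by rewrite /sn mulrN sinN. Qed.

Let quarter : 2 * pi * (1 / 4) = pi / 2 :> R. Proof. by field. Qed.

Let cs4 t : cs (1 / 4 - t) = sn t.
Proof. by rewrite csD csN snN /cs /sn quarter cos_pihalf sin_pihalf; ring. Qed.

Let sn4 t : sn (1 / 4 - t) = cs t.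
Proof. by rewrite snD csN snN /cs /sn quarter cos_pihalf sin_pihalf; ring. Qed.

(* The even edges lie on one hyperboloid, the odd ones on another; [tilt j] is
   the complement to a quarter turn of half the angle swept by the edge [j]. *)
Definition tilt (j : nat) : R := if odd j then (6 * p)^-1 else (3 * p)^-1.

Lemma tilt_itv j : 0 < tilt j < 1 / 4.
Proof.
have p3 := p_gt3; rewrite /tilt; case: odd; rewrite invr_gt0; apply/andP; split; try lra.
  by rewrite -[_^-1]mul1r ltr_pdivrMr; lra.
by rewrite -[_^-1]mul1r ltr_pdivrMr; lra.
Qed.

Let pin (t : R) : 0 < t < 1 / 4 -> 0 < 2 * pi * t < pi / 2.
Proof.
move=> /andP[t0 t1]; have pi0 := pi_gt0 R.
by rewrite -quarter !mulr_gt0 // ltr_pM2l // mulr_gt0.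
Qed.

Lemma sn_tilt_gt0 j : 0 < sn (tilt j).
Proof. by apply: sin_gt0_pihalf; apply: pin; exact: tilt_itv. Qed.

Lemma cs_tilt_gt0 j : 0 < cs (tilt j).
Proof.
apply: cos_gt0_pihalf; have /andP[h ->] := pin (tilt_itv j).
by rewrite andbT; have := pi_gt0 R; lra.
Qed.

Lemma sn_tilt_lt : sn (tilt 1) < sn (tilt 0).
Proof.
have pi0 := pi_gt0 R; have p3 := p_gt3.
rewrite /sn ltr_sin ?in_itv /=.
- rewrite ltr_pM2l ?mulr_gt0 // /tilt /= ltf_pV2 ?posrE; lra.
- by have /andP[] := pin (tilt_itv 1) => h1 h2; apply/andP; split; lra.
- by have /andP[] := pin (tilt_itv 0) => h1 h2; apply/andP; split; lra.
Qed.

Let Sa := sn (tilt 0) ^+ 2.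
Let Sb := sn (tilt 1) ^+ 2.

Lemma Sab : 0 < Sb < Sa /\ Sa < 1.
Proof.
have h0 := sn_tilt_gt0 0; have h1 := sn_tilt_gt0 1; have h := sn_tilt_lt.
have c0 := cs_tilt_gt0 0; have e := cs2sn2 (tilt 0).
rewrite /Sa /Sb; split; last by nra.
by apply/andP; split; nra.
Qed.

Lemma tilt_odd j : tilt j = tilt (odd j). Proof. by rewrite /tilt oddb. Qed.

(** Angle, in turns, of the midpoint of the edge [j]; over 2p edges it advances by q. *)
Definition mid (j : nat) : R := j%:R * q / (2 * p).

(** Consecutive edges share a vertex because the two tilts add up to 1/(2p) = (p - q)/(2p); this
    uses q = p - 1. The sum is split unequally to get two different hyperboloids. *)
Lemma midS j : mid j + (1 / 4 - tilt j) = mid j.+1 - (1 / 4 - tilt j.+1).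
Proof.
have p0 : p != 0 by rewrite gt_eqF //; have := p_gt3; lra.
by rewrite /mid /tilt /= -natr1 /q; case: odd => /=; field.
Qed.

Lemma mid_period j : mid (j + 2 * pn) = mid j + (pn%:Z - 1)%:~R.
Proof.
have p0 : p != 0 by rewrite gt_eqF //; have := p_gt3; lra.
rewrite /mid natrD natrM rmorphB /= -/p rmorph1 -/q.
have -> : pn%:R = p by [].
by field.
Qed.

Definition vec3 (x y z : R) : 'rV[R]_3 := \row_j [:: x; y; z]`_j.

Let i0 : 'I_3 := ord0.
Let i1 : 'I_3 := Ordinal (isT : (1 < 3)%N).
Let i2 : 'I_3 := Ordinal (isT : (2 < 3)%N).

Definition xc (v : 'rV[R]_3) := v ord0 i0.
Definition yc (v : 'rV[R]_3) := v ord0 i1.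
Definition zc (v : 'rV[R]_3) := v ord0 i2.

Lemma vec3E v : v = vec3 (xc v) (yc v) (zc v).
Proof.
apply/rowP => j; rewrite mxE; case: j => [[|[|[|//]]] hj] /=;
  by rewrite /xc /yc /zc; congr (v _ _); apply: val_inj.
Qed.

Lemma xc_vec3 x y z : xc (vec3 x y z) = x. Proof. by rewrite /xc mxE. Qed.
Lemma yc_vec3 x y z : yc (vec3 x y z) = y. Proof. by rewrite /yc mxE. Qed.
Lemma zc_vec3 x y z : zc (vec3 x y z) = z. Proof. by rewrite /zc mxE. Qed.
Let cE := (xc_vec3, yc_vec3, zc_vec3).

Definition height (j : nat) (s : R) : R := if odd j then - s else s.

Definition torus_vertex (j : nat) : 'rV[R]_3 :=
  vec3 (cs (mid j - (1 / 4 - tilt j))) (sn (mid j - (1 / 4 - tilt j))) (height j (-1)).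

Definition torus_polygon (j : 'I_(2 * pn)) : 'rV[R]_3 := torus_vertex j.

Lemma torus_vertex_period j : torus_vertex (j + 2 * pn) = torus_vertex j.
Proof.
have E : odd (j + 2 * pn) = odd j by rewrite oddD oddM addbF.
rewrite /torus_vertex /height /tilt E mid_period addrAC /cs /sn.
by rewrite cosDint sinDint.
Qed.

Lemma torus_polygonS (j : 'I_(2 * pn)) : torus_polygon (ordS j) = torus_vertex j.+1.
Proof.
rewrite /torus_polygon /=; have [h|h] := ltnP j.+1 (2 * pn); first by rewrite modn_small.
have -> : j.+1 = (2 * pn)%N by apply/eqP; rewrite eqn_leq h andbT ltn_ord.
by rewrite modnn -[in RHS](add0n (2 * pn)%N) torus_vertex_period.
Qed.

(** Seen from its midpoint, at distance [sn (tilt j)] from the axis, the projected edge runs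
    perpendicular to the radius with half-length [cs (tilt j)]: it is a ruling of a one-sheeted
    hyperboloid. *)
Lemma edge_pointE (j : 'I_(2 * pn)) (t : R) (s := 2 * t - 1) :
  edge_point torus_polygon j t =
  vec3 (cs (mid j) * sn (tilt j) - sn (mid j) * (s * cs (tilt j)))
       (sn (mid j) * sn (tilt j) + cs (mid j) * (s * cs (tilt j))) (height j s).
Proof.
rewrite /edge_point torus_polygonS /torus_polygon /torus_vertex -midS.
rewrite !(csD (mid j)) !(snD (mid j)) !csN !snN !cs4 !sn4 /height /= /s.
apply/rowP => i; rewrite !mxE; case: i => [[|[|[|//]]] hi] /=; try ring.
by case: (odd j) => /=; ring.
Qed.

Definition at_ (u : R) : R := atan u / (2 * pi).

Let at2pi u : 2 * pi * at_ u = atan u.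
Proof. by rewrite /at_ mulrC divfK // mulf_neq0 // gt_eqF // pi_gt0. Qed.

Definition cot j : R := cs (tilt j) / sn (tilt j).

Definition radius j (s : R) := Num.sqrt (sn (tilt j) ^+ 2 + (s * cs (tilt j)) ^+ 2).

Lemma radius_gt0 j s : 0 < radius j s.
Proof.
rewrite sqrtr_gt0; have := sn_tilt_gt0 j => h.
by have := sqr_ge0 (s * cs (tilt j)); have := exprn_gt0 2 h; lra.
Qed.

Lemma radius_at j s : radius j s * cs (at_ (s * cot j)) = sn (tilt j) /\
  radius j s * sn (at_ (s * cot j)) = s * cs (tilt j).
Proof.
rewrite /cs /sn !at2pi -/(sn (tilt j)) -/(cs (tilt j)).
have h := sn_tilt_gt0 j; set u := s * cot j.
have hu : u * sn (tilt j) = s * cs (tilt j) by rewrite /u /cot mulrA divfK // gt_eqF.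
have r0 : 0 < Num.sqrt (1 + u ^+ 2) by rewrite sqrtr_gt0; have := sqr_ge0 u; lra.
have -> : radius j s = sn (tilt j) * Num.sqrt (1 + u ^+ 2).
  rewrite /radius -hu -[X in _ = X * _](@ger0_norm _ (sn (tilt j))) ?ltW //.
  by rewrite -sqrtr_sqr -sqrtrM ?sqr_ge0 //; congr Num.sqrt; ring.
have C : sn (tilt j) * Num.sqrt (1 + u ^+ 2) * cos (atan u) = sn (tilt j).
  by rewrite cos_atan mulfK // gt_eqF.
split=> //; have ca : cos (atan u) != 0.
  by rewrite cos_atan invr_neq0 // gt_eqF.
have -> : sin (atan u) = u * cos (atan u) by rewrite -{2}(atanK u) /tan divfK.
by rewrite mulrCA mulrA -mulrA C hu.
Qed.

Lemma at_cot j : at_ (cot j) = 1 / 4 - tilt j.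
Proof.
have pi0 := pi_gt0 R; have /andP[h1 h2] := pin (tilt_itv j).
rewrite /at_; have -> : cot j = tan (2 * pi * (1 / 4 - tilt j)).
  by rewrite /tan -/(sn _) -/(cs _) cs4 sn4.
rewrite tanK; first by rewrite mulrC mulKf // mulf_neq0 // gt_eqF.
by rewrite in_itv /= mulrBr quarter; apply/andP; split; lra.
Qed.

Lemma at_N u : at_ (- u) = - at_ u. Proof. by rewrite /at_ atanN mulNr. Qed.

(** A continuous lift of the angle around the axis along the edge; [longitude_end] joins the lifts
    of successive edges. *)
Definition longitude (j : nat) (t : R) : R := mid j + at_ ((2 * t - 1) * cot j).

Lemma edge_point_polar (j : 'I_(2 * pn)) (t : R) (r := radius j (2 * t - 1)) :
  edge_point torus_polygon j t =
  vec3 (r * cs (longitude j t)) (r * sn (longitude j t)) (height j (2 * t - 1)).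
Proof.
have [hc hs] := radius_at j (2 * t - 1).
rewrite edge_pointE -hc -hs /longitude csD snD -/r; congr vec3; ring.
Qed.

Lemma longitude_end j : longitude j 1 = longitude j.+1 0.
Proof.
rewrite /longitude.
have -> : (2 * 1 - 1) * cot j = cot j by ring.
have -> : (2 * 0 - 1) * cot j.+1 = - cot j.+1 by ring.
by rewrite at_N !at_cot midS.
Qed.

Lemma longitude_period : longitude (2 * pn) 0 = longitude 0 0 + q.
Proof.
have := mid_period 0; rewrite add0n rmorphB /= -/p rmorph1 -/q => E.
have Ec : cot (2 * pn) = cot 0 by rewrite /cot /tilt oddM.
by rewrite /longitude Ec E addrAC.
Qed.

Lemma continuous_at : continuous at_.
Proof. by move=> u; apply: cvgMr_tmp; exact: continuous_atan. Qed.

Lemma continuous_longitude j : continuous (longitude j).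
Proof.
move=> t; apply: cvgD; first exact: cvg_cst.
apply: (cvg_comp (fun t => (2 * t - 1) * cot j) at_) (@continuous_at _).
apply: cvgMr_tmp; apply: cvgD; last exact: cvg_cst.
by apply: cvgMl_tmp; exact: cvg_id.
Qed.

Let s0 := (Sa + Sb) / 2.
Let kappa := (Sa - Sb) / 2.

(** Equation of the hyperboloid whose squared waist [s0] is the mean of the two waists. On the two
    hyperboloids carrying the edges its value is plus or minus kappa (1 - z^2). *)
Definition quadric (x : 'rV[R]_3) : R :=
  xc x ^+ 2 + yc x ^+ 2 - s0 - zc x ^+ 2 * (1 - s0).

(** Level 1 consists of the parts of the two hyperboloids between heights -1 and 1, which meet in
    the unit circles at the two extreme heights. Dividing by 1 + |z| instead of 1 - z^2 keeps the
    function continuous everywhere. *)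
Definition torus_level (x : 'rV[R]_3) : R :=
  `|zc x| + `|quadric x| / (kappa * (1 + `|zc x|)).

Definition torus_al (x : 'rV[R]_3) : R := turn (xc x) (yc x).

Let ga_out (u : R) : R := p / q * at_ (u * cot 0).
Let ga_in (u : R) : R := 1 / 2 - p / q * at_ (u * cot 1).

(** The factor p/q straightens the edges to lines p al - q ga = const. Dividing the height by the
    level extends the angle to the outside of the torus: there the formulas change over only where
    the quotient is 1 or -1, and at these values they agree modulo 1. *)
Definition torus_ga (x : 'rV[R]_3) : R :=
  if 0 <= quadric x then ga_out (zc x / torus_level x)
  else ga_in (zc x / torus_level x).

Lemma kappa_gt0 : 0 < kappa.
Proof. by rewrite /kappa; have [/andP[]] := Sab; lra. Qed.

Definition coord_cvg (T : Type) (F : set_system T) (f : T -> 'rV[R]_3) x :=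
  [/\ xc (f t) @[t --> F] --> xc x, yc (f t) @[t --> F] --> yc x &
      zc (f t) @[t --> F] --> zc x].

Lemma coord_cvg_id (x : 'rV[R]_3) : coord_cvg (nbhs x) id x.
Proof. by split; exact: coord_continuous. Qed.

Lemma cvg_quadric (T : Type) (F : set_system T) {FF : Filter F} f x :
  coord_cvg F f x -> quadric (f t) @[t --> F] --> quadric x.
Proof.
move=> [hx hy hz]; apply: cvgB; last by apply: cvgMr_tmp; apply: cvgM.
by apply: cvgB; [apply: cvgD; apply: cvgM|exact: cvg_cst].
Qed.

Let den_gt0 (z : R) : 0 < kappa * (1 + `|z|).
Proof. by rewrite mulr_gt0 ?kappa_gt0 // ltr_wpDr. Qed.

Lemma cvg_torus_level (T : Type) (F : set_system T) {FF : Filter F} f x :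
  coord_cvg F f x -> torus_level (f t) @[t --> F] --> torus_level x.
Proof.
move=> h; have [_ _ hz] := h.
have nz : `|zc (f t)| @[t --> F] --> `|zc x| by apply: cvg_norm.
apply: cvgD => //; apply: cvgM; first by apply: cvg_norm; exact: cvg_quadric.
apply: cvgV; first by rewrite gt_eqF // den_gt0.
by apply: cvgMl_tmp; apply: cvgD => //; exact: cvg_cst.
Qed.

Lemma continuous_torus_level : continuous torus_level.
Proof. by move=> x; exact: (cvg_torus_level (coord_cvg_id x)). Qed.

Lemma torus_level1 x : torus_level x = 1 ->
  `|zc x| <= 1 /\ `|quadric x| = kappa * (1 - zc x ^+ 2).
Proof.
have d := den_gt0 (zc x); have k0 := kappa_gt0.
rewrite /torus_level => h.
have E : `|quadric x| = (1 - `|zc x|) * (kappa * (1 + `|zc x|)).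
  have <- : `|quadric x| / (kappa * (1 + `|zc x|)) = 1 - `|zc x| by move: h; set Qd := _ / _; lra.
  by rewrite divfK // gt_eqF.
have z2 : zc x ^+ 2 = `|zc x| ^+ 2 by rewrite -normrX ger0_norm ?sqr_ge0.
have n0 := normr_ge0 (zc x); have n1 := normr_ge0 (quadric x).
split; last by rewrite E z2; ring.
by move: d n0 n1; rewrite E; nra.
Qed.

(** On the axis |quadric| is at least s0 > kappa, whereas level at most 1 needs |quadric| <= kappa
    (1 - z^2). So the inner solid torus avoids the axis and the longitude is defined on it. *)
Lemma torus_level_axis x : torus_level x <= 1 -> 0 < xc x ^+ 2 + yc x ^+ 2.
Proof.
have d := den_gt0 (zc x); have k0 := kappa_gt0.
have [/andP[sb sab] sa] := Sab.
move=> h; rewrite lt_neqAle eq_sym addr_ge0 ?sqr_ge0 // andbT.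
apply/eqP => E; move: h; rewrite /torus_level /quadric E.
have z2 : zc x ^+ 2 = `|zc x| ^+ 2 by rewrite -normrX ger0_norm ?sqr_ge0.
rewrite z2; move: d; set z := `|zc x|; have : 0 <= z := normr_ge0 _ => z0 d.
have -> : 0 - s0 - z ^+ 2 * (1 - s0) = - (s0 + z ^+ 2 * (1 - s0)) by ring.
have n0 : 0 <= z ^+ 2 * (1 - s0) by rewrite mulr_ge0 ?sqr_ge0 // /s0; lra.
rewrite normrN ger0_norm; last by rewrite addr_ge0 // /s0; lra.
rewrite -lerBrDl ler_pdivrMr // leNgt; apply/negP; rewrite negbK.
have : (1 - z) * (kappa * (1 + z)) <= kappa.
  have -> : (1 - z) * (kappa * (1 + z)) = kappa - kappa * z ^+ 2 by ring.
  by have := mulr_ge0 (ltW k0) (sqr_ge0 z); lra.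
have : kappa < s0 by rewrite /kappa /s0; lra.
by lra.
Qed.

Lemma torus_al_cvg x (e : R) : torus_level x <= 1 -> 0 < e ->
  \forall z \near x, `|cfrac (torus_al z - torus_al x)| < e.
Proof.
move=> /torus_level_axis h e0.
have [hx hy _] := coord_cvg_id x; have FF : Filter (nbhs x) := nbhs_filter x.
exact: turn_cvg hx hy h e0.
Qed.

(** The arctangents at the ends of the two sheets add up to q/(2p), hence to 1/2 after scaling by
    p/q; this explains the 1/2 in [ga_in]. *)
Lemma ga_glue (u : R) : u = 1 \/ u = -1 -> exists k : int, ga_out u = ga_in u + k%:~R.
Proof.
have p0 : p != 0 by rewrite gt_eqF //; have := p_gt3; lra.
have q0 : q != 0 by rewrite gt_eqF // /q; have := p_gt3; lra.
have T : 1 / 4 - tilt 0 + (1 / 4 - tilt 1) = q / (2 * p).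
  by rewrite /tilt /q /=; field.
rewrite /ga_out /ga_in => -[->|->].
  rewrite !mul1r !at_cot; exists 0; rewrite addr0.
  have -> : 1 / 4 - tilt 0 = q / (2 * p) - (1 / 4 - tilt 1) by rewrite -T addrK.
  by field; rewrite p0 q0.
rewrite !mulN1r !at_N !at_cot; exists (-1).
have -> : 1 / 4 - tilt 0 = q / (2 * p) - (1 / 4 - tilt 1) by rewrite -T addrK.
by rewrite rmorphN1; field; rewrite p0 q0.
Qed.

Lemma quadric0_level x : quadric x = 0 -> 0 < torus_level x ->
  zc x / torus_level x = 1 \/ zc x / torus_level x = -1.
Proof.
rewrite /torus_level => ->; rewrite normr0 mul0r addr0 normr_gt0 => z0.
case: (ltrgt0P (zc x)) z0 => // h _; [left|right].
  by rewrite divff // gt_eqF.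
by rewrite invrN mulrN divff // lt_eqF.
Qed.

Lemma continuous_torus_ga x : 0 < torus_level x ->
  (ga_out (zc z / torus_level z) @[z --> x] --> ga_out (zc x / torus_level x)) /\
  (ga_in (zc z / torus_level z) @[z --> x] --> ga_in (zc x / torus_level x)).
Proof.
move=> h.
have D : zc z / torus_level z @[z --> x] --> zc x / torus_level x.
  have hx := coord_cvg_id x; have [_ _ hz] := hx.
  have FF : Filter (nbhs x) := nbhs_filter x.
  by apply: cvgM => //; apply: cvgV; [rewrite gt_eqF|exact: cvg_torus_level].
have G j : at_ (zc z / torus_level z * cot j) @[z --> x] -->
    at_ (zc x / torus_level x * cot j).
  have FF : Filter (nbhs x) := nbhs_filter x.
  have Dj : zc z / torus_level z * cot j @[z --> x] --> zc x / torus_level x * cot j.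
    by apply: cvgMr_tmp.
  exact: (cvg_comp _ _ Dj (@continuous_at _)).
have FF : Filter (nbhs x) := nbhs_filter x.
have H j : p / q * at_ (zc z / torus_level z * cot j) @[z --> x] -->
    p / q * at_ (zc x / torus_level x * cot j) by apply: cvgM => //; exact: cvg_cst.
by split; [exact: H|apply: cvgB; [exact: cvg_cst|exact: H]].
Qed.

Let cvg_gt0 (T : Type) (F : set_system T) {FF : Filter F} (f : T -> R) l :
  f @ F --> l -> 0 < l -> \forall t \near F, 0 < f t.
Proof. by move=> h l0; exact: (cvgr_gt _ h). Qed.

Let cvg_lt0 (T : Type) (F : set_system T) {FF : Filter F} (f : T -> R) l :
  f @ F --> l -> l < 0 -> \forall t \near F, f t < 0.
Proof. by move=> h l0; exact: (cvgr_lt _ h). Qed.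

Lemma torus_ga_cvg x (e : R) : 1 <= torus_level x -> 0 < e ->
  \forall z \near x, `|cfrac (torus_ga z - torus_ga x)| < e.
Proof.
move=> lx e0; have l0 : 0 < torus_level x by rewrite (lt_le_trans ltr01).
have FF : Filter (nbhs x) := nbhs_filter x.
have qC : quadric t @[t --> x] --> quadric x := @cvg_quadric _ _ FF _ _ (coord_cvg_id x).
have [Cout Cin] := continuous_torus_ga l0.
pose e' := Num.min e (1 / 2).
have e'0 : 0 < e' by rewrite lt_min e0; lra.
have ee : e' <= e by rewrite ge_min lexx.
have e2 : e' <= 1 / 2 by rewrite ge_min lexx orbT.
have {}Cout : \forall z \near x, `|ga_out (zc z / torus_level z) - ga_out (zc x / torus_level x)| < e'.
  by move/cvgrPdist_lt : Cout => /(_ _ e'0); apply: filterS => z; rewrite distrC.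
have {}Cin : \forall z \near x, `|ga_in (zc z / torus_level z) - ga_in (zc x / torus_level x)| < e'.
  by move/cvgrPdist_lt : Cin => /(_ _ e'0); apply: filterS => z; rewrite distrC.
have S t r (k : int) : `|r| < e' -> t = r + k%:~R -> `|cfrac t| < e.
  move=> h /(cfrac_uniq (lt_le_trans h e2)) ->; exact: lt_le_trans h ee.
case: (ltrgt0P (quadric x)) => qx.
- have : \forall z \near x, 0 < quadric z.
    exact: (@cvg_gt0 _ _ FF _ _ qC qx).
  apply: filterS2 Cout => z hz qz; apply: (S _ _ 0 hz).
  by rewrite /torus_ga !ltW // addr0.
- have : \forall z \near x, quadric z < 0.
    exact: (@cvg_lt0 _ _ FF _ _ qC qx).
  apply: filterS2 Cin => z hz qz; apply: (S _ _ 0 hz).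
  by rewrite /torus_ga !leNgt qz qx addr0.
- have [k hk] := ga_glue (quadric0_level qx l0).
  apply: filterS2 Cout Cin => z hz hz'.
  rewrite /torus_ga qx lexx; case: ifP => _; first by apply: (S _ _ 0 hz); rewrite addr0.
  by apply: (S _ _ (- k) hz'); rewrite hk intrN opprD addrA.
Qed.

Lemma quadric_edge (j : 'I_(2 * pn)) t (s := 2 * t - 1) :
  quadric (edge_point torus_polygon j t) =
  (if odd j then -1 else 1) * (kappa * (1 - s ^+ 2)).
Proof.
rewrite edge_pointE -/s /quadric !cE.
have c2 : cs (mid j) ^+ 2 = 1 - sn (mid j) ^+ 2 by rewrite -(cs2sn2 (mid j)) addrK.
have d2 : cs (tilt j) ^+ 2 = 1 - sn (tilt j) ^+ 2 by rewrite -(cs2sn2 (tilt j)) addrK.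
have -> : height j s ^+ 2 = s ^+ 2 by rewrite /height; case: ifP; rewrite ?sqrrN.
have -> : (cs (mid j) * sn (tilt j) - sn (mid j) * (s * cs (tilt j))) ^+ 2 +
    (sn (mid j) * sn (tilt j) + cs (mid j) * (s * cs (tilt j))) ^+ 2 =
    (cs (mid j) ^+ 2 + sn (mid j) ^+ 2) *
    (sn (tilt j) ^+ 2 + s ^+ 2 * cs (tilt j) ^+ 2) by ring.
rewrite cs2sn2 d2 tilt_odd /s0 /kappa /Sa /Sb.
by case: (odd j) => /=; field.
Qed.

Lemma zc_edge (j : 'I_(2 * pn)) t :
  zc (edge_point torus_polygon j t) = height j (2 * t - 1).
Proof. by rewrite edge_pointE cE. Qed.

Lemma torus_level_edge (j : 'I_(2 * pn)) t : 0 <= t <= 1 ->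
  torus_level (edge_point torus_polygon j t) = 1.
Proof.
move=> /andP[t0 t1]; rewrite /torus_level quadric_edge zc_edge.
set s := 2 * t - 1; have k0 := kappa_gt0.
have -> : `|height j s| = `|s| by rewrite /height; case: ifP; rewrite ?normrN.
have s1 : `|s| <= 1 by rewrite ler_norml /s; apply/andP; split; lra.
have s2 : s ^+ 2 = `|s| ^+ 2 by rewrite -normrX ger0_norm ?sqr_ge0.
have n0 := normr_ge0 s; have d := den_gt0 s.
rewrite normrM; have -> : `|if odd j then -1 else 1| = 1 :> R.
  by case: ifP; rewrite ?normrN1 ?normr1.
rewrite mul1r s2 ger0_norm; last by rewrite mulr_ge0 ?(ltW k0) //; nra.
have n1 : 1 + `|s| != 0 by rewrite gt_eqF //; lra.
by field; rewrite n1 gt_eqF.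
Qed.

(** The factor p/q turns [mid j] into j/2, an integer on even edges; on odd ones the remaining 1/2
    is the one in [ga_in], where the height runs backwards. *)
Lemma edge_knot_lift (j : 'I_(2 * pn)) t : 0 <= t <= 1 ->
  knot_lift pn%:Z torus_al torus_ga (edge_point torus_polygon j t) (longitude j t).
Proof.
move=> t01; have p3 := p_gt3; set x := edge_point _ _ _.
have p0 : p != 0 by rewrite gt_eqF //; lra.
have q0 : q != 0 by rewrite gt_eqF // /q; lra.
have [i hi] : exists i : int, torus_al x = longitude j t + i%:~R.
  rewrite /torus_al /x edge_point_polar !cE; exact/turn_unique/radius_gt0.
have lx : torus_level x = 1 by exact: torus_level_edge.
have l0 : 0 < torus_level x by rewrite lx.
suff [k hk] : exists k : int, torus_ga x = p * longitude j t / q + k%:~R.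
  by exists i, k; split.
have zx : zc x / torus_level x = height j (2 * t - 1) by rewrite lx divr1 zc_edge.
have jE : (j : nat) = ((odd j) + j./2.*2)%N by rewrite odd_double_half.
have [oj|ej] := boolP (odd j); last first.
  have -> : torus_ga x = ga_out (zc x / torus_level x).
    rewrite /torus_ga quadric_edge (negbTE ej) mul1r mulr_ge0 ?(ltW kappa_gt0) //.
    by move: t01 => /andP[? ?]; nra.
  exists (- (j./2%:Z)); rewrite zx /height (negbTE ej) /ga_out /longitude.
  have -> : cot j = cot 0 by rewrite /cot /tilt (negbTE ej).
  rewrite /mid {1}jE (negbTE ej) add0n -muln2 natrM intrN.
  have -> : (j./2%:Z)%:~R = j./2%:R :> R by [].
  by field; rewrite p0 q0.
have [k hk] : exists k : int, torus_ga x = ga_in (zc x / torus_level x) + k%:~R.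
  rewrite /torus_ga; case: ifP => qx; last by exists 0; rewrite addr0.
  apply: ga_glue; apply: quadric0_level => //; apply/eqP.
  rewrite eq_le qx andbT quadric_edge oj mulN1r oppr_le0.
  by move: t01 => /andP[? ?]; rewrite mulr_ge0 ?(ltW kappa_gt0) //; nra.
exists (k - j./2%:Z); rewrite hk zx /height oj /ga_in /longitude.
have -> : cot j = cot 1 by rewrite /cot /tilt oj.
rewrite mulNr at_N /mid {1}jE oj -muln2 natrD natrM intrD intrN.
have -> : (true : nat)%:R = 1 :> R by [].
have -> : (j./2%:Z)%:~R = j./2%:R :> R by [].
by field; rewrite p0 q0.
Qed.

Lemma polar_radius (u v r : R) : 0 < r -> u ^+ 2 + v ^+ 2 = r ^+ 2 ->
  u = r * cs (turn u v) /\ v = r * sn (turn u v).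
Proof.
move=> r0 E; have := @turnP R u v.
by rewrite E exprn_gt0 // sqrtr_sqr gtr0_norm //; apply.
Qed.

(** The sheet determines the parity of the edge, the height its parameter, and the integer [k] which
    of the p edges of that parity it is. *)
Lemma torus_knot_polygon x : torus_level x = 1 ->
  (exists k : int, p * torus_al x - q * torus_ga x = k%:~R) ->
  polygon torus_polygon x.
Proof.
move=> lx [k hk]; have p3 := p_gt3; have pn0 : (pn%:Z != 0)%R by case: pn pn_gt3.
have p0 : p != 0 by rewrite gt_eqF //; lra.
have q0 : q != 0 by rewrite gt_eqF // /q; lra.
have [z1 Q] := torus_level1 lx.
pose b := ~~ (0 <= quadric x).
(* The angle differs from the longitude of the edge [b + 2i] by (k - i q)/p; as q is -1 modulo p,
   this is an integer when p divides k + i. *)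
pose i := `|modz (- k) pn%:Z|%N.
have iE : i%:Z = modz (- k) pn%:Z by rewrite gez0_abs // modz_ge0.
have ip : (i < pn)%N by rewrite -ltz_nat iE ltz_pmod // ltz_nat (leq_trans _ pn_gt3).
have jp : (b + i.*2 < 2 * pn)%N.
  rewrite mul2n -ltn_half_double -[_./2]/(_./2) addnC halfD /= doubleK odd_double /=.
  by rewrite [b./2](_ : _ = 0)%N ?addn0 //; case: (b).
pose j := Ordinal jp.
pose s := height b (zc x); pose t := (s + 1) / 2.
have ob : odd (b + i.*2) = b by rewrite oddD odd_double addbF oddb.
have s2 : s ^+ 2 = zc x ^+ 2 by rewrite /s /height; case: ifP; rewrite ?sqrrN.
have hs : height b s = zc x by rewrite /s /height; case: (odd b); rewrite ?opprK.
have sN : `|s| <= 1 by rewrite /s /height; case: ifP; rewrite ?normrN.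
have t01 : 0 <= t <= 1.
  by move: sN; rewrite ler_norml /t => /andP[? ?]; apply/andP; split; lra.
exists j, t; split => //.
have st : 2 * t - 1 = s by rewrite /t; field.
have tj : tilt j = tilt b by rewrite tilt_odd /= ob.
have hj : height j s = zc x by rewrite -hs /height /= ob oddb.
rewrite edge_point_polar st hj [LHS]vec3E.
have rE : xc x ^+ 2 + yc x ^+ 2 = radius j s ^+ 2.
  rewrite /radius sqr_sqrtr; last by rewrite addr_ge0 ?sqr_ge0.
  rewrite tj exprMn s2.
  have -> : cs (tilt b) ^+ 2 = 1 - sn (tilt b) ^+ 2 by rewrite -(cs2sn2 (tilt b)) addrK.
  have : xc x ^+ 2 + yc x ^+ 2 = quadric x + s0 + zc x ^+ 2 * (1 - s0).
    by rewrite /quadric; ring.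
  move=> ->; move: Q; rewrite /b /s0 /kappa; case: lerP => qx /= Q.
    by rewrite -/Sa; move: Q; rewrite (ger0_norm qx); set A := Sa; set B := Sb => Q; lra.
  by rewrite -/Sb; move: Q; rewrite (ltr0_norm qx); set A := Sa; set B := Sb => Q; lra.
have [hx hy] := polar_radius (radius_gt0 j s) rE.
have [l hl] : exists l : int, torus_al x = longitude j t + l%:~R.
  exists (divz (k + i%:Z) pn%:Z - i%:Z).
  have dv : (pn%:Z %| k + i%:Z)%Z.
    have : (pn%:Z %| i%:Z - (- k))%Z by rewrite -eqz_mod_dvd iE modz_mod.
    by rewrite opprK addrC.
  have E : (divz (k + i%:Z) pn%:Z)%:~R * p = k%:~R + i%:R.
    by rewrite /p -intrM divzK // intrD.
  have cj : cot j = cot b by rewrite /cot tj.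
  have mj : mid j = (b%:R + 2 * i%:R) * q / (2 * p).
    by rewrite /mid /= natrD -mul2n natrM.
  have lE : p * torus_al x = k%:~R + q * torus_ga x by rewrite -hk subrK.
  apply: (mulfI p0); rewrite lE /longitude st cj mj intrB.
  move: E; set D : R := (divz _ _)%:~R => E.
  have -> : k%:~R = D * p - i%:R by rewrite E addrK.
  rewrite /torus_ga lx divr1 /s /b.
  have -> : (i%:Z)%:~R = i%:R :> R by [].
  case: lerP => qx /=.
    by rewrite /ga_out /height /= /q; field; rewrite p0 q0.
  by rewrite /ga_in /height /= mulNr at_N /q; field; rewrite p0 q0.
move: hx hy; rewrite -/(torus_al x) hl /cs /sn cosDint sinDint => hx hy.
by congr vec3.
Qed.

Lemma mid_inj (i j : 'I_(2 * pn)) (k : int) : odd i = odd j ->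
  mid i - mid j = k%:~R -> i = j.
Proof.
move=> oij; have p3 := p_gt3.
have p0 : p != 0 by rewrite gt_eqF //; lra.
rewrite /mid => E.
have iE := odd_double_half i; have jE := odd_double_half j.
set d : int := (i./2%:Z - j./2%:Z)%R.
have {}E : d%:~R = p * (d - k)%:~R.
  rewrite intrB -E -iE -jE oij !natrD -!muln2 !natrM /d intrB.
  have -> (n : nat) : (n%:Z)%:~R = n%:R :> R by [].
  by rewrite /q; field.
have {}E : d = (pn%:Z * (d - k))%R.
  by apply/eqP; rewrite -(@eqr_int R) intrM E.
have hp (l : 'I_(2 * pn)) : (l./2 < pn)%N.
  by rewrite ltn_half_double -mul2n.
have hi := hp i; have hj := hp j.
have d0 : d = 0.
  have dd : (`|d| < pn)%N by rewrite /d; lia.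
  have dE : (`|d| = pn * `|d - k|)%N by rewrite [in LHS]E abszM absz_nat.
  apply/eqP; rewrite -absz_eq0; apply/eqP; move: dd; rewrite dE.
  by case: `|d - k|%N => [|n]; rewrite ?muln0 // mulnS ltnNge leq_addr.
by apply: val_inj => /=; rewrite -iE -jE oij; congr (_ + _.*2)%N; move: d0; rewrite /d; lia.
Qed.

Lemma cs_sn_inj (t u : R) : cs t = cs u -> sn t = sn u -> exists k : int, t - u = k%:~R.
Proof.
move=> hc hs; apply: cos2pi_eq1; rewrite -/(cs _) csD csN snN hc hs.
by rewrite -[RHS](cs2sn2 u); ring.
Qed.

(** On edges of different parity [quadric] has opposite signs, so they meet only at an extreme
    height; as one ascends and the other descends, one of the parameters would be 1, which is
    excluded. For equal parity, height and angle identify the point. *)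
Lemma torus_polygon_embedded : embedded_polygon torus_polygon.
Proof.
move=> i j t u /andP[t0 t1] /andP[u0 u1] E.
have k0 := kappa_gt0.
have hz : height i (2 * t - 1) = height j (2 * u - 1) by rewrite -!zc_edge E.
have hq := quadric_edge i t; rewrite E quadric_edge in hq.
have [oij|oij] := eqVneq (odd i) (odd j); last first.
  move: hz hq; rewrite /height.
  case: (odd i) (odd j) oij => [] [] //= _ hz hq; exfalso.
    have tu : 2 * u - 1 = 1 - 2 * t by lra.
    rewrite tu in hq; have h : kappa * (t * (1 - t)) = 0 by lra.
    move: h => /eqP; rewrite mulf_eq0 gt_eqF //= mulf_eq0 subr_eq0 => /orP[/eqP|/eqP]; lra.
  have tu : 2 * u - 1 = 1 - 2 * t by lra.
  rewrite tu in hq; have h : kappa * (t * (1 - t)) = 0 by lra.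
  move: h => /eqP; rewrite mulf_eq0 gt_eqF //= mulf_eq0 subr_eq0 => /orP[/eqP|/eqP]; lra.
have tu : t = u by move: hz; rewrite /height oij; case: (odd j); lra.
split => //; have Tij : tilt i = tilt j by rewrite tilt_odd oij -tilt_odd.
move: E; rewrite !edge_point_polar => E.
have rij : radius i (2 * t - 1) = radius j (2 * u - 1) by rewrite /radius Tij tu.
have rn : radius j (2 * u - 1) != 0 by rewrite gt_eqF // radius_gt0.
have hx := congr1 xc E; have hy := congr1 yc E.
rewrite !cE rij in hx hy.
have [k] := cs_sn_inj (mulfI rn hx) (mulfI rn hy).
rewrite /longitude /cot Tij tu => hk; apply: (@mid_inj i j k oij); rewrite -hk; ring.
Qed.

(** The vertical component fixes the ratio up to sign, the horizontal length then fixes the parity,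
    and the horizontal angle the edge. It serves to place a straight piece of the polygon in one
    edge. *)
Lemma torus_edges_direction (i j : 'I_(2 * pn)) (t t' u u' c : R) : t != t' ->
  edge_point torus_polygon i t - edge_point torus_polygon i t' =
  c *: (edge_point torus_polygon j u - edge_point torus_polygon j u') -> i = j.
Proof.
move=> tt'; rewrite !edge_pointE => E.
have [/andP[sb sab] sa] := Sab.
have hx := congr1 xc E; have hy := congr1 yc E; have hz := congr1 zc E.
rewrite /xc /yc /zc !mxE /= in hx hy hz; clear E.
set d := t - t'; set e := c * (u - u').
have d0 : d != 0 by rewrite subr_eq0.
have {}hx : d * (sn (mid i) * cs (tilt i)) = e * (sn (mid j) * cs (tilt j)).
  by rewrite /d /e; lra.
have {}hy : d * (cs (mid i) * cs (tilt i)) = e * (cs (mid j) * cs (tilt j)).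
  by rewrite /d /e; lra.
have {}hz : height i d = height j e.
  by move: hz; rewrite /height /d /e; case: (odd i); case: (odd j); lra.
have de : d ^+ 2 = e ^+ 2.
  have [->|->] : d = e \/ d = - e; rewrite ?sqrrN //.
  by move: hz; rewrite /height; case: (odd i); case: (odd j) => h; [left|right|right|left]; lra.
have d2 : d ^+ 2 != 0 by rewrite expf_neq0.
have c2 : cs (tilt i) ^+ 2 = cs (tilt j) ^+ 2.
  apply: (mulfI d2).
  transitivity ((d * (sn (mid i) * cs (tilt i))) ^+ 2 + (d * (cs (mid i) * cs (tilt i))) ^+ 2).
    by rewrite -[LHS]mulr1 -(cs2sn2 (mid i)); ring.
  by rewrite hx hy de -[RHS]mulr1 -(cs2sn2 (mid j)); ring.
have oij : odd i = odd j.
  move: c2; have := cs2sn2 (tilt i); have := cs2sn2 (tilt j).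
  rewrite (tilt_odd i) (tilt_odd j).
  case: (odd i) (odd j) => [] [] //=; rewrite -/Sa -/Sb => h1 h2 h3; lra.
have Tij : tilt i = tilt j by rewrite tilt_odd oij -tilt_odd.
have {}de : d = e by move: hz; rewrite /height oij; case: (odd j) => // /oppr_inj.
rewrite Tij -de in hx hy.
have cn : cs (tilt j) != 0 by rewrite gt_eqF // cs_tilt_gt0.
have [k hk] := cs_sn_inj (mulIf cn (mulfI d0 hy)) (mulIf cn (mulfI d0 hx)).
exact: (mid_inj oij hk).
Qed.

End TorusPolygon.

(** * Invariance of the boundary for surfaces *)

Lemma cvg_within_comp (T1 T2 T3 : topologicalType) (A : set T1) (B : set T2)
    (f : T1 -> T2) (h : T2 -> T3) (x : T1) (l : T3) :
  f @ within A (nbhs x) --> f x -> (forall y, A y -> B (f y)) ->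
  h @ within B (nbhs (f x)) --> l -> (h \o f) @ within A (nbhs x) --> l.
Proof.
move=> fx AB hl Q /hl hQ.
have /fx : nbhs (f x) (fun y => B y -> Q (h y)) by exact: hQ.
rewrite /= !nbhs_simpl /within /= => H.
by apply: filterS H => z Hz Az; apply: Hz => //; exact: AB.
Qed.

Section WindingNumber.
Variable R : realType.
Let V : normedModType R := (R^o * R^o)%type.

Definition sq : set V := [set z | 0 <= z.1 <= 1 /\ 0 <= z.2 <= 1].

Let convex_sq : convex sq.
Proof.
move=> x y t [x1 x2] [y1 y2] /andP[t0 t1]; split => /=.
  by rewrite /GRing.scale /=; apply/andP; split; nra.
by rewrite /GRing.scale /=; apply/andP; split; nra.
Qed.

Let near_fst (Q : V -> Prop) (a b : R) : (\forall z \near ((a, b) : V), Q z) ->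
  exists2 r : R, 0 < r & forall a', `|a' - a| < r -> Q (a', b).
Proof.
move=> /near_normP[r r0 h]; exists r => // a' ar; apply: h.
have -> : ((a', b) : V) - (a, b) = (a' - a, 0) by rewrite -[LHS]/(_, _) /= subrr.
by rewrite prod_normE /= normr0 gt_max ar.
Qed.

Let near_snd (Q : V -> Prop) (a b : R) : (\forall z \near ((a, b) : V), Q z) ->
  exists2 r : R, 0 < r & forall b', `|b' - b| < r -> Q (a, b').
Proof.
move=> /near_normP[r r0 h]; exists r => // b' br; apply: h.
have -> : ((a, b') : V) - (a, b) = (0, b' - b) by rewrite -[LHS]/(_, _) /= subrr.
by rewrite prod_normE /= normr0 gt_max r0 br.
Qed.

(* Otherwise the angle along the homotopy would be a continuous single-valued
   function on the square. *)
Lemma circle_not_contractible (U W : V -> R) (e : R) : 0 < e ->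
  (forall z, sq z -> U @ within sq (nbhs z) --> U z) ->
  (forall z, sq z -> W @ within sq (nbhs z) --> W z) ->
  (forall z, sq z -> 0 < U z ^+ 2 + W z ^+ 2) ->
  (forall t : R, 0 <= t <= 1 -> U (t, 0) = U (0, 0) /\ W (t, 0) = W (0, 0)) ->
  (forall s : R, 0 <= s <= 1 -> U (0, s) = U (1, s) /\ W (0, s) = W (1, s)) ->
  (forall t : R, 0 <= t <= 1 -> U (t, 1) = e * cos (2 * pi * t) /\
     W (t, 1) = e * sin (2 * pi * t)) ->
  False.
Proof.
move=> e0 cU cW nz bot side top.
pose al z := turn (U z) (W z).
have alC z : sq z -> \forall y \near z, sq y -> `|cfrac (al y - al z)| < 1 / 4.
  move=> sz; suff : \forall y \near within sq (nbhs z), `|cfrac (al y - al z)| < 1 / 4 by [].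
  by apply: turn_cvg; [exact: cU|exact: cW|exact: nz|lra].
(* The transport theorem again: the sections are now local lifts of the angle, and a flat section on
   the square is a global lift. *)
pose std (x : V) (v : R) (z : V) := v + cfrac (al z - al x).
have [f ff _] : exists2 f, flat std sq f & f ((0, 0) : V) = 0.
  apply: (@flat_exists R V sq std); rewrite ?lexx ?ler01 //.
  - by move=> x z v w vw; rewrite ltrD2r.
  - by move=> x z u; exists (u - cfrac (al z - al x)); rewrite /std subrK.
  - move=> x sx; near=> y => sy v; exists (v + cfrac (al y - al x)).
    have yx : `|cfrac (al y - al x)| < 1 / 4 by move: sy; near: y; exact: alC.
    have alCy := alC y sy.
    near=> z => sz; have zy : `|cfrac (al z - al y)| < 1 / 4.
      by move: sz; near: z; exact: alCy.
    rewrite /std -addrA -cfracD //; congr (_ + cfrac _); ring.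
  - by split; rewrite /= lexx ler01.
have fE x : sq x -> \forall z \near x, sq z -> f z = f x + cfrac (al z - al x).
  move=> sx; have [v hv] := ff x sx; near=> z => sz.
  have -> : f x = v.
    have -> : f x = std x v x by move: (sx); apply: (nbhs_singleton hv).
    by rewrite /std subrr (@cfrac_uniq _ 0 0 0) ?addr0 // normr0; lra.
  by move: sz; near: z.
have c0 : cfrac (0 : R) = 0 by rewrite (@cfrac_uniq _ 0 0 0) ?addr0 // normr0; lra.
have u00 : 0 <= (0 : R) <= 1 by rewrite lexx ler01.
have u11 : 0 <= (1 : R) <= 1 by rewrite lexx ler01.
(* The lift is constant on the bottom, changes equally along both sides, and gains a full turn on
   the top: a contradiction. *)
have A : f (0, 0) = f (1, 0).
  apply: (@unit_interval_const R R (fun t => f (t, 0))) => t t01.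
  have [r r0 h] := near_fst (fE ((t, 0) : V) (conj t01 u00)).
  exists r => // t' t'01 t'r; rewrite h //.
  rewrite /al; have [-> ->] := bot t' t'01; have [-> ->] := bot t t01.
  by rewrite subrr c0 addr0.
have B : f (1, 0) - f (0, 0) = f (1, 1) - f (0, 1).
  apply: (@unit_interval_const R R (fun s => f (1, s) - f (0, s))) => s s01.
  have [r r0 h] := near_snd (fE ((1, s) : V) (conj u11 s01)).
  have [r' r'0 h'] := near_snd (fE ((0, s) : V) (conj u00 s01)).
  exists (Num.min r r'); first by rewrite lt_min r0.
  move=> s' s'01; rewrite lt_min => /andP[sr sr'].
  rewrite (h s' sr (conj u11 s'01)) (h' s' sr' (conj u00 s'01)).
  rewrite /al; have [-> ->] := side s' s'01; have [-> ->] := side s s01.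
  ring.
have C : f (0, 1) - 0 = f (1, 1) - 1.
  apply: (@unit_interval_const R R (fun t => f (t, 1) - t)) => t t01.
  have [r r0 h] := near_fst (fE ((t, 1) : V) (conj t01 u11)).
  exists (Num.min r (1 / 2)); first by rewrite lt_min r0; lra.
  move=> t' t'01; rewrite lt_min => /andP[tr tr'].
  rewrite h //.
  rewrite /al; have [-> ->] := top t' t'01; have [-> ->] := top t t01.
  have [k ->] := turn_unique t' e0; have [l ->] := turn_unique t e0.
  rewrite (@cfrac_uniq _ _ (t' - t) (k - l)) //; first ring.
  by rewrite intrB; ring.
by rewrite A in B; lra.
Unshelve. all: by end_near.
Qed.

End WindingNumber.

Section BoundaryInvariance.
Variables (R : realType) (W1 W2 : normedModType R) (l : W2 -> R) (e0 : W2).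
Hypothesis lD : forall (a b : R) p p', l (a *: p + b *: p') = a * l p + b * l p'.
Hypothesis le0 : l e0 = 1.

Let V : normedModType R := (R^o * R^o)%type.

(* [io] parametrizes a disc of [M] around [x] and [k1], [k2] are coordinates on
   [M] near [x], so [x] is an interior point. Shrinking the image of a circle
   around [x] radially in the half-disc would contract it in [M] minus [x]. *)
Lemma interior_not_boundary (M : set W1) (x : W1) (U : set W1) (P : set W2)
    (f : W1 -> W2) (g : W2 -> W1) (io : V -> W1) (k1 k2 : W1 -> R) (r0 r1 : R) :
  relatively_open M U -> relatively_open [set p | 0 <= l p] P -> U x ->
  (forall y, U y -> P (f y)) -> (forall p, P p -> U (g p)) ->
  (forall y, U y -> g (f y) = y) -> (forall p, P p -> f (g p) = p) ->
  (forall y, U y -> f @ within U (nbhs y) --> f y) ->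
  (forall p, P p -> g @ within P (nbhs p) --> g p) ->
  l (f x) = 0 ->
  0 < r0 -> 0 < r1 -> continuous io -> io (0, 0) = x ->
  (forall u w : R, `|u| < r0 -> `|w| < r0 ->
     [/\ M (io (u, w)), k1 (io (u, w)) = u & k2 (io (u, w)) = w]) ->
  (forall y, M y -> `|y - x| < r1 -> k1 @ within M (nbhs y) --> k1 y) ->
  (forall y, M y -> `|y - x| < r1 -> k2 @ within M (nbhs y) --> k2 y) ->
  (forall y, M y -> `|y - x| < r1 -> k1 y = 0 -> k2 y = 0 -> y = x) ->
  False.
Proof.
move=> [O Oo UE] [O' O'o PE] Ux fU gP gf fg fC gC lfx r00 r10 ioC io0 ioM k1C k2C kinj.
have Px := fU x Ux; have Mx : M x by move: Ux; rewrite UE => -[].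
have [d1 d10 hd1] : exists2 d : R, 0 < d & forall p, `|p - f x| < d -> O' p.
  by apply/near_normP; apply: open_nbhs_nbhs; split => //; move: Px; rewrite PE => -[].
have [d2 d20 hd2] : exists2 d : R, 0 < d & forall p, `|p - f x| < d -> P p -> `|g p - x| < r1.
  apply/near_normP.
  suff : \forall p \near within P (nbhs (f x)), `|g p - x| < r1 by [].
  have := gC _ Px; rewrite gf // => /cvgrPdist_lt /(_ _ r10).
  by apply: filterS => p; rewrite distrC.
pose d := Num.min d1 d2.
have d0 : 0 < d by rewrite lt_min d10.
have [r2 r20 hr2] : exists2 r : R, 0 < r & forall y, `|y - x| < r -> U y -> `|f y - f x| < d.
  apply/near_normP.
  suff : \forall y \near within U (nbhs x), `|f y - f x| < d by [].
  by have /cvgrPdist_lt /(_ _ d0) := fC _ Ux; apply: filterS => p; rewrite distrC.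
have [e1 e10 he1] : exists2 e : R, 0 < e & forall z : V, `|z| < e ->
    `|io z - x| < r2 /\ O (io z).
  have [e e0' h] : exists2 e : R, 0 < e & forall z : V, `|z - (0, 0)| < e ->
      `|io z - x| < r2 /\ O (io z).
    have ioC0 : io @ nbhs ((0, 0) : V) --> x by rewrite -io0; exact: ioC.
    apply/near_normP; near=> z; split.
      near: z; have /cvgrPdist_lt /(_ _ r20) := ioC0.
      by apply: filterS => p; rewrite distrC.
    near: z; apply: ioC0; apply: open_nbhs_nbhs; split => //.
    by move: Ux; rewrite UE => -[].
  exists e => // z ze; apply: h; rewrite (_ : (0, 0) = 0 :> V) // subr0 //.
pose e := Num.min e1 r0 / 2.
have ee0 : 0 < e by rewrite divr_gt0 // lt_min e10.
have er : e < r0.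
  by rewrite ltr_pdivrMr // (le_lt_trans (_ : _ <= r0)) ?ge_min ?lexx ?orbT //; lra.
have ee1 : e < e1.
  by rewrite ltr_pdivrMr // (le_lt_trans (_ : _ <= e1)) ?ge_min ?lexx //; lra.
set sq := @sq R; pose ci (z : V) : V := (e * cos (2 * pi * z.1), e * sin (2 * pi * z.1)).
have ci1 (t : R) : `|e * cos t| <= e.
  by rewrite normrM gtr0_norm // ger_pMr // cos_max.
have ci2 (t : R) : `|e * sin t| <= e.
  by rewrite normrM gtr0_norm // ger_pMr // sin_max.
have ciE z : `|ci z| < e1.
  by rewrite prod_normE /= gt_max !(le_lt_trans _ ee1).
have ciM z : [/\ M (io (ci z)), k1 (io (ci z)) = (ci z).1 & k2 (io (ci z)) = (ci z).2].
  by apply: ioM; apply: le_lt_trans er.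
have ciU z : U (io (ci z)).
  by rewrite UE; split; [have [] := ciM z|have [] := he1 _ (ciE z)].
have cP z : P (f (io (ci z))) by exact: fU.
have cd z : `|f (io (ci z)) - f x| < d by apply: hr2 => //; have [] := he1 _ (ciE z).
pose h := d / (2 * (1 + `|e0|)).
have n0 := normr_ge0 e0.
have h0 : 0 < h by rewrite divr_gt0 // mulr_gt0 //; lra.
(* A point at positive height [h]. A segment from it to a point of the half-plane can touch the
   boundary line only at its far end, so the contraction [pp] would meet [f x] only on the image of
   the circle, which misses it. *)
pose p0 := f x + h *: e0.
have p0d : `|p0 - f x| < d.
  rewrite /p0 addrAC subrr add0r normrZ gtr0_norm // /h mulrAC ltr_pdivrMr; last nra.
  by rewrite ltr_pM2l //; lra.
have lp0 : l p0 = h.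
  by rewrite /p0 -[f x]scale1r lD lfx le0; ring.
have lc z : 0 <= l (f (io (ci z))) by have := cP z; rewrite PE => -[].
pose pp (z : V) := (1 - z.2) *: p0 + z.2 *: f (io (ci z)).
have lpp z : l (pp z) = (1 - z.2) * h + z.2 * l (f (io (ci z))) by rewrite lD lp0.
have ppd z : sq z -> `|pp z - f x| < d.
  move=> [_ z2]; exact: (@convex_nball _ _ (f x) d p0 (f (io (ci z))) z.2 p0d (cd z) z2).
have ppP z : sq z -> P (pp z).
  move=> sz; rewrite PE; split; last first.
    by apply: hd1; apply: lt_le_trans (ppd z sz) _; rewrite ge_min lexx.
  rewrite /= lpp; have [_ /andP[z0 z1]] := sz.
  by rewrite addr_ge0 // mulr_ge0 // ?(ltW h0) // subr_ge0.
have gM z : sq z -> M (g (pp z)) by move=> /ppP /gP; rewrite UE => -[].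
have gr z : sq z -> `|g (pp z) - x| < r1.
  move=> sz; apply: hd2; last exact: ppP.
  by apply: lt_le_trans (ppd z sz) _; rewrite ge_min lexx orbT.
have ciC : continuous ci.
  move=> z; have z1C : 2 * pi * t.1 @[t --> z] --> 2 * pi * z.1.
    by apply: cvgMl_tmp; exact: cvg_fst.
  have FF : Filter (nbhs z) := nbhs_filter z.
  have Z1 : e * cos (2 * pi * t.1) @[t --> z] --> e * cos (2 * pi * z.1).
    by apply: cvgMl_tmp; apply: (cvg_comp _ _ z1C); exact: continuous_cos.
  have Z2 : e * sin (2 * pi * t.1) @[t --> z] --> e * sin (2 * pi * z.1).
    by apply: cvgMl_tmp; apply: (cvg_comp _ _ z1C); exact: continuous_sin.
  exact: cvg_pair Z1 Z2.
have ppC z : sq z -> pp @ within sq (nbhs z) --> pp z.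
  move=> sz.
  have C1 : (io \o ci) @ within sq (nbhs z) --> io (ci z).
    apply: cvg_trans (cvg_app _ (cvg_within _)) _.
    by apply: (cvg_comp _ _ (ciC z)); exact: ioC.
  have C2 : (f \o (io \o ci)) @ within sq (nbhs z) --> f (io (ci z)).
    by apply: (cvg_within_comp C1) (fC _ (ciU z)) => y _; exact: ciU.
  have C3 : t.2 @[t --> within sq (nbhs z)] --> z.2.
    by apply: cvg_trans (cvg_app _ (cvg_within _)) _; exact: cvg_snd.
  apply: cvgD; last exact: cvgZ.
  by apply: cvgZ; [apply: cvgB => //; exact: cvg_cst|exact: cvg_cst].
have gC' z : sq z -> (g \o pp) @ within sq (nbhs z) --> g (pp z).
  by move=> sz; apply: (cvg_within_comp (ppC z sz)) (gC _ (ppP z sz)); exact: ppP.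
have s01 (t : R) : 0 <= t <= 1 -> sq (t, 0) /\ sq (t, 1).
  by move=> t01; split; split; rewrite //= ?lexx ?ler01.
apply: (@circle_not_contractible R (k1 \o (g \o pp)) (k2 \o (g \o pp)) e) => //.
- move=> z sz; apply: (cvg_within_comp (gC' z sz)) (k1C _ (gM z sz) (gr z sz)) => y.
  exact: gM.
- move=> z sz; apply: (cvg_within_comp (gC' z sz)) (k2C _ (gM z sz) (gr z sz)) => y.
  exact: gM.
- move=> z sz /=; rewrite lt_neqAle addr_ge0 ?sqr_ge0 // andbT eq_sym.
  apply/negP; rewrite paddr_eq0 ?sqr_ge0 // !sqrf_eq0 => /andP[/eqP K1 /eqP K2].
  have gx := kinj _ (gM z sz) (gr z sz) K1 K2.
  have ppx : pp z = f x by rewrite -(gf _ Ux) in gx; rewrite -(fg _ (ppP z sz)) gx gf.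
  have := lpp z; rewrite ppx lfx => /esym E; have [_ /andP[z0 z1]] := sz.
  have zl : 0 <= z.2 * l (f (io (ci z))) by rewrite mulr_ge0.
  have z2 : z.2 = 1.
    apply/eqP; rewrite eq_le z1 leNgt; apply/negP => z2.
    have : 0 < (1 - z.2) * h by rewrite mulr_gt0 // subr_gt0.
    by lra.
  move: ppx; rewrite /pp z2 subrr scale0r add0r scale1r => /(congr1 g).
  rewrite !gf // => iox; have [_ /esym c1 /esym c2] := ciM z.
  have [_ ] := ioM 0 0 ltac:(by rewrite normr0) ltac:(by rewrite normr0).
  rewrite io0 -iox -c1 -c2 /= => /eqP; rewrite mulf_eq0 gt_eqF //= => /eqP cz.
  move=> /eqP; rewrite mulf_eq0 gt_eqF //= => /eqP sz'.
  by have := cos2Dsin2 (2 * pi * z.1); rewrite cz sz' !expr0n /= addr0 => /eqP; rewrite eq_sym oner_eq0.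
- by move=> t t01; rewrite /= /pp /= !subr0 !scale0r.
- move=> s ss; suff E : pp (0, s) = pp (1, s) by rewrite /comp E.
  rewrite /pp /ci /= mulr0 mulr1 cos0 sin0.
  have -> : 2 * pi = pi *+ 2 :> R by rewrite mulr_natl.
  by rewrite cos2pi sin2pi.
- move=> t t01; rewrite /comp; have -> : g (pp (t, 1)) = io (ci (t, 1)).
    by rewrite /pp /= subrr scale0r add0r scale1r gf.
  by have [_ -> ->] := ciM (t, 1).
Unshelve. all: by end_near. Qed.

End BoundaryInvariance.

Section FoldedDisc.
Variable R : realType.
Let V3 : normedModType R := 'rV[R]_3.
Let V : normedModType R := (R^o * R^o)%type.

Lemma chart_interior (M : set 'rV[R]_3) (x : 'rV[R]_3) f (io : V -> V3)
    (k1 k2 : V3 -> R) (r0 r1 : R) :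
  half_plane_chart M x f -> f x ord0 ord0 = 0 ->
  0 < r0 -> 0 < r1 -> continuous io -> io (0, 0) = x ->
  (forall u w : R, `|u| < r0 -> `|w| < r0 ->
     [/\ M (io (u, w)), k1 (io (u, w)) = u & k2 (io (u, w)) = w]) ->
  (forall y : V3, M y -> `|y - (x : V3)| < r1 -> k1 @ within M (nbhs y) --> k1 y) ->
  (forall y : V3, M y -> `|y - (x : V3)| < r1 -> k2 @ within M (nbhs y) --> k2 y) ->
  (forall y : V3, M y -> `|y - (x : V3)| < r1 -> k1 y = 0 -> k2 y = 0 -> y = x) ->
  False.
Proof.
move=> [U [P [rU rP Ux [g [fU gP gf fg [/subspace_continuousP fC /subspace_continuousP gC]]]]]] fx0.
have lD (a b : R) (p p' : 'rV[R]_2) :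
    (a *: p + b *: p') ord0 ord0 = a * p ord0 ord0 + b * p' ord0 ord0 by rewrite !mxE.
have le0 : (delta_mx ord0 ord0 : 'rV[R]_2) ord0 ord0 = 1 by rewrite mxE !eqxx.
apply: (@interior_not_boundary R V3 'rV[R]_2 (fun p => p ord0 ord0) _ lD le0
  M x U P f g io k1 k2 r0 r1) => //.
- by move=> y Uy; apply: gf; rewrite inE.
- by move=> p Pp; apply: fg; rewrite inE.
Qed.

Implicit Types (x y z e c d : V3) (A B : V3 -> R).

(** With [A], [B] dual to [e], [c], this is the half-plane bounded by the line x + R e and
    containing x + c. Continuous coordinates in place of an existential make its complement visibly
    open. *)
Definition half_at x e c A B : set V3 :=
  [set y | 0 <= B (y - x) /\ y - x = A (y - x) *: e + B (y - x) *: c].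

Lemma near_not_half_at x e c A B y : continuous A -> continuous B ->
  ~ half_at x e c A B y -> \forall z \near y, ~ half_at x e c A B z.
Proof.
move=> cA cB nh; have FF : Filter (nbhs y) := nbhs_filter y.
have Cs : (z - x) @[z --> y] --> y - x by apply: cvgB => //; exact: cvg_cst.
have CA : A (z - x) @[z --> y] --> A (y - x) by apply: (cvg_comp _ _ Cs); exact: cA.
have CB : B (z - x) @[z --> y] --> B (y - x) by apply: (cvg_comp _ _ Cs); exact: cB.
have [B0|B0] := lerP 0 (B (y - x)); last first.
  have : \forall z \near y, B (z - x) < 0 by exact: (cvgr_lt _ CB).
  by apply: filterS => z Bz [] ; rewrite leNgt Bz.
pose D z := z - x - (A (z - x) *: e + B (z - x) *: c).
have CD : `|D z| @[z --> y] --> `|D y|.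
  by apply: cvg_norm; apply: cvgB => //; apply: cvgD; apply: cvgZr_tmp.
have D0 : 0 < `|D y|.
  by rewrite normr_gt0 subr_eq0; apply/eqP => E; apply: nh.
have : \forall z \near y, 0 < `|D z| by exact: (cvgr_gt _ CD).
apply: filterS => z; rewrite normr_gt0 subr_eq0 => /eqP Dz [_ E]; exact: Dz.
Qed.

(** The pasting lemma for two relatively closed sets that cover [M] near [y]. *)
Lemma glue_cvg (M C D : set V3) (h1 h2 : V3 -> R) (y : V3) :
  h1 @ nbhs y --> h1 y -> h2 @ nbhs y --> h2 y ->
  (~ C y -> \forall z \near y, ~ C z) -> (~ D y -> \forall z \near y, ~ D z) ->
  (C y -> D y -> h1 y = h2 y) -> C y \/ D y ->
  (\forall z \near y, M z -> C z \/ D z) ->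
  (fun z => if pselect (C z) then h1 z else h2 z) @ within M (nbhs y) -->
  (if pselect (C y) then h1 y else h2 y).
Proof.
have FF : Filter (nbhs y) := nbhs_filter y.
move=> c1 c2 nC nD E CD M1; apply/cvgrPdist_lt => e e0.
have {}c1 : \forall z \near y, `|h1 y - h1 z| < e by move/cvgrPdist_lt : c1; exact.
have {}c2 : \forall z \near y, `|h2 y - h2 z| < e by move/cvgrPdist_lt : c2; exact.
suff : \forall z \near y, M z ->
  `|(if pselect (C y) then h1 y else h2 y) - (if pselect (C z) then h1 z else h2 z)| < e by [].
case: (pselect (C y)) => [Cy|/nC nCy] /=; last first.
  near=> z => Mz; have nCz : ~ C z by near: z.
  have h2z : `|h2 y - h2 z| < e by near: z.
  by case: pselect.
have [Dy|/nD nDy] := pselect (D y).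
  near=> z => Mz; have h1z : `|h1 y - h1 z| < e by near: z.
  have h2z : `|h2 y - h2 z| < e by near: z.
  by case: pselect => // ?; rewrite E.
near=> z => Mz; have h1z : `|h1 y - h1 z| < e by near: z.
have nDz : ~ D z by near: z.
have : C z \/ D z by move: Mz; near: z.
by case: pselect => // ? [].
Unshelve. all: by end_near. Qed.

(* A point [x] around which [M] is a disc folded along the line [x + R e]. *)
Lemma folded_interior (M : set 'rV[R]_3) x e c d A B A' B' (r r0 : R) f :
  continuous A -> continuous B -> continuous A' -> continuous B' ->
  (forall u w, A (u *: e + w *: c) = u /\ B (u *: e + w *: c) = w) ->
  (forall u w, A' (u *: e + w *: d) = u /\ B' (u *: e + w *: d) = w) ->
  0 < r -> (forall y, M y -> `|y - x| < r ->
     half_at x e c A B y \/ half_at x e d A' B' y) ->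
  (forall u w u' w', 0 <= w -> 0 <= w' ->
     u *: e + w *: c = u' *: e + w' *: d -> w = 0) ->
  0 < r0 -> (forall u w : R, `|u| < r0 -> 0 <= w < r0 ->
     M (x + (u *: e + w *: c)) /\ M (x + (u *: e + w *: d))) ->
  half_plane_chart M x f -> f x ord0 ord0 = 0 -> False.
Proof.
move=> cA cB cA' cB' AB AB' r_0 near sep r00 disc ch fx.
pose C := half_at x e c A B; pose D := half_at x e d A' B'.
(* The positive part of the second coordinate goes along [c] and the negative part along [d]: a flat
   disc bent over the line. *)
pose io (z : V) : V3 := x + (z.1 *: e + (((`|z.2| + z.2) / 2) *: c + ((`|z.2| - z.2) / 2) *: d)).
pose k1 (z : V3) : R := if pselect (C z) then A (z - x) else A' (z - x).
pose k2 (z : V3) : R := if pselect (C z) then B (z - x) else - B' (z - x).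
have subC (y : V3) : (z - x) @[z --> y] --> y - x.
  by have FF : Filter (nbhs y) := nbhs_filter y; apply: cvgB => //; exact: cvg_cst.
have CD y : C y -> D y -> A (y - x) = A' (y - x) /\ B (y - x) = - B' (y - x).
  move=> [B0 E] [B0' E'].
  have B1 := sep _ _ _ _ B0 B0' (etrans (esym E) E').
  have E2 : A (y - x) *: e + 0 *: d = A' (y - x) *: e + B' (y - x) *: d.
    by rewrite -E' scale0r addr0 [in RHS]E B1 scale0r addr0.
  have [a1 b1] := AB' (A (y - x)) 0; have [a2 b2] := AB' (A' (y - x)) (B' (y - x)).
  by rewrite E2 a2 in a1; rewrite E2 b2 in b1; rewrite a1 b1 B1 oppr0.
have rn y : `|y - x| < r -> \forall z \near y, `|z - x| < r.
  move=> yr; have FF : Filter (nbhs y) := nbhs_filter y.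
  have Cn : `|z - x| @[z --> y] --> `|y - x| by apply: cvg_norm; exact: subC.
  exact: (cvgr_lt _ Cn).
have kC (h1 h2 : V3 -> R) y : continuous h1 -> continuous h2 -> M y -> `|y - x| < r ->
    (C y -> D y -> h1 (y - x) = h2 (y - x)) ->
    (fun z => if pselect (C z) then h1 (z - x) else h2 (z - x)) @ within M (nbhs y) -->
    (if pselect (C y) then h1 (y - x) else h2 (y - x)).
  move=> c1 c2 My yr E; apply: (@glue_cvg M C D (fun z => h1 (z - x)) (fun z => h2 (z - x))) => //.
  - by apply: (cvg_comp _ _ (subC y)); exact: c1.
  - by apply: (cvg_comp _ _ (subC y)); exact: c2.
  - exact: near_not_half_at.
  - exact: near_not_half_at.
  - exact: near.
  - by apply: filterS (rn y yr) => z zr Mz; exact: near.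
apply: (@chart_interior M x f io k1 k2 r0 r ch fx r00 r_0).
- move=> z; have FF : Filter (nbhs z) := nbhs_filter z.
  have z1 : t.1 @[t --> z] --> z.1 by exact: cvg_fst.
  have z2 : t.2 @[t --> z] --> z.2 by exact: cvg_snd.
  have n2 : `|t.2| @[t --> z] --> `|z.2| by exact: cvg_norm.
  have m1 : (`|t.2| + t.2) / 2 @[t --> z] --> (`|z.2| + z.2) / 2.
    by apply: cvgMr_tmp; exact: cvgD.
  have m2 : (`|t.2| - t.2) / 2 @[t --> z] --> (`|z.2| - z.2) / 2.
    by apply: cvgMr_tmp; exact: cvgB.
  apply: cvgD; first exact: cvg_cst.
  by apply: cvgD; [exact: cvgZr_tmp|apply: cvgD; exact: cvgZr_tmp].
- by rewrite /io /= normr0 subr0 addr0 !mul0r !scale0r !addr0.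
- move=> u w ur wr; have [w0|w0] := lerP 0 w.
    have E : io (u, w) = x + (u *: e + w *: c).
      by rewrite /io /= ger0_norm // subrr mul0r scale0r addr0; congr (_ + (_ + _ *: _)); field.
    have [M1 _] : M (x + (u *: e + w *: c)) /\ M (x + (u *: e + w *: d)).
      by apply: disc => //; rewrite w0 /=; apply: le_lt_trans wr; exact: ler_norm.
    have [a b] := AB u w.
    have dx : io (u, w) - x = u *: e + w *: c by rewrite E addrAC subrr add0r.
    have Ci : C (io (u, w)) by split; rewrite dx ?a b.
    by rewrite /k1 /k2; case: (pselect (C (io (u, w)))) => // ? /=; rewrite dx a b E.
  have w0' : 0 <= - w by rewrite oppr_ge0 ltW.
  have E : io (u, w) = x + (u *: e + (- w) *: d).
    by rewrite /io /= ltr0_norm // addNr mul0r scale0r add0r; congr (_ + (_ + _ *: _)); field.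
  have [_ M1] : M (x + (u *: e + (- w) *: c)) /\ M (x + (u *: e + (- w) *: d)).
    apply: disc => //; rewrite w0' /=; apply: le_lt_trans wr.
    by rewrite -normrN ler_norm.
  have [a b] := AB' u (- w).
  have dx : io (u, w) - x = u *: e + (- w) *: d by rewrite E addrAC subrr add0r.
  have nC : ~ C (io (u, w)).
    move=> [Bi]; rewrite dx => E2; have := sep u (- w).
    have := sep _ _ _ _ Bi w0' ; rewrite dx => /(_ _ _ (esym E2)) B1.
    have : u *: e + (- w) *: d = A (u *: e + (- w) *: d) *: e + 0 *: d.
      by rewrite [LHS]E2 B1 !scale0r.
    move=> /(congr1 B'); rewrite b (AB' _ 0).2 => /eqP.
    by rewrite oppr_eq0 lt_eqF.
  by rewrite /k1 /k2; case: (pselect (C (io (u, w)))) => // ? /=; rewrite dx a b E opprK.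
- by move=> y My yr; apply: kC => // Cy Dy; have [] := CD y Cy Dy.
- move=> y My yr; apply: (kC B (fun z => - B' z)) => //.
    by move=> z; have FF : Filter (nbhs z) := nbhs_filter z; apply: cvgN; exact: cB'.
  by move=> Cy Dy; have [] := CD y Cy Dy.
- move=> y My yr; rewrite /k1 /k2; case: (pselect (C y)) => [[? E] /= a b|nC /= a b].
    by apply/eqP; rewrite -subr_eq0 E a b !scale0r addr0.
  have [//|[_ E]] := near y My yr.
  by apply/eqP; rewrite -subr_eq0 E a -[B' _]opprK b oppr0 !scale0r addr0.
Qed.

Lemma cvg_mulmx (N : 'M[R]_(3, 2)) (v : 'rV[R]_3) : (u *m N) @[u --> v] --> v *m N.
Proof.
have FF : Filter (nbhs v) := nbhs_filter v.
have E (u : 'rV[R]_3) : u *m N = 0 + u ord0 ord0 *: row ord0 N +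
    u ord0 (lift ord0 ord0) *: row (lift ord0 ord0) N + u ord0 ord_max *: row ord_max N.
  rewrite mulmx_sum_row !big_ord_recl big_ord0 addr0 add0r addrA.
  by have -> : lift ord0 (lift ord0 ord0) = ord_max :> 'I_3 by apply: val_inj.
rewrite E (_ : (fun u : 'rV[R]_3 => u *m N) = fun u : 'rV[R]_3 =>
  0 + u ord0 ord0 *: row ord0 N + u ord0 (lift ord0 ord0) *: row (lift ord0 ord0) N +
  u ord0 ord_max *: row ord_max N); last exact/funext.
have K i : u ord0 i *: row i N @[u --> v] --> v ord0 i *: row i N.
  by apply: cvgZr_tmp; exact: coord_continuous.
exact: (cvgD (cvgD (cvgD (cvg_cst 0) (K _)) (K _)) (K _)).
Qed.

Lemma cvg_mulmx2 (N : 'M[R]_(2, 3)) (v : 'rV[R]_2) : (u *m N) @[u --> v] --> v *m N.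
Proof.
have FF : Filter (nbhs v) := nbhs_filter v.
have E (u : 'rV[R]_2) : u *m N = 0 + u ord0 ord0 *: row ord0 N + u ord0 ord_max *: row ord_max N.
  rewrite mulmx_sum_row !big_ord_recl big_ord0 addr0 add0r.
  by have -> : lift ord0 ord0 = ord_max :> 'I_2 by apply: val_inj.
rewrite E (_ : (fun u : 'rV[R]_2 => u *m N) = fun u : 'rV[R]_2 =>
  0 + u ord0 ord0 *: row ord0 N + u ord0 ord_max *: row ord_max N); last exact/funext.
have K i : u ord0 i *: row i N @[u --> v] --> v ord0 i *: row i N.
  by apply: cvgZr_tmp; exact: coord_continuous.
exact: (cvgD (cvgD (cvg_cst 0) (K _)) (K _)).
Qed.

Definition independent2 e c := forall u w : R, u *: e + w *: c = 0 -> u = 0 /\ w = 0.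

(** [c] is row 0 because coordinate 0 is the one that [half_plane] constrains; [e] spans the
    boundary line. *)
Definition frame2 (e c : 'rV[R]_3) : 'M[R]_(2, 3) :=
  \matrix_(i < 2) (if i == ord0 then c else e).

Lemma frame2E (e c : 'rV[R]_3) (p : 'rV[R]_2) :
  p *m frame2 e c = p ord0 ord_max *: e + p ord0 ord0 *: c.
Proof.
rewrite mulmx_sum_row !big_ord_recl big_ord0 addr0 !rowK /= addrC.
by congr (p _ _ *: _ + _); apply: val_inj.
Qed.

Lemma frame2_inv (e c : 'rV[R]_3) : independent2 e c ->
  exists N : 'M[R]_(3, 2), frame2 e c *m N = 1%:M.
Proof.
move=> ind; apply/row_freeP/inj_row_free => p; rewrite frame2E => /ind[p1 p0].
apply/rowP => i; rewrite mxE; have [->|i0] := eqVneq i ord0; first by rewrite p0.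
rewrite -p1; congr (p _ _); apply: val_inj => /=.
by case: i i0 => [[|[|//]]].
Qed.

Lemma dual_coordinates e c : independent2 e c -> exists A B, [/\ continuous A, continuous B &
  forall u w, A (u *: e + w *: c) = u /\ B (u *: e + w *: c) = w].
Proof.
move=> /frame2_inv[N eN].
have C i : continuous (fun y : 'rV[R]_3 => (y *m N) ord0 i).
  move=> y; apply: (@continuous_comp _ _ _ (fun y : 'rV[R]_3 => y *m N)
    (fun p : 'rV[R]_2 => p ord0 i)); [exact: cvg_mulmx|exact: coord_continuous].
exists (fun y => (y *m N) ord0 ord_max), (fun y => (y *m N) ord0 ord0); split => // u w.
have -> : u *: e + w *: c = (\row_i (if i == ord0 then w else u)) *m frame2 e c.
  by rewrite frame2E !mxE.
by rewrite -mulmxA eN mulmx1 !mxE.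
Qed.

Lemma free_edge_chart (M : set 'rV[R]_3) x e c A B (r : R) : independent2 e c ->
  (forall u w, A (u *: e + w *: c) = u /\ B (u *: e + w *: c) = w) ->
  0 < r -> (forall y, `|y - x| < r -> (M y <-> half_at x e c A B y)) ->
  surface_boundary M x.
Proof.
move=> ind AB r0 near; have [N eN] := frame2_inv ind.
have B0 : B 0 = 0 by have [_] := AB 0 0; rewrite !scale0r addr0.
have A0 : A 0 = 0 by have [+ _] := AB 0 0; rewrite !scale0r addr0.
have Mx : M x.
  by apply/near; rewrite ?subrr ?normr0 // /half_at /= subrr A0 B0 !scale0r addr0.
pose f (y : 'rV[R]_3) : 'rV[R]_2 := (y - x) *m N.
pose g (p : 'rV[R]_2) : 'rV[R]_3 := x + p *m frame2 e c.
have fC : continuous f.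
  move=> y; have FF : Filter (nbhs y) := nbhs_filter y.
  have subC : (z - x) @[z --> y] --> y - x by apply: cvgB => //; exact: cvg_cst.
  exact: (@continuous_comp _ _ _ (fun z : 'rV[R]_3 => z - x)
    (fun z : 'rV[R]_3 => z *m N) y subC (@cvg_mulmx N (y - x))).
have gC : continuous g.
  move=> p; have FF : Filter (nbhs p) := nbhs_filter p.
  by apply: cvgD; [exact: cvg_cst|exact: cvg_mulmx2].
have fg p : f (g p) = p by rewrite /f /g addrAC subrr add0r -mulmxA eN mulmx1.
have gf y : half_at x e c A B y -> g (f y) = y /\ 0 <= f y ord0 ord0.
  move=> [By E].
  have E' : y - x = (\row_i (if i == ord0 then B (y - x) else A (y - x))) *m frame2 e c.
    by rewrite frame2E !mxE.
  have fy : f y = \row_i (if i == ord0 then B (y - x) else A (y - x)).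
    by rewrite /f [in LHS]E' -mulmxA eN mulmx1.
  by rewrite /g fy -E' addrC subrK mxE.
have gH (p : 'rV[R]_2) : 0 <= p ord0 ord0 -> half_at x e c A B (g p).
  move=> p0; rewrite /half_at /= /g addrAC subrr add0r frame2E.
  by have [-> ->] := AB (p ord0 ord_max) (p ord0 ord0).
split => //; exists f; last by rewrite /f subrr mul0mx mxE.
pose Bl : set 'rV[R]_3 := [set y : 'rV[R]_3 | `|(y : V3) - x| < r].
have oB : open Bl.
  rewrite openE => y; rewrite /Bl /= => yr; apply/(@near_normP R V3).
  exists (r - `|y - x|) => [|z zr]; first by rewrite subr_gt0.
  by rewrite /= -(subrK y z) -addrA (le_lt_trans (ler_normD _ _)) //; lra.
exists (M `&` Bl), (@half_plane R `&` g @^-1` Bl); split.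
- by exists Bl.
- by exists (g @^-1` Bl) => //; apply: open_comp => // p _; exact: gC.
- by split => //; rewrite /Bl /= subrr normr0.
- exists g; split.
  + move=> y [My yr]; have /gf[gy fy] := (near y yr).1 My.
    by split => //; rewrite /preimage /= gy.
  + by move=> p [p0 pr]; split => //; apply/near => //; exact: gH.
  + by move=> y; rewrite inE => -[My yr]; have /gf[] := (near y yr).1 My.
  + by move=> p _.
  + by split; apply: continuous_subspaceT.
Qed.

End FoldedDisc.

(** * Boundary points of a triangulated surface *)

Section FsetSums.
Variables (K : choiceType) (W : nmodType) (a b c : K) (F : K -> W).

Lemma sum_fset3 : uniq [:: a; b; c] ->
  \sum_(v <- [fset a; b; c]%fset) F v = F a + F b + F c.
Proof.
move=> u; have P : perm_eq [fset a; b; c]%fset [:: a; b; c].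
  by apply: uniq_perm; rewrite ?fset_uniq // => v; rewrite !inE orbA.
by rewrite (perm_big _ P) !big_cons big_nil /= addr0 addrA.
Qed.

Lemma card_fset3 : #|` [fset a; b; c]%fset| = 3%N -> uniq [:: a; b; c].
Proof.
rewrite /= !inE andbT negb_or.
have [->|ab] := eqVneq a b.
  have -> : [fset b; b; c]%fset = [fset b; c]%fset by apply/fsetP => v; rewrite !inE orbb.
  by rewrite cardfs2; case: (b != c).
have [->|ac] := eqVneq a c.
  have -> : [fset c; b; c]%fset = [fset c; b]%fset.
    by apply/fsetP => v; rewrite !inE -orbA orbCA orbb orbC.
  by rewrite cardfs2; case: (c != b).
have [->|bc] := eqVneq b c => //.
have -> : [fset a; c; c]%fset = [fset a; c]%fset by apply/fsetP => v; rewrite !inE -orbA orbb.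
by rewrite cardfs2; case: (a != c).
Qed.

End FsetSums.

Section SimplicialSurface.
Variables (R : realType) (T : {fset {fset 'rV[R]_3}}).
Variable o : {fset 'rV[R]_3} -> 'rV[R]_3 * 'rV[R]_3 * 'rV[R]_3.
Hypothesis hT : triangle_complex T.
Hypothesis ho : orientation T o.
Let V3 : normedModType R := 'rV[R]_3.
Implicit Types (a b c d x y : 'rV[R]_3) (s t u : {fset 'rV[R]_3}).
Let M := carrier T.

Definition istri a b c := [fset a; b; c]%fset \in T /\ uniq [:: a; b; c].

Lemma fset3_rot a b c : [fset b; c; a]%fset = [fset a; b; c]%fset :> {fset 'rV[R]_3}.
Proof. by apply/fsetP => v; rewrite !inE orbC orbA. Qed.

Lemma istri_rot a b c : istri a b c -> istri b c a.
Proof.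
move=> [sT u]; rewrite /istri fset3_rot; split => //.
by move: u; rewrite -(rot_uniq 1).
Qed.

Lemma istri_enum s : s \in T -> exists a b c, s = [fset a; b; c]%fset /\ istri a b c.
Proof.
move=> sT; have E := ho.1 s sT; exists (o s).1.1, (o s).1.2, (o s).2.
split => //; rewrite /istri E; split => //.
by apply: card_fset3; rewrite E; have [] := hT.1 s sT.
Qed.

Lemma hull3P a b c x : uniq [:: a; b; c] -> hull [fset a; b; c]%fset x <->
  exists l m n : R, [/\ 0 <= l, 0 <= m, 0 <= n, l + m + n = 1 &
    x = l *: a + m *: b + n *: c].
Proof.
move=> u; split => [[w [w0 w1 ->]]|[l [m [n [l0 m0 n0 lmn ->]]]]].
  exists (w a), (w b), (w c); split; try by apply: w0; rewrite !inE eqxx ?orbT.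
    by rewrite -w1 sum_fset3.
  by rewrite (sum_fset3 (fun v => w v *: v)).
have := u; rewrite /= !inE negb_or => /and3P[/andP[ab ac] bc _].
have ba : (b == a) = false by rewrite eq_sym; exact: negbTE.
have ca : (c == a) = false by rewrite eq_sym; exact: negbTE.
have cb : (c == b) = false by rewrite eq_sym; exact: negbTE.
exists (fun v => if v == a then l else if v == b then m else n); split.
- by move=> v _; case: ifP => // _; case: ifP.
- by rewrite sum_fset3 // eqxx ba eqxx ca cb.
- by rewrite (sum_fset3 (fun v => _ *: v)) // eqxx ba eqxx ca cb.
Qed.

Lemma istri_indep a b c (l m n : R) : istri a b c -> l + m + n = 0 ->
  l *: a + m *: b + n *: c = 0 -> [/\ l = 0, m = 0 & n = 0].
Proof.
move=> [sT u] S0 E; have := u; rewrite /= !inE negb_or => /and3P[/andP[ab ac] bc _].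
have ba : (b == a) = false by rewrite eq_sym; exact: negbTE.
have ca : (c == a) = false by rewrite eq_sym; exact: negbTE.
have cb : (c == b) = false by rewrite eq_sym; exact: negbTE.
have [_ ai] := hT.1 _ sT.
have := ai (fun v => if v == a then l else if v == b then m else n).
rewrite sum_fset3 // (sum_fset3 (fun v => _ *: v)) // !eqxx ba ca cb.
move=> /(_ S0 E) H; split.
- by have := H a; rewrite !inE !eqxx => ->.
- by have := H b; rewrite !inE !eqxx ba orbT => ->.
- by have := H c; rewrite !inE !eqxx ca cb !orbT => ->.
Qed.

Lemma bary_sub a b c (l m n l' m' n' : R) : l + m + n = 1 -> l' + m' + n' = 1 ->
  (l' *: a + m' *: b + n' *: c) - (l *: a + m *: b + n *: c) =
  (m' - m) *: (b - a) + (n' - n) *: (c - a).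
Proof.
move=> h h'; have -> : l = 1 - m - n by lra.
have -> : l' = 1 - m' - n' by lra.
by apply/rowP => i; rewrite !mxE; ring.
Qed.

Lemma bary_add a b c (l m n u w : R) :
  l *: a + m *: b + n *: c + (u *: (b - a) + w *: (c - a)) =
  (l - u - w) *: a + (m + u) *: b + (n + w) *: c.
Proof. by apply/rowP => i; rewrite !mxE; ring. Qed.

Lemma istri_indep2 a b c : istri a b c -> independent2 (b - a) (c - a).
Proof.
move=> tr u w E; have [] := @istri_indep a b c (- u - w) u w tr; first by ring.
  by rewrite -E; apply/rowP => i; rewrite !mxE; ring.
by [].
Qed.

Lemma hull_vertices a b c u (l m n : R) : istri a b c -> u \in T ->
  0 <= l -> 0 <= m -> 0 <= n -> l + m + n = 1 ->
  hull u (l *: a + m *: b + n *: c) ->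
  [/\ l != 0 -> a \in u, m != 0 -> b \in u & n != 0 -> c \in u].
Proof.
move=> tr uT l0 m0 n0 lmn hx; have [sT un] := tr.
have hs : hull [fset a; b; c]%fset (l *: a + m *: b + n *: c).
  by apply/hull3P => //; exists l, m, n.
have : (hull [fset a; b; c]%fset `&` hull u) (l *: a + m *: b + n *: c) by split.
rewrite (hT.2 _ _ sT uT) => -[w [w0 w1 E]].
pose w' v := if v \in u then w v else 0.
have S (W : lmodType R) (F : 'rV[R]_3 -> W) :
    \sum_(v <- ([fset a; b; c] `&` u)%fset) w v *: F v = w' a *: F a + w' b *: F b + w' c *: F c.
  rewrite -(sum_fset3 (fun v => w' v *: F v)) //.
  have <- : \sum_(v <- ([fset a; b; c] `&` u)%fset) w' v *: F v =
      \sum_(v <- [fset a; b; c]%fset) w' v *: F v.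
    apply: big_fset_incl; first exact: fsubsetIl.
    move=> v vs; rewrite in_fsetI vs /= /w' => /negbTE ->; exact: scale0r.
  rewrite big_seq [RHS]big_seq; apply: eq_bigr => v; rewrite in_fsetI => /andP[_ vu].
  by rewrite /w' vu.
have w1' : w' a + w' b + w' c = 1.
  have := S R^o (fun=> 1); rewrite /GRing.scale /= !mulr1 => <-.
  by apply: etrans _ w1; apply: eq_bigr => v _; rewrite mulr1.
have [] := @istri_indep a b c (l - w' a) (m - w' b) (n - w' c) tr.
- by move: lmn w1'; move: (w' a) (w' b) (w' c) => ? ? ?; clear; lra.
- have -> : (l - w' a) *: a + (m - w' b) *: b + (n - w' c) *: c =
    (l *: a + m *: b + n *: c) - (w' a *: a + w' b *: b + w' c *: c).
    by apply/rowP => i; rewrite !mxE; ring.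
  by rewrite E (S _ id) subrr.
move=> /subr0_eq -> /subr0_eq -> /subr0_eq ->.
by split; rewrite /w'; case: ifP; rewrite ?eqxx.
Qed.

Lemma near_not_hull u x : u \in T -> ~ hull u x -> \forall z \near (x : V3), ~ hull u z.
Proof.
move=> /istri_enum[a [b [c [-> tr]]]] nh; have [sT un] := tr.
have [A [B [cA cB AB]]] := dual_coordinates (istri_indep2 tr).
have H z : hull [fset a; b; c]%fset z <->
    [/\ half_at a (b - a) (c - a) A B z, 0 <= A (z - a) & 0 <= 1 - (A (z - a) + B (z - a))].
  split.
    move=> /(hull3P _ un)[l [m [n [l0 m0 n0 lmn ->]]]].
    have E : l *: a + m *: b + n *: c - a = m *: (b - a) + n *: (c - a).
      have -> : l = 1 - m - n by lra.
      by apply/rowP => i; rewrite !mxE; ring.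
    by rewrite /half_at /= E; have [-> ->] := AB m n; split => //; lra.
  move=> [[B0 E] A0 S]; apply/(hull3P _ un).
  exists (1 - (A (z - a) + B (z - a))), (A (z - a)), (B (z - a)); split => //; first by ring.
  rewrite -[LHS](subrK a) {1}E; set u' := A _; set w' := B _.
  by apply/rowP => i; rewrite !mxE; ring.
have FF : Filter (nbhs (x : V3)) := nbhs_filter (x : V3).
have Cs : ((z : V3) - a) @[z --> (x : V3)] --> (x : V3) - a by apply: cvgB => //; exact: cvg_cst.
have CA : A (z - a) @[z --> (x : V3)] --> A (x - a) by apply: (cvg_comp _ _ Cs); exact: cA.
have CB : B (z - a) @[z --> (x : V3)] --> B (x - a) by apply: (cvg_comp _ _ Cs); exact: cB.
have [hx|nhx] := pselect (half_at a (b - a) (c - a) A B x); last first.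
  have := near_not_half_at cA cB nhx; apply: filterS => z nz /H[] //.
have [A0|A0] := lerP 0 (A (x - a)); last first.
  have : \forall z \near (x : V3), A (z - a) < 0 by exact: (cvgr_lt _ CA).
  by apply: filterS => z Az /H[_]; rewrite leNgt Az.
have [S0|S0] := lerP 0 (1 - (A (x - a) + B (x - a))); first by case: nh; apply/H.
have CS : 1 - (A (z - a) + B (z - a)) @[z --> (x : V3)] --> 1 - (A (x - a) + B (x - a)).
  by apply: cvgB; [exact: cvg_cst|exact: cvgD].
have : \forall z \near (x : V3), 1 - (A (z - a) + B (z - a)) < 0 by exact: (cvgr_lt _ CS).
by apply: filterS => z Az /H[_ _]; rewrite leNgt Az.
Qed.

(** Triangles are closed and finite in number, so those that miss [x] stay away from a ball around
    it. *)
Lemma carrier_local x : exists2 r : R, 0 < r & forall y, M y -> `|(y : V3) - x| < r ->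
  exists u, [/\ u \in T, hull u y & hull u x].
Proof.
have H (l : seq {fset 'rV[R]_3}) : {subset l <= T} ->
    \forall z \near (x : V3), forall u, u \in l -> hull u z -> hull u x.
  have FF : Filter (nbhs (x : V3)) := nbhs_filter (x : V3).
  elim: l => [|u l IH] lT; first by apply: filterE => z u; rewrite in_nil.
  have /IH h1 : {subset l <= T} by move=> v vl; apply: lT; rewrite inE vl orbT.
  have uT : u \in T by apply: lT; rewrite inE eqxx.
  have h2 : \forall z \near (x : V3), hull u z -> hull u x.
    have [hx|/(near_not_hull uT)] := pselect (hull u x); first by apply: filterE.
    by apply: filterS => z nz /nz.
  apply: filterS2 h1 h2 => z h1 h2 v; rewrite inE => /orP[/eqP -> //|vl]; exact: h1.
have /near_normP[r r0 h] := H T (fun u h => h).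
exists r => // y [u uT uy] yr; exists u; split => //; exact: (h y yr).
Qed.

Lemma tri_eq a b c u : istri a b c -> u \in T -> a \in u -> b \in u -> c \in u ->
  u = [fset a; b; c]%fset.
Proof.
move=> [sT un] uT au bu cu; apply/esym/eqP; rewrite eqEfcard.
rewrite (hT.1 _ sT).1 (hT.1 _ uT).1 leqnn andbT.
by apply/fsubsetP => v; rewrite !inE => /orP[/orP[]|] /eqP ->.
Qed.

Lemma face_point_not_boundary a b c (l m n : R) : istri a b c ->
  0 < l -> 0 < m -> 0 < n -> l + m + n = 1 ->
  ~ surface_boundary M (l *: a + m *: b + n *: c).
Proof.
move=> tr l0 m0 n0 lmn [_ [f ch fx]]; have [sT un] := tr; move: ch fx.
set x := _ + _; move=> ch fx.
have [r r0 loc] := carrier_local x.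
have [A [B [cA cB AB]]] := dual_coordinates (istri_indep2 tr).
have cB' : continuous (fun z => - B z).
  move=> z; have FF : Filter (nbhs z) := nbhs_filter z; apply: cvgN; exact: cB.
have AB' (u w : R) : A (u *: (b - a) + w *: - (c - a)) = u /\
    - B (u *: (b - a) + w *: - (c - a)) = w.
  by rewrite scalerN -scaleNr; have [-> ->] := AB u (- w); rewrite opprK.
pose r1 := Num.min l (Num.min m n) / 2.
have r1l : r1 <= l / 2 by rewrite /r1 ler_pM2r ?invr_gt0 // ge_min lexx.
have r1m : r1 <= m / 2 by rewrite /r1 ler_pM2r ?invr_gt0 // !ge_min lexx orbT.
have r1n : r1 <= n / 2 by rewrite /r1 ler_pM2r ?invr_gt0 // !ge_min lexx !orbT.
have r10 : 0 < r1 by rewrite divr_gt0 // !lt_min l0 m0.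
(* A flat disc is treated as a fold by a straight angle. *)
apply: (@folded_interior R M x (b - a) (c - a) (- (c - a)) A B A (fun z => - B z)
  r r1 f cA cB cA cB' AB AB' r0) => //.
- move=> y My yr; have [u [uT uy ux]] := loc y My yr.
  have [au bu cu] := hull_vertices tr uT (ltW l0) (ltW m0) (ltW n0) lmn ux.
  have uE := tri_eq tr uT (au (lt0r_neq0 l0)) (bu (lt0r_neq0 m0)) (cu (lt0r_neq0 n0)).
  move: uy; rewrite uE => /(hull3P _ un)[l' [m' [n' [_ _ _ lmn' ->]]]].
  rewrite /half_at /= /x bary_sub //; have [-> ->] := AB (m' - m) (n' - n).
  have [nn|nn] := lerP 0 (n' - n); [by left|right; split; first by lra].
  by rewrite scaleNr scalerN opprK.
- move=> u w u' w' w0 w'0 E.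
  have [_ b1] := AB u w; have [_ b2] := AB' u' w'.
  by move: b2; rewrite -E b1; clear E; lra.
- move=> u w /ltr_normlP[u1 u2] /andP[w0 w1]; split.
    rewrite /x bary_add; exists [fset a; b; c]%fset => //; apply/(hull3P _ un).
    exists (l - u - w), (m + u), (n + w); split => //; try by lra.
  rewrite scalerN -scaleNr /x bary_add; exists [fset a; b; c]%fset => //; apply/(hull3P _ un).
  by exists (l - u - - w), (m + u), (n + - w); split => //; lra.
Qed.

(** The two triangles form a disc folded along the edge. Its halves meet only on the fold, since a
    common point off it would make [c] a vertex of the other triangle. *)
Lemma shared_edge_not_boundary a b c d (l m : R) : istri a b c -> istri a b d -> c != d ->
  (forall u, u \in T -> a \in u -> b \in u ->
     u = [fset a; b; c]%fset \/ u = [fset a; b; d]%fset) ->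
  0 < l -> 0 < m -> l + m = 1 ->
  ~ surface_boundary M (l *: a + m *: b).
Proof.
move=> tr tr' cd two l0 m0 lm [_ [f ch fx]]; move: ch fx.
have [sT un] := tr; have [sT' un'] := tr'.
have xE e : l *: a + m *: b = l *: a + m *: b + 0 *: e by rewrite scale0r addr0.
set x := _ + _; move=> ch fx.
have [r r0 loc] := carrier_local x.
have [A [B [cA cB AB]]] := dual_coordinates (istri_indep2 tr).
have [A' [B' [cA' cB' AB']]] := dual_coordinates (istri_indep2 tr').
have lm0 : l + m + 0 = 1 by rewrite addr0.
pose r1 := Num.min l m / 2.
have r1l : r1 <= l / 2 by rewrite /r1 ler_pM2r ?invr_gt0 // ge_min lexx.
have r1m : r1 <= m / 2 by rewrite /r1 ler_pM2r ?invr_gt0 // !ge_min lexx orbT.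
have r10 : 0 < r1 by rewrite divr_gt0 // !lt_min l0 m0.
have inC (u w : R) : `|u| < r1 -> 0 <= w < r1 ->
    hull [fset a; b; c]%fset (x + (u *: (b - a) + w *: (c - a))).
  move=> /ltr_normlP[u1 u2] /andP[w0 w1].
  rewrite /x (xE c) bary_add; apply/(hull3P _ un).
  by exists (l - u - w), (m + u), (0 + w); split => //; lra.
have inD (u w : R) : `|u| < r1 -> 0 <= w < r1 ->
    hull [fset a; b; d]%fset (x + (u *: (b - a) + w *: (d - a))).
  move=> /ltr_normlP[u1 u2] /andP[w0 w1].
  rewrite /x (xE d) bary_add; apply/(hull3P _ un').
  by exists (l - u - w), (m + u), (0 + w); split => //; lra.
apply: (@folded_interior R M x (b - a) (c - a) (d - a) A B A' B' r r1 f cA cB cA' cB'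
  AB AB' r0) => //.
- move=> y My yr; have [u [uT uy ux]] := loc y My yr.
  rewrite /x (xE c) in ux.
  have [au bu _] := hull_vertices tr uT (ltW l0) (ltW m0) (lexx 0) lm0 ux.
  have [uE|uE] := two u uT (au (lt0r_neq0 l0)) (bu (lt0r_neq0 m0)).
    left; move: uy; rewrite uE => /(hull3P _ un)[l' [m' [n' [_ _ n0 lmn' ->]]]].
    rewrite /half_at /= /x (xE c) bary_sub //.
    by have [-> ->] := AB (m' - m) (n' - 0); rewrite subr0.
  right; move: uy; rewrite uE => /(hull3P _ un')[l' [m' [n' [_ _ n0 lmn' ->]]]].
  rewrite /half_at /= /x (xE d) bary_sub //.
  by have [-> ->] := AB' (m' - m) (n' - 0); rewrite subr0.
- move=> u w u' w' w0 w'0 E.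
  apply/eqP; rewrite eq_le w0 andbT leNgt; apply/negP => wp.
  (* Rescaled, the common point lies in both triangles, off their common edge. *)
  move: E; pose k := r1 / (1 + (`|u| + w + `|u'| + w')).
  have n1 := normr_ge0 u; have n2 := normr_ge0 u'.
  have D0 : 0 < 1 + (`|u| + w + `|u'| + w') by lra.
  have k0 : 0 < k by rewrite divr_gt0.
  have kB (z : R) : 0 <= z -> z <= `|u| + w + `|u'| + w' -> 0 <= k * z < r1.
    move=> z0 zD; rewrite mulr_ge0 ?(ltW k0) //=.
    by rewrite /k mulrAC ltr_pdivrMr // ltr_pM2l //; lra.
  have kn (z : R) : `|k * z| = k * `|z| by rewrite normrM gtr0_norm.
  have q1 : `|k * u| < r1 by rewrite kn; have /andP[_] := kB `|u| n1 ltac:(lra).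
  have q2 : `|k * u'| < r1 by rewrite kn; have /andP[_] := kB `|u'| n2 ltac:(lra).
  have q3 : 0 <= k * w < r1 by apply: kB => //; lra.
  have q4 : 0 <= k * w' < r1 by apply: kB => //; lra.
  move=> E; have h1 := inC _ _ q1 q3; have h2 := inD _ _ q2 q4.
  have E' : (k * u) *: (b - a) + (k * w) *: (c - a) =
      (k * u') *: (b - a) + (k * w') *: (d - a) by rewrite -!scalerA -!scalerDr E.
  rewrite -E' in h2.
  move: h1 => /(hull3P _ un)[l1 [m1 [n1' [l10 m10 n10 lmn1 hE]]]].
  rewrite hE in h2.
  have [_ _ cu] := hull_vertices tr sT' l10 m10 n10 lmn1 h2.
  have : c \in [fset a; b; d]%fset.
    apply: cu; apply/eqP => n10'.
    have := hE; rewrite /x (xE c) bary_add n10'.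
    move=> /eqP; rewrite -subr_eq0 => /eqP hE0.
    have [] := @istri_indep a b c (l - k * u - k * w - l1) (m + k * u - m1) (0 + k * w - 0) tr.
    - by move: lmn1 lm n10'; clear; lra.
    - by rewrite -hE0; apply/rowP => i; rewrite !mxE; ring.
    - move=> _ _ /eqP; rewrite add0r subr0 mulf_eq0 !gt_eqF //.
  rewrite !inE (negbTE cd) orbF; move: un; rewrite /= !inE negb_or eq_sym.
  by move=> /andP[/andP[_ ac] /andP[bc _]] /orP[/eqP E1|/eqP E1]; move: ac bc; rewrite E1 eqxx.
- by move=> u w ur wr; split; [exists [fset a; b; c]%fset|exists [fset a; b; d]%fset] => //;
    [exact: inC|exact: inD].
Qed.

Lemma free_edge_boundary a b c (l m : R) : istri a b c ->
  (forall u, u \in T -> a \in u -> b \in u -> u = [fset a; b; c]%fset) ->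
  0 < l -> 0 < m -> l + m = 1 -> surface_boundary M (l *: a + m *: b).
Proof.
move=> tr one l0 m0 lm; have [sT un] := tr.
have xE : l *: a + m *: b = l *: a + m *: b + 0 *: c by rewrite scale0r addr0.
have lm0 : l + m + 0 = 1 by rewrite addr0.
set x := _ + _; have [r r0 loc] := carrier_local x.
have [A [B [cA cB AB]]] := dual_coordinates (istri_indep2 tr).
have FF : Filter (nbhs (x : V3)) := nbhs_filter (x : V3).
have Cs : ((z : V3) - x) @[z --> (x : V3)] --> (x : V3) - x by apply: cvgB => //; exact: cvg_cst.
have z0 : (0 : 'rV[R]_3) = 0 *: (b - a) + 0 *: (c - a) by rewrite !scale0r addr0.
have [A0 B0] := AB 0 0; rewrite -z0 in A0 B0.
have CA : A (z - x) @[z --> (x : V3)] --> A (x - x) by apply: (cvg_comp _ _ Cs); exact: cA.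
have CB : B (z - x) @[z --> (x : V3)] --> B (x - x) by apply: (cvg_comp _ _ Cs); exact: cB.
rewrite subrr A0 in CA; rewrite subrr B0 in CB.
have CS : A (z - x) + B (z - x) @[z --> (x : V3)] --> (0 + 0 : R) by exact: cvgD.
have /near_normP[r1 r10 h1] : \forall z \near (x : V3), - m < A (z - x) /\ A (z - x) + B (z - x) < l.
  apply: filterI; first by apply: (cvgr_gt _ CA); rewrite oppr_lt0.
  by apply: (cvgr_lt _ CS); rewrite addr0.
apply: (@free_edge_chart R M x (b - a) (c - a) A B (Num.min r r1)) => //.
- exact: istri_indep2.
- by rewrite lt_min r0.
move=> y; rewrite lt_min => /andP[yr yr1]; split.
  move=> My; have [u [uT uy ux]] := loc y My yr; rewrite /x xE in ux.
  have [au bu _] := hull_vertices tr uT (ltW l0) (ltW m0) (lexx 0) lm0 ux.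
  move: uy; rewrite (one u uT (au (lt0r_neq0 l0)) (bu (lt0r_neq0 m0))).
  move=> /(hull3P _ un)[l' [m' [n' [_ _ n0 lmn' ->]]]].
  rewrite /half_at /= /x xE bary_sub //.
  by have [-> ->] := AB (m' - m) (n' - 0); rewrite subr0.
move=> [By E]; have [Am ABl] := h1 y yr1.
exists [fset a; b; c]%fset => //; apply/(hull3P _ un).
exists (l - A (y - x) - B (y - x)), (m + A (y - x)), (0 + B (y - x)).
split; [clear E; lra|clear E; lra|clear E; lra|clear E; lra|].
by rewrite -bary_add -xE -[LHS](subrK x) {1}E addrC.
Qed.

Lemma directed_edge_third s a b : s \in T -> (a, b) \in directed_edges (o s) ->
  exists c, [/\ s = [fset a; b; c]%fset, istri a b c & (b, a) \notin directed_edges (o s)].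
Proof.
move=> sT; have E := ho.1 s sT; move: E; case: (o s) => [[x y] z] /= E.
have tr : istri x y z.
  by rewrite /istri E; split => //; apply: card_fset3; rewrite E; have [] := hT.1 s sT.
have [_ un] := tr; have := un; rewrite /= !inE negb_or => /and3P[/andP[xy xz] yz _].
have [yx [zx zy]] : y != x /\ z != x /\ z != y by rewrite !(eq_sym z) (eq_sym y).
have tr1 := istri_rot tr; have tr2 := istri_rot tr1.
have D := (negbTE xy, negbTE xz, negbTE yz, negbTE yx, negbTE zx, negbTE zy).
rewrite !xpair_eqE => /or3P[] /andP[/eqP -> /eqP ->].
- by exists z; split; [rewrite E| |rewrite !D /= ?andbF].
- by exists x; split; [rewrite fset3_rot E| |rewrite !D /= ?andbF].
- by exists y; split; [rewrite fset3_rot fset3_rot E| |rewrite !D /= ?andbF].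
Qed.

(* Three triangles on an edge would induce three mutually opposite directions. *)
Lemma directed_edge_two s t u a b : s \in T -> t \in T -> u \in T ->
  (a, b) \in directed_edges (o s) -> t != s -> u != s ->
  a \in t -> b \in t -> a \in u -> b \in u -> t = u.
Proof.
move=> sT tT uT sab ts us at_ bt au bu; apply/eqP; apply/negPn/negP => tu.
have tba : (b, a) \in directed_edges (o t) by apply: (ho.2 s t) => //; rewrite eq_sym.
have uba : (b, a) \in directed_edges (o u) by apply: (ho.2 s u) => //; rewrite eq_sym.
have uab : (a, b) \in directed_edges (o u) by exact: (ho.2 t u).
by have [_ [_ _]] := directed_edge_third uT uab; rewrite uba.
Qed.

End SimplicialSurface.

(** * Straight segments inside the polygon *)

Section PolygonEdges.
Variables (R : realType) (n : nat) (Q : 'I_n -> 'rV[R]_3).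
Hypothesis Qemb : embedded_polygon Q.
Implicit Types (i j : 'I_n) (t u : R) (a b x y : 'rV[R]_3).

Lemma edge_point_affine j t u s :
  edge_point Q j ((1 - s) * t + s * u) =
  (1 - s) *: edge_point Q j t + s *: edge_point Q j u.
Proof. by apply/rowP => i; rewrite /edge_point !mxE; ring. Qed.

Lemma edge_pointB j t u : edge_point Q j t - edge_point Q j u = (t - u) *: (Q (ordS j) - Q j).
Proof. by apply/rowP => i; rewrite /edge_point !mxE; ring. Qed.

Lemma edge_point0 j : edge_point Q j 0 = Q j.
Proof. by rewrite /edge_point subr0 scale1r scale0r addr0. Qed.

Lemma edge_point1 j : edge_point Q j 1 = edge_point Q (ordS j) 0.
Proof. by rewrite edge_point0 /edge_point subrr scale0r add0r scale1r. Qed.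

Lemma edge_point_inj j : injective (edge_point Q j).
Proof.
move=> t u E; have : (t - u) *: (Q (ordS j) - Q j) = 0 by rewrite -edge_pointB E subrr.
move=> /eqP; rewrite scaler_eq0 => /orP[|/eqP D]; first by rewrite subr_eq0 => /eqP.
have E0 : edge_point Q j 0 = edge_point Q j (1 / 2).
  by apply/eqP; rewrite -subr_eq0 edge_pointB D scaler0.
have [_] := Qemb (i := j) (j := j) (t := 0) (u := 1 / 2) ltac:(lra) ltac:(lra) E0.
by lra.
Qed.

Lemma edge_point_interior i j t u : 0 < t < 1 -> 0 <= u <= 1 ->
  edge_point Q i t = edge_point Q j u -> i = j /\ t = u.
Proof.
move=> t01 u01 E; have [u1|u1] := eqVneq u 1.
  have [_] := Qemb (i := i) (j := ordS j) (t := t) (u := 0) ltac:(lra) ltac:(lra)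
    (etrans E (etrans (congr1 _ u1) (edge_point1 j))).
  by move: t01; clear; lra.
apply: Qemb => //; first by lra.
by case/andP: u01 => -> u1'; rewrite lt_neqAle u1.
Qed.

Lemma edge_avoid_finite j (l : seq 'rV[R]_3) :
  exists2 t : R, 0 < t < 1 & forall u, t <= u < 1 -> edge_point Q j u \notin l.
Proof.
elim: l => [|x l [t t01 IH]]; first by exists (1 / 2) => //; lra.
have [[u [u1 E]]|nx] := pselect (exists u, u < 1 /\ x = edge_point Q j u).
  exists (Num.max t ((1 + u) / 2)).
    by rewrite lt_max gt_max; apply/andP; split; [apply/orP; left|apply/andP; split]; lra.
  move=> w; rewrite ge_max => /andP[/andP[tw uw] w1]; rewrite inE negb_or IH ?tw ?w1 // andbT.
  by rewrite E; apply/eqP => /edge_point_inj wu; clear E; lra.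
exists t => // u tu; rewrite inE negb_or IH // andbT.
by apply/eqP => E; apply: nx; exists u; case/andP: tu.
Qed.

Hypothesis Qdir : forall i j t t' u u' (c : R), t != t' ->
  edge_point Q i t - edge_point Q i t' = c *: (edge_point Q j u - edge_point Q j u') -> i = j.

(** Pigeonhole: of n + 1 points in a prescribed short piece of the segment, two lie on the same one
    of the n edges. *)
Lemma segment_two_points a b e : 0 < e ->
  (forall t, 0 < t < 1 -> polygon Q ((1 - t) *: a + t *: b)) ->
  forall t0, 0 <= t0 -> t0 + e <= 1 -> exists j t t' u u',
  [/\ t0 < t < t0 + e, t0 < t' < t0 + e, 0 <= u <= 1 /\ 0 <= u' <= 1, t != t' &
    (1 - t) *: a + t *: b = edge_point Q j u /\ (1 - t') *: a + t' *: b = edge_point Q j u'].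
Proof.
move=> e0 h t0 t00 t01.
pose p (k : 'I_n.+1) : R := t0 + e * ((k%:R + 1) / n.+3%:R).
have pP k : t0 < p k < t0 + e.
  have k1 : 0 < ((k : nat)%:R + 1) / n.+3%:R :> R.
    by rewrite divr_gt0 ?ltr0Sn // natr1 ltr0Sn.
  have k2 : ((k : nat)%:R + 1) / n.+3%:R < 1 :> R.
    by rewrite ltr_pdivrMr ?ltr0Sn // mul1r natr1 ltr_nat; have := ltn_ord k; lia.
  rewrite /p; move: k1 k2; set r := _ / _ => k1 k2.
  have := mulr_gt0 e0 k1; have : e * r < e * 1 by rewrite ltr_pM2l.
  by lra.
have pI k k' : p k = p k' -> k = k'.
  move=> /addrI /(mulfI (lt0r_neq0 e0)) /(mulIf _).
  have n0 : n.+3%:R^-1 != 0 :> R by rewrite invr_eq0 pnatr_eq0.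
  by move=> /(_ n0) /addIr /eqP; rewrite eqr_nat => /eqP /val_inj.
have ex k : exists ju, 0 <= ju.2 <= 1 /\ (1 - p k) *: a + p k *: b = edge_point Q ju.1 ju.2.
  by have [|j [u [u01 E]]] := h (p k); [have := pP k; lra|exists (j, u)].
have [f fP] := choice ex.
have : ~~ injectiveb (fun k => (f k).1).
  apply/negP => /injectiveP /leq_card; rewrite !card_ord; lia.
move=> /injectivePn[k [k' kk' E]].
exists (f k).1, (p k), (p k'), (f k).2, (f k').2; split; rewrite ?pP //.
- by have [? _] := fP k; have [? _] := fP k'.
- by apply/eqP => /pI /eqP; exact/negP.
- by split; [exact: (fP k).2|rewrite E; exact: (fP k').2].
Qed.

(** Two points on an edge [j] make the whole segment collinear with it. Every other short piece
    gives an edge with the same direction, which is [j] by [Qdir]; so the affine parameter [w] lies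
    in [0, 1] on a dense set. *)
Lemma segment_in_edge a b : a != b ->
  (forall t, 0 < t < 1 -> polygon Q ((1 - t) *: a + t *: b)) ->
  exists j u v, [/\ 0 <= u <= 1, 0 <= v <= 1, a = edge_point Q j u & b = edge_point Q j v].
Proof.
move=> ab h; have two := segment_two_points _ h.
have [j [t [t' [u [u' [_ _ _ tt' [E E']]]]]]] := two 1 ltr01 0 (lexx 0) ltac:(lra).
have dab s s' : ((1 - s) *: a + s *: b) - ((1 - s') *: a + s' *: b) = (s - s') *: (b - a).
  by apply/rowP => i; rewrite !mxE; ring.
have D0 : t - t' != 0 by rewrite subr_eq0.
pose k := (u - u') / (t - t'); pose w s := u + (s - t) * k.
have wE s : (1 - s) *: a + s *: b = edge_point Q j (w s).
  have h1 : (t - t') *: (b - a) = (u - u') *: (Q (ordS j) - Q j).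
    by rewrite -dab -edge_pointB E E'.
  have h2 : b - a = k *: (Q (ordS j) - Q j).
    by rewrite /k mulrC -scalerA -h1 scalerA mulVf // scale1r.
  apply: (addIr (- edge_point Q j u)); rewrite edge_pointB -{1}E dab h2 scalerA.
  by congr (_ *: _); rewrite /w; ring.
have close s e : 0 < e -> 0 <= s -> s + e <= 1 -> exists2 r, s < r < s + e & 0 <= w r <= 1.
  move=> e0 s0 s1; have [i [r [r' [v [v' [rs _ [v01 _] rr' [F F']]]]]]] := two e e0 s s0 s1.
  exists r => //; suff ij : i = j by move: F; rewrite ij wE => /edge_point_inj ->.
  have R0 : r - r' != 0 by rewrite subr_eq0.
  have vv' : v != v'.
    apply/eqP => vE; have := dab r r'; rewrite F F' vE subrr => /esym /eqP.
    by rewrite scaler_eq0 (negbTE R0) subr_eq0 eq_sym (negbTE ab).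
  apply: (Qdir (t := v) (t' := v') (u := w t) (u' := w t') (c := (r - r') / (t - t'))) => //.
  by rewrite -F -F' -!wE !dab scalerA divfK.
(* Only parameters arbitrarily close to the ends are known to be in range; the closed bounds pass to
   the limit. *)
have lim (x y : R) : (forall e, 0 < e -> e <= 1 -> exists2 r, 0 < r < e & 0 <= x + r * y <= 1) ->
    0 <= x <= 1.
  move=> H; apply/andP; have ny := ler_norm y; have ny' := ler_norm (- y).
  rewrite normrN in ny'; have y0 := normr_ge0 y.
  split; rewrite leNgt; apply/negP => x0.
    pose e := Num.min 1 (- x / (1 + `|y|)).
    have e0 : 0 < e by rewrite lt_min ltr01 divr_gt0 //; lra.
    have [|r /andP[r0 re] /andP[+ _]] := H e e0; first by rewrite ge_min lexx.
    have : r < - x / (1 + `|y|) by move: re; rewrite lt_min => /andP[].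
    by rewrite ltr_pdivlMr; [nra|lra].
  pose e := Num.min 1 ((x - 1) / (1 + `|y|)).
  have e0 : 0 < e by rewrite lt_min ltr01 divr_gt0 //; lra.
  have [|r /andP[r0 re] /andP[_ +]] := H e e0; first by rewrite ge_min lexx.
  have : r < (x - 1) / (1 + `|y|) by move: re; rewrite lt_min => /andP[].
  by rewrite ltr_pdivlMr; [nra|lra].
exists j, (w 0), (w 1); split.
- apply: (lim _ k) => e e0 e1; have [|r r0 wr] := close 0 e e0 (lexx 0); first by lra.
  by exists r; [lra|move: wr; rewrite /w; lra].
- apply: (lim _ (- k)) => e e0 e1; clear E E'.
  have [||r r0 wr] := close (1 - e) e e0; first by lra.
    by lra.
  by exists (1 - r); [lra|move: wr; rewrite /w; lra].
- by rewrite -wE subr0 scale1r scale0r addr0.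
- by rewrite -wE subrr scale0r add0r scale1r.
Qed.

End PolygonEdges.

(** * Antisymmetric rounding and cancellation over interior edges *)

Section FloorCeil.
Variable R : realType.
Implicit Types u v w : R.

(* Twice the antisymmetric rounding used to count crossings of integer translates. *)
Definition floor_ceil u : int := Num.floor u + Num.ceil u.

Lemma floor_ceilN u : floor_ceil (- u) = - floor_ceil u.
Proof.
have := Num.Theory.floorNceil (- u); have := Num.Theory.ceilNfloor (- u).
by rewrite /floor_ceil opprK => -> ->; lia.
Qed.

Lemma floor_ceil_int (k : int) : floor_ceil (k%:~R : R) = k + k.
Proof. by rewrite /floor_ceil Num.Theory.intrKfloor Num.Theory.intrKceil. Qed.

(** The rounding depends only on comparisons with integers, and these are what flat continuation
    preserves. *)
Lemma floor_ceil_eq u v : (forall k : int, (u < k%:~R) = (v < k%:~R)) ->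
  (forall k : int, (k%:~R < u) = (k%:~R < v)) -> floor_ceil u = floor_ceil v.
Proof.
move=> h h'; congr (_ + _); apply: le_anti; apply/andP; split.
- by rewrite -ltzD1 Num.Theory.floor_lt_int h Num.Theory.floorD1_gt.
- by rewrite -ltzD1 Num.Theory.floor_lt_int -h Num.Theory.floorD1_gt.
- by rewrite leNgt Num.Theory.ceil_gt_int h' -Num.Theory.ceil_gt_int ltxx.
- by rewrite leNgt Num.Theory.ceil_gt_int -h' -Num.Theory.ceil_gt_int ltxx.
Qed.

(** The floors add up to at most 0 and the ceilings to at least 0, with equality in both cases
    exactly when all three are integers. Otherwise the sums are at most -1 and at least 1, and they
    differ by at most 3. *)
Lemma floor_ceil_triangle u v w : u + v + w = 0 ->
  -1 <= floor_ceil u + floor_ceil v + floor_ceil w <= 1.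
Proof.
move=> S.
have [fu fu'] := andP (Num.Theory.floor_itv u); have [cu' cu] := andP (Num.Theory.ceil_itv u).
have [fv fv'] := andP (Num.Theory.floor_itv v); have [cv' cv] := andP (Num.Theory.ceil_itv v).
have [fw fw'] := andP (Num.Theory.floor_itv w); have [cw' cw] := andP (Num.Theory.ceil_itv w).
have F0 : Num.floor u + Num.floor v + Num.floor w <= 0.
  by rewrite -(ler_int R) !intrD; lra.
have C0 : 0 <= Num.ceil u + Num.ceil v + Num.ceil w.
  by rewrite -(ler_int R) !intrD; lra.
have FC : Num.floor u + Num.floor v + Num.floor w = 0 ->
    Num.ceil u + Num.ceil v + Num.ceil w = 0.
  move=> E; have : (Num.floor u + Num.floor v + Num.floor w)%:~R = 0 :> R by rewrite E.
  rewrite !intrD => ER.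
  have -> : u = (Num.floor u)%:~R by lra.
  have -> : v = (Num.floor v)%:~R by lra.
  have -> : w = (Num.floor w)%:~R by lra.
  by rewrite !Num.Theory.intrKceil.
have CF : Num.ceil u + Num.ceil v + Num.ceil w = 0 ->
    Num.floor u + Num.floor v + Num.floor w = 0.
  move=> E; have : (Num.ceil u + Num.ceil v + Num.ceil w)%:~R = 0 :> R by rewrite E.
  rewrite !intrD => ER.
  have -> : u = (Num.ceil u)%:~R by lra.
  have -> : v = (Num.ceil v)%:~R by lra.
  have -> : w = (Num.ceil w)%:~R by lra.
  by rewrite !Num.Theory.intrKfloor.
have h (x : R) : Num.floor x <= Num.ceil x <= Num.floor x + 1.
  rewrite (Num.Theory.ceil_floor x); move: (Num.floor x) (x \isn't a Num.int); clear.
  by move=> k [] /=; lia.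
have := h u; have := h v; have := h w; rewrite /floor_ceil.
move: F0 C0 FC CF; clear.
move: (Num.floor u) (Num.floor v) (Num.floor w) (Num.ceil u) (Num.ceil v) (Num.ceil w).
by move=> a b c d e f; lia.
Qed.

(** This is the saving of 1 for each triangle that has an edge on the knot. *)
Lemma floor_ceil_triangle_int (k : int) v w : k%:~R + v + w = 0 ->
  floor_ceil (k%:~R : R) + floor_ceil v + floor_ceil w = 0.
Proof.
move=> S; have -> : w = - (v + k%:~R) by lra.
rewrite floor_ceilN floor_ceil_int /floor_ceil.
have ki : (k%:~R : R) \is a Num.int by exact: intr_int.
rewrite (Num.Theory.floorDrz v ki) (Num.Theory.ceilDrz v ki).
by rewrite Num.Theory.intrKfloor Num.Theory.intrKceil; ring.
Qed.

End FloorCeil.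

Section AntisymmetricSum.
Variables (V : eqType) (D : seq (V * V)) (W : V * V -> int).

Definition flip (d : V * V) := (d.2, d.1).

Lemma flipK : involutive flip. Proof. by case. Qed.

Lemma antisymmetric_sum : uniq D ->
  (forall d, d \in D -> flip d \in D -> W (flip d) = - W d) ->
  \sum_(d <- D) W d = \sum_(d <- D | flip d \notin D) W d.
Proof.
move=> uD WN; rewrite (bigID (fun d => flip d \in D)) /=.
have P : perm_eq [seq d <- D | flip d \in D] [seq flip d | d <- [seq d <- D | flip d \in D]].
  apply: uniq_perm; first exact: filter_uniq.
    by rewrite map_inj_uniq ?filter_uniq //; exact: (inv_inj flipK).
  move=> d; rewrite mem_filter; apply/andP/mapP => [[fd dD]|[e + ->]].
    by exists (flip d); rewrite ?mem_filter ?flipK ?dD.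
  by rewrite mem_filter flipK => /andP[-> ->].
have : \sum_(d <- D | flip d \in D) W d = - \sum_(d <- D | flip d \in D) W d.
  rewrite -[LHS]big_filter (perm_big _ P) big_map big_filter /= -sumrN.
  rewrite big_seq_cond [RHS]big_seq_cond; apply: eq_bigr => d /andP[dD fd]; exact: WN.
move: (\sum_(d <- D | flip d \in D) W d) => S SN; have -> : S = 0 by lia.
exact: add0r.
Qed.

End AntisymmetricSum.

(** * The inequality of Milnor-Wood type for a surface spanning a polygon *)

Section MilnorWood.
Variables (R : realType) (n : nat) (Q : 'I_n -> 'rV[R]_3) (last : 'I_n) (N : nat).
Let V3 : normedModType R := 'rV[R]_3.
Let P : set V3 := polygon Q.
Hypothesis Qemb : embedded_polygon Q.
Hypothesis Qdir : forall i j (t t' u u' c : R), t != t' ->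
  edge_point Q i t - edge_point Q i t' = c *: (edge_point Q j u - edge_point Q j u') -> i = j.
Variables (std : V3 -> R -> V3 -> R) (lam : 'I_n -> R -> R).
Hypothesis std_lt : forall x z (v w : R), v < w -> std x v z < std x w z.
Hypothesis std_surj : forall x z (u : R), exists v, std x v z = u.
Hypothesis stdD1 : forall x (v : R) z, std x (v + 1) z = std x v z + 1.
Hypothesis std_compat : forall x, (~` P) x -> \forall y \near x, (~` P) y -> forall v,
  exists v', \forall z \near y, (~` P) z -> std x v z = std y v' z.
Hypothesis lam_flat : forall j t, 0 <= t <= 1 -> exists2 r : R, 0 < r &
  flat std (~` P `&` nball (edge_point Q j t : V3) r) (std (edge_point Q j t) (lam j t)).
Hypothesis lam_local : forall j t, 0 <= t <= 1 -> exists2 d : R, 0 < d &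
  forall t', 0 <= t' <= 1 -> `|t' - t| < d -> \forall z \near (edge_point Q j t' : V3),
    std (edge_point Q j t) (lam j t) z = std (edge_point Q j t') (lam j t') z.
Hypothesis lam_end : forall j, lam (ordS j) 0 = lam j 1 + (if j == last then N else 0%N)%:R.

Variables (T : {fset {fset 'rV[R]_3}}).
Variable o : {fset 'rV[R]_3} -> 'rV[R]_3 * 'rV[R]_3 * 'rV[R]_3.
Hypotheses (hT : triangle_complex T) (ho : orientation T o).
Hypothesis hS : surface_boundary (carrier T) = P.
Implicit Types (a b c x y z : 'rV[R]_3) (s : {fset 'rV[R]_3}).

Lemma stdDn x v z (k : nat) : std x (v + k%:R) z = std x v z + k%:R.
Proof.
elim: k => [|k IH]; first by rewrite !addr0.
by rewrite -natr1 !addrA stdD1 IH.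
Qed.

Lemma stdDz x v z (k : int) : std x (v + k%:~R) z = std x v z + k%:~R.
Proof.
case: k => k; first exact: stdDn.
have := stdDn x (v - k.+1%:R) z k.+1; rewrite subrK => ->.
by rewrite NegzE intrN addrK.
Qed.

Lemma flat_shift (D : set V3) f (k : int) : flat std D f -> flat std D (fun z => f z + k%:~R).
Proof.
move=> fD x Dx; have [v h] := fD x Dx; exists (v + k%:~R).
by apply: filterS h => z h Dz; rewrite h // stdDz.
Qed.

Lemma istri_swap a b c : istri T a b c -> istri T b a c.
Proof.
have E : [fset b; a; c]%fset = [fset a; b; c]%fset by apply/fsetP => v; rewrite !inE (orbC (v == b)).
move=> [sT un]; split; first by rewrite E.
by move: un; rewrite /= !inE !negb_or !andbT (eq_sym b a) => /andP[/andP[-> ->] ->].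
Qed.

Lemma istri_dart a b c (s := [fset a; b; c]%fset) : istri T a b c ->
  (a, b) \in directed_edges (o s) \/ (b, a) \in directed_edges (o s).
Proof.
move=> [sT un]; have E := ho.1 s sT; move: E; case: (o s) => [[x y] z] /= E.
have ain : a \in [fset x; y; z]%fset by rewrite E !inE eqxx.
have bin : b \in [fset x; y; z]%fset by rewrite E !inE eqxx orbT.
have ab : a != b by move: un; rewrite /= !inE negb_or => /andP[/andP[]].
move: ain bin ab; rewrite !inE !xpair_eqE => /orP[/orP[]|] /eqP -> /orP[/orP[]|] /eqP ->;
  rewrite ?eqxx ?orbT //=; by [left|right].
Qed.

Lemma dart_mem s a b : s \in T -> (a, b) \in directed_edges (o s) -> a \in s /\ b \in s.
Proof.
move=> sT /(directed_edge_third hT ho sT)[c [-> _ _]].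
by rewrite !inE !eqxx orbT.
Qed.

Definition unshared s a b := forall u, u \in T -> a \in u -> b \in u -> u = s.

(** A second triangle on this side would be the only other one, by the orientation, and the point
    would be interior to the surface. *)
Lemma polygon_dart_unshared s a b (l m : R) : s \in T -> (a, b) \in directed_edges (o s) ->
  0 < l -> 0 < m -> l + m = 1 -> P (l *: a + m *: b) -> unshared s a b.
Proof.
move=> sT sab l0 m0 lm Px u uT au bu; apply/eqP/negPn/negP => us.
have [c [sE tr _]] := directed_edge_third hT ho sT sab.
have uba : (b, a) \in directed_edges (o u) by apply: (ho.2 s u) => //; rewrite eq_sym.
have [d [uE /istri_swap tr' _]] := directed_edge_third hT ho uT uba.
have uE' : u = [fset a; b; d]%fset.
  by rewrite uE; apply/fsetP => v; rewrite !inE (orbC (v == b)).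
have cd : c != d by apply: contraNN us => /eqP cd; rewrite sE uE' cd.
move: Px; rewrite -hS; apply: (shared_edge_not_boundary hT ho tr tr' cd) => //.
move=> w wT aw bw; rewrite -sE -uE'; have [->|ws] := eqVneq w s; [by left|right].
exact: (directed_edge_two hT ho sT wT uT sab).
Qed.

Lemma polygon_edge_unshared a b c (l m : R) : istri T a b c ->
  0 < l -> 0 < m -> l + m = 1 -> P (l *: a + m *: b) -> unshared [fset a; b; c]%fset a b.
Proof.
move=> tr l0 m0 lm Px; have [sT _] := tr; have [h|h] := istri_dart tr.
  exact: (polygon_dart_unshared sT h l0 m0 lm).
move=> u uT au bu; apply: (polygon_dart_unshared sT h m0 l0) => //; first by rewrite addrC.
by rewrite addrC.
Qed.

Lemma unshared_in_edge a b c : istri T a b c -> unshared [fset a; b; c]%fset a b ->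
  exists j u v, [/\ 0 <= u <= 1, 0 <= v <= 1, a = edge_point Q j u & b = edge_point Q j v].
Proof.
move=> tr un; apply: (segment_in_edge Qemb Qdir).
  by have [_] := tr; rewrite /= !inE negb_or => /andP[/andP[]].
move=> t /andP[t0 t1]; suff : P ((1 - t) *: a + t *: b) by [].
by rewrite -hS; apply: (free_edge_boundary hT ho tr un) => //; lra.
Qed.

(** One polygon point inside a side makes the side unshared, so all of its inner points are boundary
    points; then it lies in a single edge of the polygon, end points included. *)
Lemma polygon_edge_closed a b c (l m : R) : istri T a b c ->
  0 < l -> 0 < m -> l + m = 1 -> P (l *: a + m *: b) ->
  forall t, 0 <= t <= 1 -> P ((1 - t) *: a + t *: b).
Proof.
move=> tr l0 m0 lm Px t t01; have un := polygon_edge_unshared tr l0 m0 lm Px.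
have [j [u [v [u01 v01 -> ->]]]] := unshared_in_edge tr un.
rewrite -edge_point_affine; exists j, ((1 - t) * u + t * v); split => //; clear Px; nra.
Qed.

Definition puncture s : set V3 := hull s `&` ~` P.

(** The polygon avoids the open triangle and contains each side completely once it meets its
    interior. If a segment hits it strictly between its ends, the hit is a vertex, and the segment
    is a point, or both ends lie on such a side. *)
Lemma convex_puncture s : s \in T -> convex (puncture s).
Proof.
move=> /(istri_enum hT ho)[a [b [c [-> tr]]]] x y t; have [sT un] := tr.
move=> [/(hull3P _ un)[l [m [k [l0 m0 k0 lmk ->]]]] nx].
move=> [/(hull3P _ un)[l' [m' [k' [l'0 m'0 k'0 lmk' ->]]]] ny] t01.
have zE : (1 - t) *: (l *: a + m *: b + k *: c) + t *: (l' *: a + m' *: b + k' *: c) =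
    ((1 - t) * l + t * l') *: a + ((1 - t) * m + t * m') *: b + ((1 - t) * k + t * k') *: c.
  by apply/rowP => i; rewrite !mxE; ring.
split.
  apply/(hull3P _ un); exists ((1 - t) * l + t * l'), ((1 - t) * m + t * m'), ((1 - t) * k + t * k').
  by split => //; clear zE; [nra|nra|nra|nra].
have [t0|t0] := eqVneq t 0; first by rewrite t0 subr0 scale1r scale0r addr0.
have [t1|t1] := eqVneq t 1; first by rewrite t1 subrr scale0r scale1r add0r.
have {t0 t1}[t0 t1] : 0 < t /\ t < 1.
  by case/andP: t01 => t0' t1'; rewrite !lt_neqAle t0' t1' t1 eq_sym t0.
rewrite zE => Pz; clear zE.
have zero (p q : R) : 0 <= p -> 0 <= q -> (1 - t) * p + t * q = 0 -> p = 0.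
  by move=> p0 q0 E; nra.
have pos (p q : R) : 0 <= p -> 0 <= q -> (1 - t) * p + t * q != 0 -> 0 < (1 - t) * p + t * q.
  by move=> p0 q0; rewrite lt_neqAle eq_sym => ->; nra.
have line (p q : R) x' y' : p + q = 1 -> p *: x' + q *: y' = (1 - q) *: x' + q *: y'.
  by move=> pq; have -> : p = 1 - q by lra.
have [L0|L0] := eqVneq ((1 - t) * l + t * l') 0.
  have l_0 := zero _ _ l0 l'0 L0; have [M0|M0] := eqVneq ((1 - t) * m + t * m') 0.
    have m_0 := zero _ _ m0 m'0 M0; apply: nx; move: Pz; rewrite L0 M0 l_0 m_0.
    have -> : k = 1 by lra.
    by have -> : (1 - t) * 1 + t * k' = 1 by nra.
  have [K0|K0] := eqVneq ((1 - t) * k + t * k') 0.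
    have k_0 := zero _ _ k0 k'0 K0; apply: nx; move: Pz; rewrite L0 K0 l_0 k_0.
    have -> : m = 1 by lra.
    by have -> : (1 - t) * 1 + t * m' = 1 by nra.
  apply: nx; rewrite l_0 scale0r add0r line; last by lra.
  apply: (polygon_edge_closed (istri_rot tr) (pos _ _ m0 m'0 M0) (pos _ _ k0 k'0 K0)); try by nra.
  by move: Pz; rewrite L0 scale0r add0r.
have [M0|M0] := eqVneq ((1 - t) * m + t * m') 0.
  have m_0 := zero _ _ m0 m'0 M0; have [K0|K0] := eqVneq ((1 - t) * k + t * k') 0.
    have k_0 := zero _ _ k0 k'0 K0; apply: nx; move: Pz; rewrite M0 K0 m_0 k_0.
    have -> : l = 1 by lra.
    by have -> : (1 - t) * 1 + t * l' = 1 by nra.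
  apply: nx; rewrite m_0 scale0r addr0 addrC line; last by lra.
  apply: (polygon_edge_closed (istri_rot (istri_rot tr)) (pos _ _ k0 k'0 K0) (pos _ _ l0 l'0 L0)); try by nra.
  by move: Pz; rewrite M0 scale0r addr0 addrC.
have [K0|K0] := eqVneq ((1 - t) * k + t * k') 0.
  have k_0 := zero _ _ k0 k'0 K0; apply: nx; rewrite k_0 scale0r addr0 line; last by lra.
  apply: (polygon_edge_closed tr (pos _ _ l0 l'0 L0) (pos _ _ m0 m'0 M0)); try by nra.
  by move: Pz; rewrite K0 scale0r addr0.
move: Pz; rewrite -hS; apply: (face_point_not_boundary hT ho tr); try exact: pos.
by clear zero pos line; nra.
Qed.

Lemma hull_mem s a : a \in s -> hull s a.
Proof.
move=> as_; exists (fun v => (v == a)%:R); split.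
- by move=> v _; rewrite ler0n.
- rewrite (bigD1_seq a) ?fset_uniq //= eqxx big1 ?addr0 // => v /negbTE ->.
  by rewrite mulr0n.
- rewrite (bigD1_seq a) ?fset_uniq //= eqxx scale1r big1 ?addr0 // => v /negbTE ->.
  by rewrite mulr0n scale0r.
Qed.

(** A small move towards the barycentre enters the open triangle. It provides points off the polygon
    at which sections near a vertex or side can be compared. *)
Lemma puncture_near s x (K : V3 -> Prop) : s \in T -> hull s x ->
  (\forall z \near (x : V3), K z) -> exists2 z, puncture s z & K z.
Proof.
move=> /(istri_enum hT ho)[a [b [c [-> tr]]]]; have [sT un] := tr.
move=> /(hull3P _ un)[l [m [k [l0 m0 k0 lmk ->]]]].
set y := _ + _; move=> /near_normP[r r0 h].
pose g : V3 := 3^-1 *: a + 3^-1 *: b + 3^-1 *: c.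
have [d d0 hd] := segment_near (y : V3) g r0.
pose t := Num.min (d / 2) (1 / 2).
have t0 : 0 < t by rewrite lt_min; apply/andP; split; lra.
have td : t < d by apply: (@le_lt_trans _ _ (d / 2)); [rewrite ge_min lexx|lra].
have t1 : t < 1 by apply: (@le_lt_trans _ _ (1 / 2)); [rewrite ge_min lexx orbT|lra].
have zE : (1 - t) *: y + t *: g = ((1 - t) * l + t / 3) *: a + ((1 - t) * m + t / 3) *: b +
    ((1 - t) * k + t / 3) *: c.
  by apply/rowP => i; rewrite !mxE; ring.
exists ((1 - t) *: y + t *: g); last first.
  have := hd 0 t; rewrite subr0 gtr0_norm // => /(_ td).
  by rewrite subr0 scale1r scale0r addr0 => /h.
rewrite zE; clear zE; split.
  by apply/(hull3P _ un); eexists _, _, _; split; [| | | |reflexivity]; nra.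
suff : ~ P (((1 - t) * l + t / 3) *: a + ((1 - t) * m + t / 3) *: b + ((1 - t) * k + t / 3) *: c) by [].
by rewrite -hS; apply: (face_point_not_boundary hT ho tr); nra.
Qed.

Lemma base_values : exists vv : V3 -> R, forall a,
  (exists2 r : R, 0 < r & flat std (~` P `&` nball (a : V3) r) (std a (vv a))) /\
  (P a -> exists j t, [/\ 0 <= t < 1, a = edge_point Q j t & vv a = lam j t]).
Proof.
suff H a : exists v : R,
    (exists2 r : R, 0 < r & flat std (~` P `&` nball (a : V3) r) (std a v)) /\
    (P a -> exists j t, [/\ 0 <= t < 1, a = edge_point Q j t & v = lam j t]).
  by have [vv vvP] := choice H; exists vv.
have [[j [t [/andP[t0 t1] ->]]]|nP] := pselect (P a); last first.
  by exists 0; split => //; exact: flat_std.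
(* The end of an edge is read as the start of the next one, so every polygon point gets one
   parameter in [0, 1). *)
have [t1'|t1'] := eqVneq t 1.
  exists (lam (ordS j) 0); rewrite t1' edge_point1; split; first by apply: lam_flat; lra.
  by move=> _; exists (ordS j), 0; split => //; lra.
exists (lam j t); split; first by apply: lam_flat; lra.
by move=> _; exists j, t; split => //; rewrite t0 lt_neqAle t1'.
Qed.

(** [flat_exists] extends the base section from one point of the punctured triangle near [a]; on the
    convex intersection with a ball around [a] the extension is the base section, by uniqueness. *)
Lemma vertex_sections (vv : V3 -> R) :
  (forall a, exists2 r : R, 0 < r & flat std (~` P `&` nball (a : V3) r) (std a (vv a))) ->
  exists sec : {fset 'rV[R]_3} -> V3 -> V3 -> R, forall s a, s \in T -> a \in s ->
  flat std (puncture s) (sec s a) /\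
  \forall z \near (a : V3), puncture s z -> sec s a z = std a (vv a) z.
Proof.
move=> vvP; suff H (sa : {fset 'rV[R]_3} * V3) : exists f : V3 -> R,
    sa.1 \in T -> sa.2 \in sa.1 -> flat std (puncture sa.1) f /\
    \forall z \near sa.2, puncture sa.1 z -> f z = std sa.2 (vv sa.2) z.
  by have [f fP] := choice H; exists (fun s a => f (s, a)) => s a; exact: (fP (s, a)).
case: sa => s a /=; have [sT|sT] := boolP (s \in T); last by exists (fun=> 0).
have [as_|as_] := boolP (a \in s); last by exists (fun=> 0).
have [r r0 fr] := vvP a.
have ball_a : \forall z \near (a : V3), nball (a : V3) r z by apply/near_normP; exists r.
have [z0 Cz0 z0r] := puncture_near sT (hull_mem as_) ball_a.
have cC := convex_puncture sT.
have CX : puncture s `<=` ~` P by move=> z [].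
have [f ff fz0] := flat_exists std_lt std_surj std_compat (std a (vv a) z0) cC CX Cz0.
exists f => _ _; split => //.
apply: filterS ball_a => z zr Cz.
have fD : flat std (puncture s `&` nball (a : V3) r) f by apply: flat_sub ff => y [].
have gD : flat std (puncture s `&` nball (a : V3) r) (std a (vv a)).
  by apply: flat_sub fr => y [[_ ny] yr].
apply: (flat_eq std_lt (convexI cC (@convex_nball _ _ _ _)) fD gD _ _ fz0); first by [].
by [].
Qed.

Lemma nball_near (x y : V3) (r : R) : `|y - x| < r -> \forall z \near y, nball x r z.
Proof.
move=> h; apply/near_normP; exists (r - `|y - x|); first by rewrite subr_gt0.
move=> z zy; rewrite /nball /=; have := ler_normD (z - y) (y - x); rewrite addrA subrK.
by move: zy; set p := `|z - y|; set q := `|y - x|; set w := `|z - x|; lra.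
Qed.

Lemma convex_hull s : convex (hull s : set V3).
Proof.
move=> x y t [w [w0 w1 ->]] [w' [w'0 w'1 ->]] t01.
exists (fun v => (1 - t) * w v + t * w' v); split.
- by move=> v vs; have := w0 v vs; have := w'0 v vs; nra.
- by rewrite big_split /= -!mulr_sumr w1 w'1; ring.
- rewrite !scaler_sumr -big_split /=; apply: eq_bigr => v _.
  by rewrite [RHS]scalerDl !scalerA.
Qed.

Section CrossingNumbers.
Variables (vv : V3 -> R) (sec : {fset 'rV[R]_3} -> V3 -> V3 -> R).
Hypothesis vvP : forall a, P a -> exists j t, [/\ 0 <= t < 1, a = edge_point Q j t & vv a = lam j t].
Hypothesis secP : forall s a, s \in T -> a \in s -> flat std (puncture s) (sec s a) /\
  \forall z \near (a : V3), puncture s z -> sec s a z = std a (vv a) z.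

Definition crossing s a b z := floor_ceil (sec s b z - sec s a z).

(** Flat sections keep their order over the convex puncture, and integer translates of a flat
    section are flat, as the bundle commutes with translation by 1. *)
Lemma crossing_const s a b z z' : s \in T -> a \in s -> b \in s ->
  puncture s z -> puncture s z' -> crossing s a b z = crossing s a b z'.
Proof.
move=> sT as_ bs Cz Cz'; have [fa _] := secP sT as_; have [fb _] := secP sT bs.
have cC := convex_puncture sT.
have lt1 (k : int) x y : puncture s x -> puncture s y ->
    sec s b x - sec s a x < k%:~R -> sec s b y - sec s a y < k%:~R.
  by move=> Cx Cy; rewrite !ltrBlDl; exact: (flat_lt std_lt cC fb (flat_shift k fa)).
have lt2 (k : int) x y : puncture s x -> puncture s y ->
    k%:~R < sec s b x - sec s a x -> k%:~R < sec s b y - sec s a y.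
  by move=> Cx Cy; rewrite !ltrBrDl; exact: (flat_lt std_lt cC (flat_shift k fa) fb).
by apply: floor_ceil_eq => k; apply/idP/idP; [exact: lt1|exact: lt1|exact: lt2|exact: lt2].
Qed.

Definition open_segment a b : set V3 :=
  [set e | exists l m : R, [/\ 0 < l, 0 < m, l + m = 1 & e = l *: a + m *: b]].

Lemma open_segmentC a b : open_segment a b = open_segment b a.
Proof.
by apply/seteqP; split => e [l [m [l0 m0 lm ->]]]; exists m, l; split => //; rewrite addrC.
Qed.

Lemma convex_open_segment a b : convex (open_segment a b).
Proof.
move=> x y t [l [m [l0 m0 lm ->]]] [l' [m' [l'0 m'0 lm' ->]]] t01.
exists ((1 - t) * l + t * l'), ((1 - t) * m + t * m').
split; [nra|nra|nra|by apply/rowP => i; rewrite !mxE; ring].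
Qed.

Lemma open_segment_near a b (K : V3 -> Prop) : (\forall z \near (a : V3), K z) ->
  exists2 e, open_segment a b e & K e.
Proof.
move=> /near_normP[r r0 h]; have [d d0 hd] := segment_near (a : V3) (b : V3) r0.
pose t := Num.min (d / 2) (1 / 2).
have t0 : 0 < t by rewrite lt_min; apply/andP; split; lra.
have td : t < d by apply: (@le_lt_trans _ _ (d / 2)); [rewrite ge_min lexx|lra].
have t1 : t < 1 by apply: (@le_lt_trans _ _ (1 / 2)); [rewrite ge_min lexx orbT|lra].
exists ((1 - t) *: a + t *: b).
  by exists (1 - t), t; split => //; lra.
have := hd 0 t; rewrite subr0 gtr0_norm // => /(_ td).
by rewrite subr0 scale1r scale0r addr0 => /h.
Qed.

(** A side shared by two triangles has no polygon point inside. At each end the sections of both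
    triangles have the same germ, so they agree along the open side. *)
Lemma crossing_opposite s s' a b z z' : s \in T -> s' \in T -> s != s' ->
  (a, b) \in directed_edges (o s) -> a \in s' -> b \in s' ->
  puncture s z -> puncture s' z' -> crossing s a b z = - crossing s' b a z'.
Proof.
move=> sT s'T ss' sab as' bs' Cz Cz'.
have [as_ bs] := dart_mem sT sab.
have EC u : u \in T -> a \in u -> b \in u -> open_segment a b `<=` puncture u.
  move=> uT au bu e [l [m [l0 m0 lm ->]]]; split; last first.
    move=> Pe; have un := polygon_dart_unshared sT sab l0 m0 lm Pe.
    by move: ss'; rewrite (un s' s'T as' bs') eqxx.
  have -> : l = 1 - m by rewrite -lm addrK.
  by apply: convex_hull; [exact: hull_mem|exact: hull_mem|lra].
have EZ := EC s sT as_ bs; have EZ' := EC s' s'T as' bs'.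
have agree x y : open_segment a b = open_segment x y -> x \in s -> x \in s' ->
    forall e, open_segment a b e -> sec s x e = sec s' x e.
  move=> Exy xs xs' e Ee; have [f hf] := secP sT xs; have [g hg] := secP s'T xs'.
  have FF : Filter (nbhs (x : V3)) := nbhs_filter (x : V3).
  have [e0 Ee0 [h h']] := open_segment_near y (filterI hf hg).
  rewrite -Exy in Ee0.
  apply: (flat_eq std_lt (@convex_open_segment a b) (flat_sub EZ f) (flat_sub EZ' g) Ee0 Ee).
  by rewrite h ?h' //; [exact: EZ'|exact: EZ].
have FF : Filter (nbhs (a : V3)) := nbhs_filter (a : V3).
have [e Ee _] := open_segment_near b (filterT : \forall z \near (a : V3), True).
rewrite (crossing_const sT as_ bs Cz (EZ e Ee)) (crossing_const s'T bs' as' Cz' (EZ' e Ee)).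
rewrite /crossing -floor_ceilN opprB (agree a b) // (agree b a) //; exact: open_segmentC.
Qed.

(** The correction between [lam j t] and the base value actually chosen: a point with parameter 1 is
    assigned to the next edge, and only after [last] does this shift the value. *)
Definition bump j (t : R) : int := if (t == 1) && (j == last) then N else 0.

Lemma base_value_bump a j t z : 0 <= t <= 1 -> a = edge_point Q j t ->
  std a (vv a) z = std a (lam j t) z + (bump j t)%:~R.
Proof.
move=> t01 aE; have Pa : P a by exists j, t.
have [i [u [u01 aE' ->]]] := vvP Pa; rewrite -stdDz; congr (std _ _ _).
rewrite /bump; have [t1|t1] := eqVneq t 1.
  have [-> ->] := Qemb (i := i) (j := ordS j) (t := u) (u := 0) u01 ltac:(lra)
    (etrans (esym aE') (etrans aE (etrans (congr1 _ t1) (edge_point1 Q j)))).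
  by rewrite lam_end t1 /=; case: eqVneq.
rewrite addr0; have t01' : 0 <= t < 1.
  by case/andP: t01 => t0 t1'; rewrite t0 lt_neqAle t1.
by have [-> ->] := Qemb u01 t01' (etrans (esym aE') aE).
Qed.

(** For a side on the polygon, the section of [a] continues as the invariant section [lam] all along
    the edge, so at [b] it differs from the section of [b] only by integer corrections. *)
Lemma section_along_edge s a b j u v : s \in T -> (a, b) \in directed_edges (o s) ->
  0 <= u <= 1 -> 0 <= v <= 1 -> a = edge_point Q j u -> b = edge_point Q j v ->
  forall z, puncture s z -> sec s b z - sec s a z = (bump j v - bump j u)%:~R.
Proof.
move=> sT sab u01 v01 aE bE z Cz; have [as_ bs] := dart_mem sT sab.
have cC := convex_puncture sT.
pose w (t : R) := (1 - t) * u + t * v; pose y t : V3 := edge_point Q j (w t).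
have w01 t : 0 <= t <= 1 -> 0 <= w t <= 1 by clear aE bE; rewrite /w; nra.
have yE t : y t = (1 - t) *: a + t *: b by rewrite /y edge_point_affine -aE -bE.
have hs t : 0 <= t <= 1 -> hull s (y t).
  by move=> t01; rewrite yE; apply: convex_hull => //; exact: hull_mem.
(* Continuation takes place next to the knot, inside the punctured triangle: at time [t] the section
   of [a] has the germ of the invariant section at [y t]. *)
pose K t := \forall z \near y t, puncture s z ->
  sec s a z = std (y t) (lam j (w t)) z + (bump j u)%:~R.
have y0 : y 0 = a by rewrite yE subr0 scale1r scale0r addr0.
have y1 : y 1 = b by rewrite yE subrr scale1r scale0r add0r.
have K0 : K 0.
  rewrite /K y0; have [_ +] := secP sT as_; apply: filterS => x + Cx => -> //.
  by rewrite (base_value_bump _ u01 aE) /w subr0 mul1r mul0r addr0.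
have K1 : K 1.
  apply: (unit_interval_ind (Q := K) _ (t := 0) (u := 1) _ _ K0); try lra.
  move=> t t01; have [r r0 fr] := lam_flat j (w01 t t01).
  have [d1 d10 hd1] := lam_local j (w01 t t01).
  have [d2 d20 hd2] := segment_near (a : V3) (b : V3) r0.
  exists (Num.min d1 d2); first by rewrite lt_min d10.
  move=> t' t'' t'01 t''01; rewrite !lt_min => /andP[d1' d2'] /andP[d1'' d2''] Kt'.
  have vu : `|v - u| <= 1 by rewrite ler_norml; clear aE bE; lra.
  have wd (x : R) : `|x - t| < d1 -> `|w x - w t| < d1.
    apply: le_lt_trans; have -> : w x - w t = (x - t) * (v - u) by rewrite /w; ring.
    by rewrite normrM ler_piMr.
  have B (x : R) : `|x - t| < d2 -> \forall z \near y x, nball (y t) r z.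
    by move=> xt; apply: nball_near; rewrite !yE; exact: hd2.
  have L' := hd1 (w t') (w01 _ t'01) (wd _ d1').
  have L'' := hd1 (w t'') (w01 _ t''01) (wd _ d1'').
  have FF : Filter (nbhs (y t')) := nbhs_filter (y t').
  have [z0 Cz0 [[e1 e2] e3]] := puncture_near sT (hs t' t'01) (filterI (filterI L' Kt') (B _ d2')).
  have FF' : Filter (nbhs (y t'')) := nbhs_filter (y t'').
  apply: filterS2 L'' (B _ d2'') => x Lx Bx Cx; rewrite -Lx.
  have fD : flat std (puncture s `&` nball (y t) r) (sec s a).
    by apply: flat_sub (secP sT as_).1 => ? [].
  have gD : flat std (puncture s `&` nball (y t) r)
      (fun x => std (y t) (lam j (w t)) x + (bump j u)%:~R).
    by apply: flat_shift; apply: flat_sub fr => ? [[_ ?] ?].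
  apply: (flat_eq std_lt (convexI cC (@convex_nball _ _ _ _)) fD gD (x := z0)) => //.
  by rewrite e2 // e1.
have FF : Filter (nbhs (b : V3)) := nbhs_filter (b : V3).
have [fb hb] := secP sT bs; rewrite /K y1 in K1.
have [z0 Cz0 [e1 e2]] := puncture_near sT (hull_mem bs) (filterI K1 hb).
have E0 : sec s b z0 = sec s a z0 + (bump j v - bump j u)%:~R.
  rewrite e1 // e2 // (base_value_bump _ v01 bE) /w subrr mul0r mul1r add0r intrB.
  by rewrite -addrA (addrC (bump j u)%:~R) subrK.
rewrite (flat_eq std_lt cC fb (flat_shift _ (secP sT as_).1) Cz0 Cz E0).
by rewrite addrC addKr.
Qed.

End CrossingNumbers.

Lemma polygon_point_edge s x : s \in T -> hull s x -> P x -> x \notin s ->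
  exists a b c (l m : R), [/\ s = [fset a; b; c]%fset, istri T a b c, 0 < l /\ 0 < m,
    l + m = 1 & x = l *: a + m *: b].
Proof.
move=> /(istri_enum hT ho)[a [b [c [-> tr]]]]; have [sT un] := tr.
move=> /(hull3P _ un)[l [m [k [l0 m0 k0 lmk ->]]]] Px xs.
have [L|L] := eqVneq l 0.
  move: Px xs lmk; rewrite L scale0r !add0r => Px xs lmk.
  have [M|M] := eqVneq m 0.
    move: xs; have -> : k = 1 by rewrite -lmk M add0r.
    by rewrite M scale0r add0r scale1r !inE eqxx !orbT.
  have [K|K] := eqVneq k 0.
    move: xs; have -> : m = 1 by rewrite -lmk K addr0.
    by rewrite K scale0r addr0 scale1r !inE eqxx !orbT.
  exists b, c, a, m, k; split; [exact/esym/fset3_rot|exact: istri_rot| |by []|by []].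
  by rewrite !lt_neqAle m0 k0 !(eq_sym 0) M K.
have [M|M] := eqVneq m 0.
  move: Px xs lmk; rewrite M scale0r !addr0 => Px xs lmk.
  have [K|K] := eqVneq k 0.
    move: xs; have -> : l = 1 by rewrite -lmk K addr0.
    by rewrite K scale0r addr0 scale1r !inE eqxx.
  exists c, a, b, k, l; split; [exact: fset3_rot|exact: (istri_rot (istri_rot tr))| | |].
  - by rewrite !lt_neqAle l0 k0 !(eq_sym 0) L K.
  - by rewrite addrC.
  - by rewrite addrC.
have [K|K] := eqVneq k 0.
  move: Px xs lmk; rewrite K scale0r !addr0 => Px xs lmk.
  exists a, b, c, l, m; split => //.
  by rewrite !lt_neqAle l0 m0 !(eq_sym 0) L M.
have pos (p : R) : 0 <= p -> p != 0 -> 0 < p by rewrite lt_neqAle eq_sym => -> ->.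
case: (face_point_not_boundary hT ho tr (pos _ l0 L) (pos _ m0 M) (pos _ k0 K) lmk).
by rewrite hS.
Qed.

(** The boundary dart lying in the edge [j] and touching its end, in either direction. It gives one
    boundary dart per polygon edge, and for [last] the place where the base value jumps. *)
Definition end_dart j (t : R) s (d : 'rV[R]_3 * 'rV[R]_3) := [/\ s \in T,
  d \in directed_edges (o s), 0 <= t < 1,
  d = (edge_point Q j 1, edge_point Q j t) \/ d = (edge_point Q j t, edge_point Q j 1) &
  unshared s (edge_point Q j 1) (edge_point Q j t)].

Lemma end_dart_exists j : exists t s d, end_dart j t s d.
Proof.
pose l : seq 'rV[R]_3 := flatten [seq (enum_fset s) | s <- enum_fset T].
have mem_l s a : s \in T -> a \in s -> a \in l.
  by move=> sT as_; apply/flatten_mapP; exists s.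
(* Beyond [t] the edge contains no vertex of the triangulation before its end, so the side through
   the point at [t] reaches that end. *)
have [t t01 avoid] := edge_avoid_finite Qemb j l.
have Px : P (edge_point Q j t) by exists j, t; split => //; lra.
have [[s sT hx] _] : surface_boundary (carrier T) (edge_point Q j t) by rewrite hS.
have xs : edge_point Q j t \notin s.
  by apply/negP => /(mem_l _ _ sT); apply/negP; apply: avoid; lra.
have [a [b [c [p [q [sE tr [p0 q0] pq xE]]]]]] := polygon_point_edge sT hx Px xs.
have [as_ bs] : a \in s /\ b \in s by rewrite sE !inE !eqxx orbT.
move: Px; rewrite xE => Px; have uns := polygon_edge_unshared tr p0 q0 pq Px.
have [i [u [v [u01 v01 aE bE]]]] := unshared_in_edge tr uns.
have E : edge_point Q j t = edge_point Q i ((1 - q) * u + q * v).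
  by rewrite edge_point_affine xE -aE -bE; congr (_ *: _ + _); rewrite -pq addrK.
have [ij tE] : j = i /\ t = (1 - q) * u + q * v.
  apply: (edge_point_interior Qemb t01 _ E); clear xE E aE bE; nra.
subst i; have ends w x : x \in s -> x = edge_point Q j w -> t <= w -> w <= 1 -> w = 1.
  move=> xs' xE' tw w1; have [//|w1'] := eqVneq w 1.
  have := avoid w; rewrite tw lt_neqAle w1 w1' => /(_ isT).
  by rewrite -xE' (mem_l _ _ sT xs').
have out x y w w' : (x, y) \in directed_edges (o s) \/ (y, x) \in directed_edges (o s) ->
    unshared s x y -> x = edge_point Q j w -> y = edge_point Q j w' -> w = 1 ->
    0 <= w' < 1 -> exists t s d, end_dart j t s d.
  move=> dart un xe ye we w'01; subst x y w.
  by case: dart => dart; [exists w', s, (edge_point Q j 1, edge_point Q j w')|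
    exists w', s, (edge_point Q j w', edge_point Q j 1)]; split => //; [left|right].
have dart := istri_dart tr; rewrite -sE in dart uns.
have [tu|ut] := lerP t u.
  have u1 : u = 1 by apply: (ends u a) => //; lra.
  apply: (out a b u v dart uns aE bE u1).
  case/andP: v01 => -> v1; rewrite lt_neqAle v1 andbT /=; apply/eqP => v1'.
  by move: t01; rewrite tE u1 v1' !mulr1 subrK ltxx andbF.
have tv : t <= v by clear xE E aE bE; nra.
have v1 : v = 1 by apply: (ends v b) => //; lra.
apply: (out b a v u _ _ bE aE v1); [by case: dart; [right|left]| |].
  by move=> w wT bw aw; exact: uns.
by clear xE E aE bE; lra.
Qed.

Lemma end_dart_istri j t s d (p := edge_point Q j 1) (y := edge_point Q j t) :
  end_dart j t s d -> exists c, s = [fset p; y; c]%fset /\ istri T p y c.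
Proof.
move=> [sT ds t01 [dE|dE] _]; rewrite dE in ds.
  by have [c [sE tr _]] := directed_edge_third hT ho sT ds; exists c.
have [c [sE /istri_swap tr _]] := directed_edge_third hT ho sT ds; exists c; split => //.
by rewrite sE; apply/fsetP => v; rewrite !inE (orbC (v == _)).
Qed.

Lemma dart_inj s s' d : s \in T -> s' \in T ->
  d \in directed_edges (o s) -> d \in directed_edges (o s') -> s = s'.
Proof.
case: d => a b sT s'T ds ds'; apply/eqP/negPn/negP => ss'.
have [as' bs'] := dart_mem s'T ds'; have ba := ho.2 _ _ _ _ sT s'T ss' ds as' bs'.
by have [c [_ _]] := directed_edge_third hT ho s'T ds'; rewrite ba.
Qed.

(** The shorter dart ends on the longer one. The complex condition makes the far end of the longer
    dart a vertex of the other triangle, so the triangles coincide, and a triangle has no three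
    collinear vertices. *)
Lemma end_dart_unique j t s d t' s' d' : end_dart j t s d -> end_dart j t' s' d' -> d = d'.
Proof.
wlog tt' : t s d t' s' d' / t <= t'.
  move=> H h h'; have [tt'|t't] := lerP t t'; first exact: (H t s d t' s' d').
  by apply/esym/(H t' s' d' t s d) => //; exact: ltW.
move=> e e'; have [c [sE tr]] := end_dart_istri e; have [c' [s'E tr']] := end_dart_istri e'.
have [sT ds t01 dE uns] := e; have [s'T ds' t'01 dE' uns'] := e'.
have p' : edge_point Q j 1 \in s' by rewrite s'E !inE eqxx.
have y' : edge_point Q j t' \in s' by rewrite s'E !inE eqxx orbT.
pose m := (1 - t') / (1 - t).
have m0 : 0 < m by rewrite divr_gt0 //; lra.
have m1 : m <= 1 by rewrite ler_pdivrMr; lra.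
have mE : (1 - m) * 1 + m * t = t'.
  have E : m * (1 - t) = 1 - t' by rewrite /m divfK //; lra.
  have -> : (1 - m) * 1 + m * t = 1 - m * (1 - t) by ring.
  by rewrite E; ring.
have yE : edge_point Q j t' = (1 - m) *: edge_point Q j 1 + m *: edge_point Q j t.
  by rewrite -edge_point_affine mE.
have hy : hull s' ((1 - m) *: edge_point Q j 1 + m *: edge_point Q j t + 0 *: c).
  by rewrite scale0r addr0 -yE; exact: hull_mem.
have ys' : edge_point Q j t \in s'.
  have [||//|_ + _] := hull_vertices hT tr s'T _ _ (lexx 0) _ hy.
  - by rewrite subr_ge0.
  - exact: ltW.
  - by rewrite subrK addr0.
  - by apply; exact: lt0r_neq0.
have ss' : s' = s by exact: uns.
have tE : t' = t.
  move: y'; rewrite ss' sE !inE => /orP[/orP[]|] /eqP E.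
  - by have := edge_point_inj Qemb E; clear E yE; lra.
  - exact: (edge_point_inj Qemb E).
  have [] := @istri_indep _ _ hT _ _ _ (1 - m) m (-1) tr; first by ring.
    by rewrite -yE -E scaleN1r subrr.
  by move=> _ _ /eqP; rewrite oppr_eq0 oner_eq0.
rewrite ss' in ds'; rewrite tE in dE'.
case: dE => dE; case: dE' => dE'; rewrite dE dE' //.
  rewrite dE in ds; rewrite dE' in ds'.
  by have [? [_ _]] := directed_edge_third hT ho sT ds; rewrite ds'.
rewrite dE in ds; rewrite dE' in ds'.
by have [? [_ _]] := directed_edge_third hT ho sT ds; rewrite ds'.
Qed.

Lemma unshared_dart s a b : s \in T -> (a, b) \in directed_edges (o s) ->
  (forall u, u \in T -> (b, a) \notin directed_edges (o u)) <-> unshared s a b.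
Proof.
move=> sT sab; split => [h u uT au bu|h u uT].
  apply/eqP/negPn/negP => us; have := h u uT.
  by rewrite (ho.2 s u) // eq_sym.
apply/negP => uba; have [bu au] := dart_mem uT uba.
move: uba; rewrite (h u uT au bu).
by have [c [_ _ /negP]] := directed_edge_third hT ho sT sab.
Qed.

Let darts := flatten [seq directed_edges (o s) | s <- enum_fset T].

Lemma dartsP d : reflect (exists2 s, s \in T & d \in directed_edges (o s)) (d \in darts).
Proof. exact: flatten_mapP. Qed.

Lemma uniq_directed_edges s : s \in T -> uniq (directed_edges (o s)).
Proof.
move=> sT; have E := ho.1 s sT; have un : uniq [:: (o s).1.1; (o s).1.2; (o s).2].
  by apply: card_fset3; rewrite E; have [] := hT.1 s sT.
move: un; case: (o s) => [[a b] c] /=; rewrite !inE !xpair_eqE !negb_or !negb_and !andbT.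
by move=> /andP[/andP[-> ab] bc]; rewrite ab bc orbT.
Qed.

Lemma uniq_darts : uniq darts.
Proof.
rewrite /darts; have : {subset enum_fset T <= T} by [].
elim: (enum_fset T) (fset_uniq T) => //= s l IH /andP[sl ul] lT.
have sT : s \in T by apply: lT; rewrite inE eqxx.
have lT' : {subset l <= T} by move=> t tl; apply: lT; rewrite inE tl orbT.
rewrite cat_uniq uniq_directed_edges // IH // andbT /=.
apply/hasPn => d /flatten_mapP[s' s'l ds']; apply/negP => ds.
by move: sl; rewrite (dart_inj sT (lT' _ s'l) ds ds') s'l.
Qed.

Lemma free_unshared s a b : s \in T -> (a, b) \in directed_edges (o s) ->
  (b, a) \notin darts <-> unshared s a b.
Proof.
move=> sT sab; rewrite -(unshared_dart sT sab); split => [h u uT|h].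
  by apply/negP => uba; move/negP: h; apply; apply/dartsP; exists u.
by apply/dartsP => -[u uT]; apply/negP; exact: h.
Qed.

Let free d := flip d \notin darts.

(* Each edge of the polygon contains a dart of its own. *)
Lemma card_free_triangles :
  (n <= 3 * count (fun s => has free (directed_edges (o s))) (enum_fset T))%N.
Proof.
have ex j : exists d : V3 * V3, exists t s, end_dart j t s d.
  by have [t [s [d h]]] := end_dart_exists j; exists d, t, s.
have [f fP] := choice ex.
have f_inj : injective f.
  move=> i j E; have [t [s [_ _ t01 h _]]] := fP i; have [t' [s' [_ _ t'01 h' _]]] := fP j.
  have t1 : 1 != t by apply: contraTneq t01 => <-; rewrite ltxx andbF.
  move: h'; rewrite -E; case: h => -> [] [h1 h2].
  - apply: (Qdir (t := 1) (t' := t) (u := 1) (u' := t') (c := 1)) => //.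
    by rewrite scale1r h1 h2.
  - apply: (Qdir (t := 1) (t' := t) (u := t') (u' := 1) (c := 1)) => //.
    by rewrite scale1r h1 h2.
  - apply: (Qdir (t := 1) (t' := t) (u := t') (u' := 1) (c := 1)) => //.
    by rewrite scale1r h1 h2.
  - apply: (Qdir (t := 1) (t' := t) (u := 1) (u' := t') (c := 1)) => //.
    by rewrite scale1r h1 h2.
pose l := [seq s <- enum_fset T | has free (directed_edges (o s))].
have -> : (3 * count (fun s => has free (directed_edges (o s))) (enum_fset T))%N =
    size (flatten [seq directed_edges (o s) | s <- l]).
  rewrite -size_filter -/l; elim: l => [|s l IH]; first by rewrite muln0.
  by rewrite /= size_cat -IH; case: (o s) => [[? ?] ?] /=; lia.
rewrite -[X in (X <= _)%N](size_enum_ord n) -(size_map f).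
apply: uniq_leq_size; first by rewrite map_inj_uniq // enum_uniq.
move=> _ /mapP[j _ ->]; have [t [s [sT ds t01 h uns]]] := fP j.
apply/flatten_mapP; exists s => //; rewrite mem_filter sT andbT; apply/hasP; exists (f j) => //.
move: ds; rewrite /free; case: h => -> ds; apply/(free_unshared sT ds) => //.
by move=> u uT au bu; exact: uns.
Qed.

Theorem milnor_wood : (9 <= n)%N -> (2 * N + 3 <= #|` T|)%N.
Proof.
move=> n9; have [vv vvP] := base_values.
have [sec secP] := vertex_sections (fun a => (vvP a).1).
have {}vvP a := (vvP a).2.
(* One sample point per triangle; by [crossing_const] its position is immaterial. *)
have [pt ptP] : exists pt : {fset 'rV[R]_3} -> V3, forall s, s \in T -> puncture s (pt s).
  suff H s : exists p, s \in T -> puncture s p by have [g gP] := choice H; exists g.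
  have [sT|] := boolP (s \in T); last by exists 0.
  have [a [b [c [sE _]]]] := istri_enum hT ho sT.
  have as_ : a \in s by rewrite sE !inE eqxx.
  have FF : Filter (nbhs (a : V3)) := nbhs_filter (a : V3).
  have [z Cz _] := puncture_near sT (hull_mem as_) (filterT : \forall z \near (a : V3), True).
  by exists z.
have [tri triP] : exists tri : V3 * V3 -> {fset 'rV[R]_3},
    forall d s, s \in T -> d \in directed_edges (o s) -> tri d = s.
  suff H d : exists s, forall s', s' \in T -> d \in directed_edges (o s') -> s = s'.
    by have [g gP] := choice H; exists g.
  have [/dartsP[s sT ds]|nd] := boolP (d \in darts).
    by exists s => s' s'T ds'; exact: (dart_inj sT s'T ds ds').
  by exists fset0 => s sT ds; case/negP: nd; apply/dartsP; exists s.
pose W (d : V3 * V3) := crossing sec (tri d) d.1 d.2 (pt (tri d)).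
have freeW s d j u v : s \in T -> d \in directed_edges (o s) -> 0 <= u <= 1 -> 0 <= v <= 1 ->
    d = (edge_point Q j u, edge_point Q j v) ->
    sec s d.2 (pt s) - sec s d.1 (pt s) = (bump j v - bump j u)%:~R.
  move=> sT ds u01 v01 dE; rewrite dE in ds *.
  exact: (section_along_edge vvP secP sT ds u01 v01 erefl erefl (ptP s sT)).
have free_edge s d : s \in T -> d \in directed_edges (o s) -> free d -> exists j u v,
    [/\ 0 <= u <= 1, 0 <= v <= 1 & d = (edge_point Q j u, edge_point Q j v)].
  case: d => a b sT ds /(free_unshared sT ds); have [c [sE tr _]] := directed_edge_third hT ho sT ds.
  by rewrite sE => /(unshared_in_edge tr)[j [u [v [u01 v01 -> ->]]]]; exists j, u, v.
(* The three differences of sections add up to 0. A free dart makes one of them an integer, which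
   trades the bound 1 for 0. *)
have triangle s : s \in T ->
    `|\sum_(d <- directed_edges (o s)) W d| + (has free (directed_edges (o s)))%:Z <= 1.
  move=> sT; have tE d : d \in directed_edges (o s) -> W d = crossing sec s d.1 d.2 (pt s).
    by move=> ds; rewrite /W (triP d s).
  have fi d : d \in directed_edges (o s) -> free d ->
      exists k : int, sec s d.2 (pt s) - sec s d.1 (pt s) = k%:~R.
    move=> ds fd; have [j [u [v [u01 v01 dE]]]] := free_edge s d sT ds fd.
    by exists (bump j v - bump j u); exact: freeW dE.
  rewrite (eq_big_seq _ tE); move: fi; clear tE.
  case: (o s) => [[a b] c] /= fi; rewrite !big_cons big_nil /= addr0 addrA /crossing.
  set x := sec s b _ - _; set y := sec s c _ - _; set z := sec s a _ - _.
  have xyz : x + y + z = 0 by rewrite /x /y /z; ring.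
  have [xE|xF] := boolP (free (a, b)).
    have [k kE] := fi (a, b) (mem_head _ _) xE; rewrite /= -/x in kE; rewrite kE in xyz *.
    by rewrite floor_ceil_triangle_int.
  have [yE|yF] := boolP (free (b, c)).
    have [|k kE] := fi (b, c) _ yE; first by rewrite !inE eqxx orbT.
    rewrite /= -/y in kE; rewrite kE in xyz *.
    by rewrite (addrC (floor_ceil x)) floor_ceil_triangle_int // -xyz; ring.
  have [zE|zF] := boolP (free (c, a)).
    have [|k kE] := fi (c, a) _ zE; first by rewrite !inE eqxx !orbT.
    rewrite /= -/z in kE; rewrite kE in xyz *.
    by rewrite addrC addrA floor_ceil_triangle_int // -xyz; ring.
  by have := floor_ceil_triangle xyz; rewrite addr0 ler_norml.
have total : `|\sum_(d <- darts) W d| +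
    (count (fun s => has free (directed_edges (o s))) (enum_fset T))%:Z <= #|` T|%:Z.
  rewrite /darts big_flatten big_map.
  suff H (l : seq {fset 'rV[R]_3}) : {subset l <= T} ->
      `|\sum_(s <- l) \sum_(d <- directed_edges (o s)) W d| +
      (count (fun s => has free (directed_edges (o s))) l)%:Z <= (size l)%:Z by exact: H.
  elim: l => [|s l IH] lT; first by rewrite big_nil.
  have sT : s \in T by apply: lT; rewrite inE eqxx.
  have /IH h : {subset l <= T} by move=> t tl; apply: lT; rewrite inE tl orbT.
  have h' := triangle s sT; rewrite big_cons /=.
  move: h h'; set p := \sum_(d <- _) _; set q := \sum_(s <- _) _.
  by move: (count _ _) (has _ _) => k b; have := ler_normD p q; lia.
have anti : \sum_(d <- darts) W d = \sum_(d <- darts | free d) W d.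
  apply: antisymmetric_sum uniq_darts _ => -[a b] /dartsP[s sT ds] /dartsP[s' s'T ds'].
  have ss' : s' != s.
    apply/eqP => ss'; rewrite ss' in ds'.
    by have [c [_ _]] := directed_edge_third hT ho sT ds; rewrite ds'.
  rewrite /W (triP _ s' s'T ds') (triP _ s sT ds) /=.
  have [as_ bs] := dart_mem sT ds.
  exact: (crossing_opposite secP s'T sT ss' ds' bs as_ (ptP s' s'T) (ptP s sT)).
have [t0 [s0 [d0 e0]]] := end_dart_exists last.
have [s0T d0s0 t001 d0E uns0] := e0.
have freeE s d j u v : s \in T -> d \in directed_edges (o s) -> 0 <= u <= 1 -> 0 <= v <= 1 ->
    d = (edge_point Q j u, edge_point Q j v) -> W d = (bump j v - bump j u) *+ 2.
  move=> sT ds u01 v01 dE; rewrite /W (triP d s) // /crossing (freeW s d j u v) //.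
  by rewrite floor_ceil_int.
(* Just one end of [d0] carries the jump N, and [floor_ceil] doubles integers. *)
have W0 : `|W d0| = (2 * N)%N.
  have b1 : bump last 1 = N by rewrite /bump !eqxx.
  have b0 : bump last t0 = 0 by rewrite /bump lt_eqF //; case/andP: t001.
  have t001' : 0 <= t0 <= 1 by lra.
  have one01 : 0 <= (1 : R) <= 1 by rewrite ler01 lexx.
  case: d0E => dE; [rewrite (freeE s0 d0 last 1 t0)|rewrite (freeE s0 d0 last t0 1)] => //;
    rewrite b0 b1; lia.
(* A correction occurs only at the end of [last], and no other free dart in that edge touches this
   point. *)
have Wother d : d \in darts -> free d -> d != d0 -> W d = 0.
  move=> /dartsP[s sT ds] fd dd0; have [j [u [v [u01 v01 dE]]]] := free_edge s d sT ds fd.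
  rewrite (freeE s d j u v) // /bump.
  have uns : unshared s (edge_point Q j u) (edge_point Q j v).
    by move: ds fd; rewrite dE => ds /(free_unshared sT ds).
  have uv : u != v.
    apply/eqP => uv; rewrite dE uv in ds.
    by have [c [_ _]] := directed_edge_third hT ho sT ds; rewrite ds.
  have lt1 (x : R) : 0 <= x <= 1 -> x != 1 -> 0 <= x < 1.
    by move=> /andP[-> x1]; rewrite lt_neqAle x1 => ->.
  have [jl|] := eqVneq j last; last by rewrite !andbF.
  rewrite !andbT; subst j; have [u1|u1] := eqVneq u 1.
    rewrite u1 in dE uns uv; case/eqP: dd0; apply: (end_dart_unique (t := v) (s := s) _ e0).
    by split => //; [apply: lt1; rewrite 1?eq_sym|left].
  have [v1|v1] := eqVneq v 1 => //.
  rewrite v1 in dE uns; case/eqP: dd0; apply: (end_dart_unique (t := u) (s := s) _ e0).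
  by split => //; [exact: lt1|right|move=> w wT bw aw; exact: uns].
have sum0 : `|\sum_(d <- darts) W d| = (2 * N)%N.
  have d0D : d0 \in darts by apply/dartsP; exists s0.
  have fd0 : free d0.
    move: d0s0; rewrite /free; case: d0E => -> ds; apply/(free_unshared s0T ds) => //.
    by move=> u uT au bu; exact: uns0.
  rewrite anti -big_filter (bigD1_seq d0) ?filter_uniq ?uniq_darts ?mem_filter ?fd0 //=.
  rewrite big1_seq ?addr0 // => d; rewrite mem_filter => /and3P[dd0 fd dD]; exact: Wother.
(* With n at least 9 there are at least three triangles with a free dart, which gives the summand
   3. *)
have := card_free_triangles; move: total; rewrite sum0.
by move: (count _ _) => c; move: n9; lia.
Qed.

End MilnorWood.

(** * Surfaces spanning the torus knot *)

Section TorusKnotSurfaces.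
Variables (R : realType) (k : nat).
Let pn := (k + 5)%N.
Let pn_gt3 : (3 < pn)%N. Proof. by rewrite /pn addnC. Qed.
Let V3 : normedModType R := 'rV[R]_3.
Let p : R := (pn%:Z)%:~R.
Let q : R := p - 1.
Let N : R := euler_num R pn.
Let Q : 'I_(2 * pn) -> V3 := torus_polygon R (pn := pn).
Let tstd : V3 -> R -> V3 -> R := std pn (torus_level (R := R) pn) (torus_al (R := R)) (torus_ga (R := R) pn).

(** The parameter fixed by the meridian in [glue_knot], followed along the knot by means of the
    continuous longitude. *)
Definition base_value (j : 'I_(2 * pn)) (t : R) : R := q^-1 - N / q * longitude pn j t.

Let pz_gt3 : 3 < pn%:Z. Proof. by rewrite /pn; lia. Qed.

Let q_neq0 : q != 0.
Proof.
rewrite /q /p subr_eq0; apply/eqP => /eqP; rewrite -[1]/(1%:~R) eqr_int /pn.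
by lia.
Qed.

Lemma base_value_adm (j : 'I_(2 * pn)) t : 0 <= t <= 1 ->
  adm pn (torus_al (R := R)) (torus_ga (R := R) pn) (polygon Q) (edge_point Q j t) (base_value j t).
Proof.
by move=> t01; right; exists (longitude pn j t) => //; exact: (edge_knot_lift pn_gt3).
Qed.

Lemma base_value_flat j t : 0 <= t <= 1 -> exists2 r : R, 0 < r &
  flat tstd (~` polygon Q `&` nball (edge_point Q j t : V3) r)
    (tstd (edge_point Q j t) (base_value j t)).
Proof.
move=> t01; apply: (flat_knot pz_gt3 (continuous_torus_level pn_gt3)) (base_value_adm j t01).
- by move=> x e; exact: (torus_al_cvg pn_gt3).
- by move=> x e; exact: (torus_ga_cvg pn_gt3).
- by move=> x; exact: (torus_knot_polygon pn_gt3).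
Qed.

Lemma base_value_local j t : 0 <= t <= 1 -> exists2 d : R, 0 < d &
  forall t', 0 <= t' <= 1 -> `|t' - t| < d -> \forall z \near (edge_point Q j t' : V3),
    tstd (edge_point Q j t) (base_value j t) z = tstd (edge_point Q j t') (base_value j t') z.
Proof.
move=> t01.
have /near_normP[r r0 H] := std_compat_adm pz_gt3 (continuous_torus_level pn_gt3)
  (fun x e => torus_al_cvg pn_gt3 (x := x) (e := e))
  (fun x e => torus_ga_cvg pn_gt3 (x := x) (e := e))
  (fun x => torus_knot_polygon pn_gt3 (x := x)) (edge_point Q j t : V3).
have [d1 d10 hd1] := segment_near (Q j) (Q (ordS j)) r0.
have /near_normP[d2 d20 hd2] : \forall t' \near t, `|longitude pn j t' - longitude pn j t| < 1 / 2.
  have /cvgr_dist_lt h := @continuous_longitude R pn j t.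
  by apply: filterS (h (1 / 2) _) => [t'|]; [rewrite distrC|rewrite divr_gt0].
exists (Num.min d1 d2) => [|t' t'01]; first by rewrite lt_min d10.
rewrite lt_min => /andP[/hd1 near_t /hd2 near_L].
have [v' [v'E h]] := H (edge_point Q j t') near_t _ (base_value_adm j t01).
suff -> : base_value j t' = v' by [].
rewrite v'E; last by rewrite (torus_level_edge pn_gt3).
have [i [_ [-> _]]] := edge_knot_lift pn_gt3 j t01.
have [i' [_ [-> _]]] := edge_knot_lift pn_gt3 j t'01.
rewrite (@cfrac_uniq _ _ (longitude pn j t' - longitude pn j t) (i' - i)) //.
  by rewrite /base_value -/p -/q -/N; ring.
by rewrite intrB; ring.
Qed.

Definition euler_nat := (pn * (pn - 1) - pn - (pn - 1))%N.

Lemma euler_natE : N = euler_nat%:R.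
Proof.
rewrite /N /euler_num /euler_nat /pn.
have -> : ((k + 5) * (k + 5 - 1) - (k + 5) - (k + 5 - 1))%N = (k * k + 7 * k + 11)%N by nia.
have -> : (k + 5)%N%:Z%:~R = k%:R + 5 :> R by rewrite -pmulrn natrD.
by rewrite !natrD !natrM; ring.
Qed.

Let lt_last : (2 * pn - 1 < 2 * pn)%N. Proof. by rewrite /pn; lia. Qed.

(** Longitudes of successive edges match; closing up after one circuit drops q, which the slope N/q
    converts into the integer N. *)
Lemma base_value_end j : base_value (ordS j) 0 =
  base_value j 1 + (if j == Ordinal lt_last then euler_nat else 0%N)%:R.
Proof.
rewrite /base_value (longitude_end R pn_gt3).
have [->|jl] := eqVneq j (Ordinal lt_last).
  have -> : ordS (Ordinal lt_last) = 0%N :> nat.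
    by rewrite /= subn1 prednK ?modnn // /pn; lia.
  have -> : (Ordinal lt_last).+1 = (2 * pn)%N by rewrite /= subn1 prednK // /pn; lia.
  rewrite (longitude_period R pn_gt3) -/p -/q -euler_natE.
  have E : N / q * q = N by rewrite divfK.
  by rewrite -[X in _ = _ + X]E; ring.
have -> : ordS j = j.+1 :> nat.
  rewrite /= modn_small //; have := ltn_ord j.
  by move: jl; rewrite -val_eqE /=; lia.
by rewrite addr0.
Qed.

Lemma torus_knot_triangles (T : {fset {fset 'rV[R]_3}}) o :
  embedded_triangulated_surface T -> orientation T o ->
  surface_boundary (carrier T) = polygon Q -> (2 * euler_nat + 3 <= #|` T|)%N.
Proof.
move=> [hT _] ho hS.
apply: (@milnor_wood R (2 * pn) Q (Ordinal lt_last) euler_nat _ _ tstd base_value _ _ _ _ _ _ _ T o) => //.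
- exact: (torus_polygon_embedded pn_gt3).
- by move=> i j t t' u u' c; exact: (torus_edges_direction pn_gt3).
- by move=> x z v w; exact: (std_lt pz_gt3).
- by move=> x z u; exact: (std_surj pz_gt3).
- by move=> x v z; exact: stdD1.
- move=> x nx; apply: (std_compat pz_gt3 (continuous_torus_level pn_gt3)) nx.
  + by move=> y e; exact: (torus_al_cvg pn_gt3).
  + by move=> y e; exact: (torus_ga_cvg pn_gt3).
  + by move=> y; exact: (torus_knot_polygon pn_gt3).
- exact: base_value_flat.
- exact: base_value_local.
- exact: base_value_end.
- by rewrite /pn; lia.
Qed.

End TorusKnotSurfaces.

Theorem theorem1p2 (R : realType) :
  exists n_ : nat -> nat,
    [/\ forall k, (0 < n_ k)%N,
        n_ k @[k --> \oo] --> \oo &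
        forall k, exists P : 'I_(n_ k) -> 'rV[R]_3,
          embedded_polygon P /\
          forall (T : {fset {fset 'rV[R]_3}})
            (o : {fset 'rV[R]_3} -> 'rV[R]_3 * 'rV[R]_3 * 'rV[R]_3),
            embedded_triangulated_surface T ->
            orientation T o ->
            surface_boundary (carrier T) = polygon P ->
            (n_ k)%:R ^+ 2 / 2 - 3 * (n_ k)%:R + 5 <= #|` T|%:R :> R].
Proof.
(* p = k + 5 makes n = 2p at least 10, enough for three triangles with an edge on the knot. *)
exists (fun k => 2 * (k + 5))%N; split.
- by move=> k; lia.
- apply/cvgnyPge => A; exists A => // k /= Ak; lia.
move=> k; exists (torus_polygon R (pn := k + 5)); split.
  by apply: torus_polygon_embedded; lia.
move=> T o hT ho hS; have := torus_knot_triangles hT ho hS.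
rewrite -(ler_nat R) natrD natrM -euler_natE /euler_num; apply: le_trans.
have -> : (k + 5)%N%:Z%:~R = (k + 5)%N%:R :> R by rewrite -pmulrn.
rewrite natrM; set x : R := (k + 5)%N%:R.
have -> // : (2 * x) ^+ 2 / 2 - 3 * (2 * x) + 5 = 2 * (x * (x - 1) - x - (x - 1)) + 3 by field.
Qed.
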